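(* (1) Let $D_1$ be the class of all groups that are isomorphic to a direct product of a finitely generated Abelian group with a finite group. Then the uniform epimorphism problem onto $D_1$ is solvable, i.e., there exists an algorithm that takes as input a finite presentation $\langle S\mid R\rangle$ (of an arbitrary finitely presented group) and a finite presentation $\langle S'\mid R'\rangle$ of a group in $D_1$, and that determines whether there exists a group epimorphism $|\langle S\mid R\rangle|\to|\langle S'\mid R'\rangle|$ or not. (2) Let $D_2$ be the class of all virtually cyclic groups. Then the uniform epimorphism problem onto $D_2$ is solvable, i.e., there exists an algorithm that takes as input a finite presentation $\langle S\mid R\rangle$ (of an arbitrary finitely presented group) and a finite presentation $\langle S'\mid R'\rangle$ of a group in $D_2$, and that determines whether there exists a group epimorphism $|\langle S\mid R\rangle|\to|\langle S'\mid R'\rangle|$ or not.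
   Context: A group presentation $\langle S\mid R\rangle$ is a pair consisting of a set $S$ and a subset $R$ of the free group $\mathrm{Free}(S)$; it is finite if $S$ and $R$ are finite. The group described by it is $|\langle S\mid R\rangle| := \mathrm{Free}(S)/\langle R\rangle^{\triangleleft}$, the quotient by the normal closure of $R$ in $\mathrm{Free}(S)$. For a class $D$ of finitely presented groups, the uniform epimorphism problem onto $D$ is the problem of deciding, given as input a finite presentation of an arbitrary finitely presented group $\Gamma$ and a finite presentation of a group $\Lambda$ that belongs to $D$, whether there exists an epimorphism $\Gamma\to\Lambda$. The algorithm is only required to work correctly (and terminate) on inputs whose second presentation is a presentation of a group in $D$. A group is virtually cyclic if it contains a cyclic subgroup of finite index. *)

(* Defs.v *)
From HB Require Import structures.
From mathcomp Require Import fingroup.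
From mathcomp Require Import all_boot.
From mathcomp Require Import boolp classical_sets cardinality.

Set Implicit Arguments.
Unset Strict Implicit.
Unset Printing Implicit Defensive.

Local Open Scope group_scope.
Local Open Scope quotient_scope.
Local Open Scope classical_set_scope.

Section Subgroups.
Variable G : groupType.
Implicit Types (A C H R : set G) (x : G).

Definition is_subgroup H : Prop :=
  [/\ H 1, forall x y, H x -> H y -> H (x * y) & forall x, H x -> H x^-1].

Definition is_normal_subgroup H : Prop :=
  is_subgroup H /\ forall x y, H x -> H (x ^ y).

Definition generated A : set G :=
  \bigcap_(H in [set H | is_subgroup H /\ A `<=` H]) H.

Definition normal_closure R : set G :=
  \bigcap_(H in [set H | is_normal_subgroup H /\ R `<=` H]) H.

Definition finite_index H : Prop :=
  finite_set (range (fun x => [set x * h | h in H])).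

Definition is_cyclic C : Prop := exists g, C = generated [set g].

End Subgroups.

Definition abelian_group (G : groupType) : Prop := forall x y : G, commute x y.

Definition finitely_generated (G : groupType) : Prop :=
  exists2 A : set G, finite_set A & generated A = [set: G].

Definition virtually_cyclic (G : groupType) : Prop :=
  exists2 C : set G, is_cyclic C & finite_index C.

Definition group_isomorphic (G H : groupType) : Prop :=
  exists f : {multiplicative G -> H}, bijective f.

Definition group_epimorphism (G H : groupType) : Prop :=
  exists f : {multiplicative G -> H}, range f = [set: H].

Definition fg_abelian_times_finite (G : groupType) : Prop :=
  exists (A : groupType) (F : finGroupType),
    [/\ abelian_group A, finitely_generated A
      & group_isomorphic G (A * F)%type].

(* Elements of the free group are reduced words; the letter (s, false) stands *)
(* for the generator s and (s, true) for its inverse.                         *)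
Section FreeGroup.
Variable S : choiceType.
Implicit Types (a b : S * bool) (u v w : seq (S * bool)).

Definition inv_letter a : S * bool := (a.1, ~~ a.2).

Definition reduced w : bool := sorted (fun a b => b != inv_letter a) w.

Definition cons_reduce a w : seq (S * bool) :=
  if w is b :: w' then if b == inv_letter a then w' else a :: w else [:: a].

Definition reduce w : seq (S * bool) := foldr cons_reduce [::] w.

Definition inv_word w : seq (S * bool) := rev (map inv_letter w).

Lemma inv_letterK : involutive inv_letter.
Proof. by case=> s b; rewrite /inv_letter /= negbK. Qed.

Lemma reduced_behead a w : reduced (a :: w) -> reduced w.
Proof. by case: w => //= b w /andP[]. Qed.

Lemma reduced_cons_reduce a w : reduced w -> reduced (cons_reduce a w).
Proof.
case: w => [|b w] //= red_w; case: eqP => [_|/eqP ne_ba] /=.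
  exact: reduced_behead red_w.
by rewrite ne_ba.
Qed.

Lemma reduced_foldr u w : reduced w -> reduced (foldr cons_reduce w u).
Proof. by move=> red_w; elim: u => //= a u; apply: reduced_cons_reduce. Qed.

Lemma reduced_reduce w : reduced (reduce w).
Proof. exact: reduced_foldr. Qed.

Lemma cons_reduceK a w :
  reduced w -> cons_reduce a (cons_reduce (inv_letter a) w) = w.
Proof.
case: w => [|b w] /=; first by rewrite eqxx.
rewrite inv_letterK; have [->|ne_ba] := eqVneq b a; last by rewrite /= eqxx.
by case: w => [|c w] //= /andP[/negPf->].
Qed.

Lemma foldr_cons_reduce a u w : reduced w ->
  foldr cons_reduce w (cons_reduce a u) = cons_reduce a (foldr cons_reduce w u).
Proof.
case: u => [|b u] //= red_w; have [->|//] := eqVneq b (inv_letter a).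
by rewrite cons_reduceK // reduced_foldr.
Qed.

Lemma foldr_reduce u w : reduced w ->
  foldr cons_reduce w (reduce u) = foldr cons_reduce w u.
Proof.
by move=> red_w; elim: u => //= a u IHu; rewrite foldr_cons_reduce // IHu.
Qed.

Lemma reduce_id w : reduced w -> reduce w = w.
Proof.
elim: w => //= a w IHw red_w; rewrite IHw ?(reduced_behead red_w) //.
by case: w red_w {IHw} => //= b w /andP[/negPf->].
Qed.

Lemma reduce_catl u v : reduce (reduce u ++ v) = reduce (u ++ v).
Proof.
by rewrite /reduce !foldr_cat foldr_reduce //; apply: reduced_reduce.
Qed.

Lemma reduce_catr u v : reduce (u ++ reduce v) = reduce (u ++ v).
Proof.
by rewrite /reduce !foldr_cat -/(reduce (reduce v)) reduce_id ?reduced_reduce.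
Qed.

Lemma inv_wordK : involutive inv_word.
Proof. by move=> w; rewrite /inv_word map_rev revK (mapK inv_letterK). Qed.

Lemma reduced_inv_word w : reduced w -> reduced (inv_word w).
Proof.
rewrite /reduced /inv_word rev_sorted sorted_map; apply: sub_sorted => a b /=.
by apply: contra => /eqP ->; rewrite inv_letterK.
Qed.

Lemma reduce_inv_wordr w : reduce (w ++ inv_word w) = [::].
Proof.
elim: w => //= a w IHw; rewrite /inv_word /= rev_cons -cats1 catA.
by rewrite -reduce_catl IHw /= eqxx.
Qed.

Lemma reduce_inv_wordl w : reduce (inv_word w ++ w) = [::].
Proof. by rewrite -{2}(inv_wordK w) reduce_inv_wordr. Qed.

Record free_group := FreeGroup {
  fg_word :> seq (S * bool);
  fg_reduced : reduced fg_word
}.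

HB.instance Definition _ := [isSub for fg_word].
HB.instance Definition _ := [Choice of free_group by <:].

Definition fg_one : free_group := @FreeGroup [::] isT.
Definition fg_mul (x y : free_group) : free_group :=
  FreeGroup (reduced_reduce (fg_word x ++ fg_word y)).
Definition fg_inv (x : free_group) : free_group :=
  FreeGroup (reduced_inv_word (fg_reduced x)).

Lemma fg_mulA : associative fg_mul.
Proof.
by move=> x y z; apply: val_inj; rewrite /= reduce_catl reduce_catr catA.
Qed.

Lemma fg_mul1 : left_id fg_one fg_mul.
Proof. by move=> x; apply/val_inj/reduce_id/fg_reduced. Qed.

Lemma fg_mulr1 : right_id fg_one fg_mul.
Proof.
by move=> x; apply: val_inj; rewrite /= cats0; apply/reduce_id/fg_reduced.
Qed.

Lemma fg_mulV : left_inverse fg_one fg_inv fg_mul.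
Proof. by move=> x; apply/val_inj/reduce_inv_wordl. Qed.

Lemma fg_mulrV : right_inverse fg_one fg_inv fg_mul.
Proof. by move=> x; apply/val_inj/reduce_inv_wordr. Qed.

HB.instance Definition _ :=
  isGroup.Build free_group fg_mulA fg_mul1 fg_mulr1 fg_mulV fg_mulrV.

End FreeGroup.

Section PresentedGroup.
Variables (S : choiceType) (R : set (free_group S)).
Implicit Types x y z : free_group S.

Lemma normal_closure_normal : is_normal_subgroup (normal_closure R).
Proof.
split; first split.
- by move=> H [[[H1 _ _] _] _]; exact: H1.
- move=> x y Nx Ny H HR; have [[[_ HM _] _] _] := HR.
  exact: HM (Nx H HR) (Ny H HR).
- by move=> x Nx H HR; have [[[_ _ HV] _] _] := HR; exact: HV (Nx H HR).
- by move=> x y Nx H HR; have [[_ HJ] _] := HR; exact: HJ (Nx H HR).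
Qed.

Let N1 : normal_closure R 1.
Proof. by have [[]] := normal_closure_normal. Qed.
Let NM x y :
  normal_closure R x -> normal_closure R y -> normal_closure R (x * y).
Proof. by have [[_ NM _] _] := normal_closure_normal; apply: NM. Qed.
Let NV x : normal_closure R x -> normal_closure R x^-1.
Proof. by have [[_ _ NV] _] := normal_closure_normal; apply: NV. Qed.
Let NJ x y : normal_closure R x -> normal_closure R (x ^ y).
Proof. by have [_ NJ] := normal_closure_normal; apply: NJ. Qed.

Definition pres_rel : rel (free_group S) :=
  fun x y => `[< normal_closure R (x^-1 * y) >].

Lemma pres_rel_refl : reflexive pres_rel.
Proof. by move=> x; apply/asboolP; rewrite mulVg. Qed.

Lemma pres_rel_sym : symmetric pres_rel.
Proof.
by move=> x y; apply/asbool_equiv_eq; split=> /NV; rewrite invgM invgK.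
Qed.

Lemma pres_rel_trans : transitive pres_rel.
Proof.
move=> y x z /asboolP xy /asboolP yz; apply/asboolP.
by have := NM xy yz; rewrite -mulgA mulVKg.
Qed.

Canonical pres_equiv := EquivRel pres_rel
  pres_rel_refl pres_rel_sym pres_rel_trans.

Definition presented_group := {eq_quot pres_equiv}.

HB.instance Definition _ := Choice.on presented_group.
HB.instance Definition _ := EqQuotient.on presented_group.

Definition pres_class (x : free_group S) : presented_group :=
  \pi_presented_group x.

Definition pres_one : presented_group := pres_class 1.
Definition pres_mul (X Y : presented_group) : presented_group :=
  pres_class (repr X * repr Y).
Definition pres_inv (X : presented_group) : presented_group :=
  pres_class (repr X)^-1.

Lemma pres_classP x y :
  pres_class x = pres_class y <-> normal_closure R (x^-1 * y).
Proof.
split; first by move/eqquotP/asboolP.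
by move=> xy; apply/eqquotP/asboolP.
Qed.

Lemma pres_classK (X : presented_group) : pres_class (repr X) = X.
Proof. exact: reprK. Qed.

Lemma pres_classM x y :
  pres_mul (pres_class x) (pres_class y) = pres_class (x * y).
Proof.
apply/pres_classP; set x' := repr _; set y' := repr _.
have /pres_classP xx : pres_class x' = pres_class x by apply: pres_classK.
have /pres_classP yy : pres_class y' = pres_class y by apply: pres_classK.
have := NM (NJ y' xx) yy.
by rewrite /conjg invgM !mulgA mulgK.
Qed.

Lemma pres_classV x : pres_inv (pres_class x) = pres_class x^-1.
Proof.
apply/pres_classP; set x' := repr _.
have /pres_classP xx : pres_class x' = pres_class x by apply: pres_classK.
by have := NJ x^-1 (NV xx); rewrite /conjg invgM !invgK !mulgA mulgV mul1g.
Qed.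

Lemma pres_mulA : associative pres_mul.
Proof.
move=> X Y Z; rewrite -(pres_classK X) -(pres_classK Y) -(pres_classK Z).
by rewrite !pres_classM mulgA.
Qed.

Lemma pres_mul1 : left_id pres_one pres_mul.
Proof. by move=> X; rewrite -(pres_classK X) pres_classM mul1g. Qed.

Lemma pres_mulr1 : right_id pres_one pres_mul.
Proof. by move=> X; rewrite -(pres_classK X) pres_classM mulg1. Qed.

Lemma pres_mulV : left_inverse pres_one pres_inv pres_mul.
Proof. by move=> X; rewrite -(pres_classK X) pres_classV pres_classM mulVg. Qed.

Lemma pres_mulrV : right_inverse pres_one pres_inv pres_mul.
Proof. by move=> X; rewrite -(pres_classK X) pres_classV pres_classM mulgV. Qed.

HB.instance Definition _ := isGroup.Build presented_group
  pres_mulA pres_mul1 pres_mulr1 pres_mulV pres_mulrV.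

End PresentedGroup.

Record finite_presentation := FinitePresentation {
  ngens : nat;
  relators : seq (free_group 'I_ngens)
}.

Definition group_of (P : finite_presentation) : groupType :=
  presented_group [set` relators P].

(* Kleene's partial recursive functions, without arities: an argument that is *)
(* missing from the list is read as 0, and superfluous ones are ignored.      *)
Inductive program : Type :=
  | Zero
  | Succ
  | Proj of nat
  | Comp of program & seq program
  | PrimRec of program & program
  | Mu of program.

(* computes p xs y means that p, run on xs, halts with output y. PrimRec   *)
(* recurses on the first argument; Mu f searches for a value to put in front. *)
Fixpoint computes (p : program) : seq nat -> nat -> Prop :=
  match p with
  | Zero => fun xs y => y = 0
  | Succ => fun xs y => y = (head 0 xs).+1
  | Proj i => fun xs y => y = nth 0 xs i
  | Comp f gs => fun xs y =>
      exists2 zs : seq nat,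
        (fix computes_all (gs : seq program) (zs : seq nat) : Prop :=
           match gs, zs with
           | [::], [::] => True
           | g :: gs', z :: zs' => computes g xs z /\ computes_all gs' zs'
           | _, _ => False
           end) gs zs
        & computes f zs y
  | PrimRec f g => fun xs =>
      (fix iterate (n : nat) : nat -> Prop :=
         match n with
         | 0 => computes f (behead xs)
         | m.+1 => fun y =>
             exists2 z, iterate m z & computes g [:: m, z & behead xs] y
         end) (head 0 xs)
  | Mu f => fun xs y =>
      computes f (y :: xs) 0 /\
      forall m, (m < y)%N -> exists z, computes f (m :: xs) z.+1
  end.

Fixpoint computes_functional (p : program) :
  forall xs y y', computes p xs y -> computes p xs y' -> y = y'.
Proof.
case: p => [||i|f gs|f g|f] xs y y' /=.
- by move=> -> ->.
- by move=> -> ->.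
- by move=> -> ->.
- move=> [zs gzs fy] [zs' gzs' fy'].
  suff eq_zs : zs = zs'.
    by rewrite -eq_zs in fy'; apply: computes_functional fy fy'.
  elim: gs zs zs' gzs gzs' {fy fy'} => [|g gs IHgs] [|z zs] [|z' zs'] //=.
  move=> [gz gzs] [gz' gzs']; congr (_ :: _); last exact: IHgs.
  exact: computes_functional gz gz'.
- elim: (head 0 xs) y y' => [|m IHm] y y'; first exact: computes_functional.
  move=> [z mz gy] [z' mz' gy']; have eq_z := IHm _ _ mz mz'.
  by rewrite -eq_z in gy'; apply: computes_functional gy gy'.
- move=> [fy lt_y] [fy' lt_y']; case: (ltngtP y y') => // [/lt_y'|/lt_y] [z fz].
    by have := computes_functional f _ _ _ fy fz.
  by have := computes_functional f _ _ _ fy' fz.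
Qed.

(* Inputs are passed to programs as Goedel numbers, by iterating the          *)
(* bijection CodeSeq.code : seq nat -> nat.                                   *)
Definition letter_code n (a : 'I_n * bool) : nat := (a.1 : nat).*2 + a.2.

Definition word_code n (x : free_group 'I_n) : nat :=
  CodeSeq.code [seq letter_code a | a <- fg_word x].

Definition presentation_code (P : finite_presentation) : nat :=
  CodeSeq.code
    [:: ngens P; CodeSeq.code [seq word_code r | r <- relators P]].

(* The program need not halt when the group of Q is not in D.                 *)
Definition uniform_epimorphism_problem_solvable (D : groupType -> Prop) : Prop :=
  exists p : program, forall P Q : finite_presentation, D (group_of Q) ->
    let input := [:: presentation_code P; presentation_code Q] in
    (group_epimorphism (group_of P) (group_of Q) -> computes p input 1%N) /\
    (~ group_epimorphism (group_of P) (group_of Q) -> computes p input 0%N).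

(* Main.v *)
From HB Require Import structures.
From mathcomp Require Import fingroup.
From mathcomp Require Import all_boot all_order all_algebra.
From mathcomp Require Import boolp classical_sets cardinality.
From mathcomp Require Import zify ring.
Require Import Defs.

(** Call a predicate of codes semidecidable if it is the projection of a total
recursive relation. One program solves both problems: it looks for a certificate
that an epimorphism G -> L exists and, in the same loop, for a certificate that
none exists, and it answers according to which one turns up
([search_program]). So it is enough to have two semidecidable predicates, one
equivalent to existence for all presentations, the other one implying
non-existence for all presentations and implied by it when L is in the class.

Existence is certified by words for the images of the generators of G, words
that express the generators of L through these images, and derivations of the
trivial words that this requires ([epimorphism_null]).

Non-existence is certified by a finite quotient E of L, given by its
multiplication table, together with a reason, for each tuple of elements of E
indexed by the generators of G, why no epimorphism G -> L induces this tuple: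
(1) a relator of G does not hold, (2) the tuple does not generate, or (3) an
argument about translations that is explained below. This is [obstruction].

Let L be the product of Z^r and a finite group F. Then (1) and (2) are enough. If
for a suitable m there is an epimorphism from G onto (Z/m)^r x F, its component
onto F can be kept, and Smith normal forms turn its component onto (Z/m)^r into
a homomorphism to Z^r which is still onto on the kernel of G -> F
([unimodular_combination], [lattice_epimorphism]).

Let L be virtually cyclic and infinite. Finite quotients no longer suffice: there
are virtually cyclic groups that are not isomorphic but have the same finite
quotients. A twisted transfer ([signed_transfer]) maps L, with finite kernel, to
the group [zpm] of maps x |-> a + x and x |-> a - x of Z, and all translations by
integers can be assumed to be in the image. Homomorphisms from G to [zpm] with
prescribed signs are cocycles G -> Z. They form a lattice, and after division by
the coboundaries this lattice has some rank k. Up to a bounded factor, a cocycle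
modulo m lifts to an integral one ([int_kernel_split]), so that a homomorphism
from G onto a deep finite quotient of L lifts to an epimorphism onto L as soon
as its cocycle is congruent to one that takes the value 1 on a word of positive
sign. For k >= 2 that is always possible ([unimodular_lift]), for k = 0 there is
no homomorphism onto a deep quotient, and for k = 1 all surjective cocycles agree
up to sign on words of positive sign. Reason (3) is this last case: there is a
word of positive sign whose value under any epimorphism has to be 1 or -1, while
the tuple gives it another value modulo m. That k is at most 1 can be seen modulo
one integer N > 1, because the descent [cocycle_descent] goes from N to all
powers of N. *)

Set Implicit Arguments.
Unset Strict Implicit.
Unset Printing Implicit Defensive.

Local Open Scope group_scope.
Local Open Scope nat_scope.

(** * Recursive functions and semidecidable predicates *)

Notation env := (nat -> nat).

(** The program receives the first n values of the environment. Environments are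
functions rather than lists so that entering a binder, which shifts the indices,
is a beta reduction. *)
Definition computable n (f : env -> nat) : Prop :=
  exists p, forall e, computes p (mkseq e n) (f e).

Lemma computable_var n k : k < n -> computable n (fun e => e k).
Proof. by move=> lt_kn; exists (Proj k) => e /=; rewrite nth_mkseq. Qed.

Lemma computable_subst k n (h : env -> nat) (x : nat -> env -> nat) :
  computable k h -> (forall i, i < k -> computable n (x i)) ->
  computable n (fun e => h (fun i => x i e)).
Proof.
move=> [p hp] cx.
have /choice[q xq] : forall i, exists q, i < k ->
    forall e, computes q (mkseq e n) (x i e).
  move=> i; have [/cx [q xq]|_] := boolP (i < k); first by exists q.
  by exists Zero.
exists (Comp p (mkseq q k)) => e /=.
exists (mkseq (fun i => x i e) k) => //.
have: forall i, i < k -> computes (q i) (mkseq e n) (x i e) by move=> i /xq.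
rewrite /mkseq; have : forall i, i \in iota 0 k -> i < k.
  by move=> i; rewrite mem_iota.
elim: (iota 0 k) => //= i s IHs lt_k qx; split.
  by apply: qx; apply: lt_k; rewrite mem_head.
by apply: IHs => // j sj; apply: lt_k; rewrite inE sj orbT.
Qed.

Lemma computable_comp1 (h : nat -> nat) : computable 1 (fun e => h (e 0)) ->
  forall n f, computable n f -> computable n (fun e => h (f e)).
Proof.
by move=> ch n f cf; apply: (computable_subst (x := fun=> f) ch) => -[].
Qed.

Lemma computable_comp2 (h : nat -> nat -> nat) :
  computable 2 (fun e => h (e 0) (e 1)) ->
  forall n f g, computable n f -> computable n g ->
  computable n (fun e => h (f e) (g e)).
Proof.
move=> ch n f g cf cg.
by apply: (computable_subst (x := fun i => if i is 0 then f else g) ch) => -[|[]].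
Qed.

Lemma computable_shift n f :
  computable n f -> computable n.+1 (fun e => f (fun k => e k.+1)).
Proof.
by move=> cf; apply: (computable_subst cf (x := fun i e => e i.+1)) => i lt_in; apply: computable_var.
Qed.

Lemma computable_succ n f : computable n f -> computable n (fun e => (f e).+1).
Proof.
by move: n f; apply: computable_comp1; exists Succ.
Qed.

Lemma computable_cst n c : computable n (fun=> c).
Proof. by elim: c => [|c]; [exists Zero | apply: computable_succ]. Qed.

Lemma computable_primrec n b (st : nat -> nat -> env -> nat) k :
  computable n b -> computable n.+2 (fun e => st (e 0) (e 1) (fun i => e i.+2)) ->
  computable n k ->
  computable n (fun e => nat_rect (fun=> nat) (b e) (fun m z => st m z e) (k e)).
Proof.
move=> [p bp] [q stq] ck.
suff ch : computable n.+1 (fun e => nat_rect (fun=> nat) (b (fun i => e i.+1))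
    (fun m z => st m z (fun i => e i.+1)) (e 0)).
  by apply: (computable_subst (x := fun i e => if i is j.+1 then e j else k e) ch) => -[|i] // lt_in; apply: computable_var.
exists (PrimRec p q) => e /=.
have -> : map e (iota 1 n) = mkseq (fun i => e i.+1) n.
  by rewrite /mkseq -(addn0 1) iotaDl -map_comp.
elim: (e 0) => [|m IHm] /=; first exact: bp.
exists (nat_rect (fun=> nat) (b (fun i => e i.+1)) (fun m z => st m z (fun i => e i.+1)) m) => //.
set z := nat_rect _ _ _ _.
have := stq (fun i => if i is i'.+1 then if i' is i''.+1 then e i''.+1 else z else m).
rewrite {1}/mkseq /= -(addn0 2) iotaDl -map_comp.
congr (computes q [:: m, z & _] _); rewrite /mkseq; exact: eq_map.
Qed.

(** Only total functions occur, so minimization can be used without domains: g is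
any function that returns the first zero of f. *)
Lemma computable_mu n (f : nat -> env -> nat) g :
  computable n.+1 (fun e => f (e 0) (fun i => e i.+1)) ->
  (forall e, f (g e) e = 0 /\ forall m, m < g e -> f m e <> 0) ->
  computable n g.
Proof.
move=> [p fp] mug; exists (Mu p) => e /=.
have fpE m : computes p (m :: mkseq e n) (f m e).
  have := fp (fun i => if i is j.+1 then e j else m).
  by rewrite /mkseq /= -(addn0 1) iotaDl -map_comp.
have [f0 fm] := mug e; split; first by have := fpE (g e); rewrite f0.
move=> m /fm fm0; exists (f m e).-1.
by have := fpE m; case: (f m e) fm0.
Qed.

Lemma computable_add n f g : computable n f -> computable n g ->
  computable n (fun e => f e + g e).
Proof.
move: n f g; apply: computable_comp2.
have -> : (fun e : env => e 0 + e 1) =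
    (fun e => nat_rect (fun=> nat) (e 1) (fun m z => z.+1) (e 0)).
  by apply: funext => e; elim: (e 0) => //= m <-.
apply: (@computable_primrec 2 (fun e => e 1) (fun m z e => z.+1));
  by [exact: computable_var | apply: computable_succ; apply: computable_var].
Qed.

Lemma computable_pred n f : computable n f -> computable n (fun e => (f e).-1).
Proof.
move: n f; apply: computable_comp1.
have -> : (fun e : env => (e 0).-1) =
    (fun e => nat_rect (fun=> nat) 0 (fun m z => m) (e 0)).
  by apply: funext => e; case: (e 0).
by apply: (@computable_primrec 1 (fun=> 0) (fun m z e => m));
  [exact: computable_cst | exact: computable_var..].
Qed.

Lemma computable_sub n f g : computable n f -> computable n g ->
  computable n (fun e => f e - g e).
Proof.
move: n f g; apply: computable_comp2.
have -> : (fun e : env => e 0 - e 1) =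
    (fun e => nat_rect (fun=> nat) (e 0) (fun m z => z.-1) (e 1)).
  by apply: funext => e; elim: (e 1) => /= [|m <-]; rewrite ?subn0 ?subnS.
apply: (@computable_primrec 2 (fun e => e 0) (fun m z e => z.-1));
  by [exact: computable_var | apply: computable_pred; apply: computable_var].
Qed.

Lemma computable_mul n f g : computable n f -> computable n g ->
  computable n (fun e => f e * g e).
Proof.
move: n f g; apply: computable_comp2.
have -> : (fun e : env => e 0 * e 1) =
    (fun e => nat_rect (fun=> nat) 0 (fun m z => z + e 1) (e 0)).
  by apply: funext => e; elim: (e 0) => //= m <-; rewrite mulSn addnC.
apply: (@computable_primrec 2 (fun=> 0) (fun m z e => z + e 1)).
- exact: computable_cst.
- by apply: computable_add; apply: computable_var.
exact: computable_var.
Qed.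

Lemma computable_exp n f g : computable n f -> computable n g ->
  computable n (fun e => f e ^ g e).
Proof.
move: n f g; apply: computable_comp2.
have -> : (fun e : env => e 0 ^ e 1) =
    (fun e => nat_rect (fun=> nat) 1 (fun m z => z * e 0) (e 1)).
  by apply: funext => e; elim: (e 1) => //= m <-; rewrite expnSr.
apply: (@computable_primrec 2 (fun=> 1) (fun m z e => z * e 0)).
- exact: computable_cst.
- by apply: computable_mul; apply: computable_var.
exact: computable_var.
Qed.

Lemma computable_div n f g : computable n f -> computable n g ->
  computable n (fun e => f e %/ g e).
Proof.
move: n f g; apply: computable_comp2.
apply: (computable_mu (f := fun q e => e 1 * ((e 0).+1 - q.+1 * e 1))).
  by apply: computable_mul; [|apply: computable_sub]; try apply: computable_succ;
     try apply: computable_mul; try apply: computable_succ; apply: computable_var.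
move=> e; case: (posnP (e 1)) => [->|d_gt0]; first by rewrite divn0.
split.
  apply/eqP; rewrite muln_eq0 -[_.+1 - _ == 0]/(_.+1 <= _).
  by rewrite -ltn_divLR // ltnS leqnn orbT.
move=> m; rewrite leq_divRL // => le_m; apply/eqP.
by rewrite muln_eq0 negb_or -lt0n d_gt0 subn_eq0 -leqNgt.
Qed.

Lemma computable_mod n f g : computable n f -> computable n g ->
  computable n (fun e => f e %% g e).
Proof.
move=> cf cg; rewrite (_ : (fun e => _) = (fun e => f e - f e %/ g e * g e)).
  by apply: computable_sub => //; apply: computable_mul => //; apply: computable_div.
by apply: funext => e; rewrite {2}(divn_eq (f e) (g e)) addKn.
Qed.

(** Finite sequences of numbers are the only data structure: words, tables and
traces of computations are all coded as nested sequences. *)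
Definition cnth c i := nth 0 (CodeSeq.decode c) i.
Definition csize c := size (CodeSeq.decode c).
Definition ccons x c := 2 ^ x * c.*2.+1.
Definition chead c := head 0 (CodeSeq.decode c).
Definition ctail c := CodeSeq.code (behead (CodeSeq.decode c)).

Lemma cconsE x c : ccons x c = CodeSeq.code (x :: CodeSeq.decode c).
Proof. by rewrite /ccons /= CodeSeq.decodeK. Qed.

Lemma computable_chead n f : computable n f -> computable n (fun e => chead (f e)).
Proof.
move: n f; apply: computable_comp1.
apply: (computable_mu (f := fun h e => e 0 * (1 - e 0 %% 2 ^ h.+1))).
  apply: computable_mul; first exact: computable_var.
  apply: computable_sub; first exact: computable_cst.
  apply: computable_mod; first exact: computable_var.
  by apply: computable_exp; [exact: computable_cst | apply: computable_succ; apply: computable_var].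
move=> e; rewrite -[e 0]CodeSeq.decodeK /chead CodeSeq.codeK.
case: (CodeSeq.decode (e 0)) => //= h t; set m := CodeSeq.code t.
split.
  apply/eqP; rewrite muln_eq0 subn_eq0 lt0n; apply/orP; right.
  by rewrite expnSr -muln_modr -lt0n muln_gt0 expn_gt0 /= modn2 /= odd_double.
move=> i lt_ih; apply/eqP; rewrite muln_eq0 negb_or muln_eq0 negb_or /= andbT.
rewrite -lt0n expn_gt0 /= -lt0n subn_gt0 ltnS leqn0.
by rewrite -/(dvdn _ _) dvdn_mulr // dvdn_exp2l.
Qed.

Lemma ctailE c : ctail c = c %/ 2 ^ chead c %/ 2.
Proof.
rewrite -{2}[c]CodeSeq.decodeK /ctail /chead.
case: (CodeSeq.decode c) => //= h t.
by rewrite mulKn ?expn_gt0 // divn2 /= uphalf_double.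
Qed.

Lemma computable_ctail n f : computable n f -> computable n (fun e => ctail (f e)).
Proof.
move=> cf; rewrite (_ : (fun e => _) = fun e => f e %/ 2 ^ chead (f e) %/ 2).
  apply: computable_div; last exact: computable_cst.
  apply: computable_div => //; apply: computable_exp; first exact: computable_cst.
  exact: computable_chead.
by apply: funext => e; rewrite ctailE.
Qed.

Lemma decode_ctail c i :
  CodeSeq.decode (nat_rect (fun=> nat) c (fun _ z => ctail z) i) = drop i (CodeSeq.decode c).
Proof.
elim: i => [|i IHi] /=; first by rewrite drop0.
by rewrite /ctail CodeSeq.codeK IHi -drop1 drop_drop.
Qed.

Lemma computable_cdrop n f g : computable n f -> computable n g ->
  computable n (fun e => nat_rect (fun=> nat) (f e) (fun _ z => ctail z) (g e)).
Proof.
move=> cf cg; apply: (@computable_primrec n f (fun _ z e => ctail z)) => //.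
by apply: computable_ctail; apply: computable_var.
Qed.

Lemma computable_cnth n f g : computable n f -> computable n g ->
  computable n (fun e => cnth (f e) (g e)).
Proof.
move=> cf cg; have := computable_chead (computable_cdrop cf cg).
congr (computable n); apply: funext => e.
by rewrite /chead decode_ctail -nth0 nth_drop addn0.
Qed.

Lemma computable_csize n f : computable n f -> computable n (fun e => csize (f e)).
Proof.
move: n f; apply: computable_comp1.
apply: (computable_mu (f := fun i e => nat_rect (fun=> nat) (e 0) (fun _ z => ctail z) i)).
  by apply: computable_cdrop; apply: computable_var.
move=> e; split.
  rewrite -[LHS]CodeSeq.decodeK decode_ctail drop_oversize //.
move=> m lt_m m0; have: 0 < size (drop m (CodeSeq.decode (e 0))).
  by rewrite size_drop subn_gt0.
by rewrite -decode_ctail m0.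
Qed.

Lemma computable_ccons n f g : computable n f -> computable n g ->
  computable n (fun e => ccons (f e) (g e)).
Proof.
move=> cf cg; rewrite (_ : (fun e => _) = fun e => 2 ^ f e * (g e * 2).+1).
  apply: computable_mul; first by apply: computable_exp => //; apply: computable_cst.
  by apply: computable_succ; apply: computable_mul => //; apply: computable_cst.
by apply: funext => e; rewrite muln2.
Qed.

Ltac solve_computable := repeat first
  [ assumption
  | simple apply computable_cst
  | simple apply computable_var; done
  | simple apply computable_succ
  | simple apply computable_add
  | simple apply computable_sub
  | simple apply computable_mul
  | simple apply computable_exp
  | simple apply computable_div
  | simple apply computable_mod
  | simple apply computable_cnth
  | simple apply computable_csize
  | simple apply computable_ccons ].

(** The number y plays the role of a certificate, to be checked by f. *)
Definition semidec n (P : env -> Prop) : Prop :=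
  exists2 f : nat -> env -> nat,
    computable n.+1 (fun e => f (e 0) (fun i => e i.+1)) &
    forall e, P e <-> exists y, f y e = 0.

Lemma semidec_ext n (P Q : env -> Prop) :
  (forall e, P e <-> Q e) -> semidec n P -> semidec n Q.
Proof. by move=> PQ [f cf fP]; exists f => // e; rewrite -PQ. Qed.

Lemma semidec_eq0 n f : computable n f -> semidec n (fun e => f e = 0).
Proof.
move=> cf; exists (fun _ e => f e); first exact: computable_shift cf.
by move=> e; split=> [|[]//]; exists 0.
Qed.

Lemma semidec_leq n f g : computable n f -> computable n g ->
  semidec n (fun e => f e <= g e).
Proof.
move=> cf cg; have /semidec_eq0 := computable_sub cf cg.
by apply: semidec_ext => e; rewrite /leq; split=> /eqP.
Qed.

Lemma semidec_eq n f g : computable n f -> computable n g ->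
  semidec n (fun e => f e = g e).
Proof.
move=> cf cg; have := computable_add (computable_sub cf cg) (computable_sub cg cf).
move/semidec_eq0; apply: semidec_ext => e; split=> [/eqP|->]; last by rewrite subnn.
by rewrite addn_eq0 !subn_eq0 -eqn_leq => /eqP.
Qed.

Lemma semidec_neq n f g : computable n f -> computable n g ->
  semidec n (fun e => f e <> g e).
Proof.
move=> cf cg; have := computable_add (computable_sub cf cg) (computable_sub cg cf).
move=> /(semidec_leq (computable_cst n 1)); apply: semidec_ext => e.
by rewrite lt0n addn_eq0 !subn_eq0 -eqn_leq; split=> /eqP.
Qed.

Lemma semidec_and n P Q : semidec n P -> semidec n Q ->
  semidec n (fun e => P e /\ Q e).
Proof.
move=> [f cf fP] [g cg gQ].
exists (fun y e => f (cnth y 0) e + g (cnth y 1) e).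
  apply: computable_add.
    apply: (computable_subst cf (x := fun i e => if i is j.+1 then e i else cnth (e 0) 0)).
    by case=> [|i] lt_in; solve_computable.
  apply: (computable_subst cg (x := fun i e => if i is j.+1 then e i else cnth (e 0) 1)).
  by case=> [|i] lt_in; solve_computable.
move=> e; rewrite fP gQ; split=> [[[y fy] [z gz]]|[y /eqP]].
  exists (CodeSeq.code [:: y; z]).
  by rewrite /cnth CodeSeq.codeK /= fy gz.
by rewrite addn_eq0 => /andP[/eqP fy /eqP gy]; split; eexists; eassumption.
Qed.

Lemma semidec_or n P Q : semidec n P -> semidec n Q ->
  semidec n (fun e => P e \/ Q e).
Proof.
move=> [f cf fP] [g cg gQ]; exists (fun y e => f y e * g y e).
  exact: computable_mul.
move=> e; rewrite fP gQ; split=> [[] [y y0]|[y /eqP]]; first by exists y; rewrite y0.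
  by exists y; rewrite y0 muln0.
by rewrite muln_eq0 => /orP[]/eqP fy; [left|right]; exists y.
Qed.

Lemma semidec_ex n (P : nat -> env -> Prop) :
  semidec n.+1 (fun e => P (e 0) (fun i => e i.+1)) ->
  semidec n (fun e => exists x, P x e).
Proof.
move=> [f cf fP].
pose sc x (e : env) i := if i is j.+1 then e j else x.
exists (fun y e => f (cnth y 1) (sc (cnth y 0) e)).
  apply: (computable_subst cf (x := fun i e =>
    if i is j.+1 then if j is k.+1 then e k.+1 else cnth (e 0) 0 else cnth (e 0) 1)).
  by case=> [|[|i]] lt_in; solve_computable.
move=> e; split=> [[x Px]|[y fy]].
  have /(fP (sc x e)) [y fy] := Px; exists (CodeSeq.code [:: x; y]).
  by rewrite /cnth CodeSeq.codeK.
by exists (cnth y 0); apply/(fP (sc (cnth y 0) e)); exists (cnth y 1).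
Qed.

Definition ccode (f : nat -> nat) n := CodeSeq.code (mkseq f n).

Lemma cnth_ccode f n i : i < n -> cnth (ccode f n) i = f i.
Proof. by move=> lt_in; rewrite /cnth CodeSeq.codeK nth_mkseq. Qed.

(** A bounded quantifier does not lead out of the semidecidable predicates: the
witnesses for all x below the bound are collected in one sequence. *)
Lemma semidec_all n k (P : nat -> env -> Prop) :
  computable n k ->
  semidec n.+1 (fun e => P (e 0) (fun i => e i.+1)) ->
  semidec n (fun e => forall x, x < k e -> P x e).
Proof.
move=> ck [f cf fP].
pose sc x (e : env) i := if i is j.+1 then e j else x.
pose S y e m := nat_rect (fun=> nat) 0 (fun i z => z + f (cnth y i) (sc i e)) m.
have S0 y e m : S y e m = 0 <-> forall i, i < m -> f (cnth y i) (sc i e) = 0.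
  elim: m => [|m IHm]; first by split.
  split=> [/eqP|fm] /=.
    rewrite addn_eq0 => /andP[/eqP/IHm Sm /eqP fm] i; rewrite ltnS leq_eqVlt.
    by case/orP=> [/eqP->|/Sm].
  by rewrite -/(S y e m) (IHm.2 _) ?add0n ?fm // => i lt_im; rewrite fm // ltnS ltnW.
exists (fun y e => S y e (k e)).
  apply: (@computable_primrec n.+1 (fun=> 0)
    (fun i z e => z + f (cnth (e 0) i) (sc i (fun j => e j.+1)))).
  - exact: computable_cst.
  - apply: computable_add; first exact: computable_var.
    apply: (computable_subst cf (x := fun i e => if i is j.+1 then
       if j is k.+1 then e k.+3 else e 0 else cnth (e 2) (e 0))).
    by case=> [|[|i]] lt_in; solve_computable.
  exact: computable_shift ck.
move=> e; split=> [Pe|[y /S0 Sy] x lt_xk].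
  have /choice[y fy] : forall x, exists y, x < k e -> f y (sc x e) = 0.
    move=> x; have [lt_xk|_] := boolP (x < k e); last by exists 0.
    by have /(fP (sc x e)) [y fy] := Pe x lt_xk; exists y.
  exists (ccode y (k e)); apply/S0 => i lt_ik.
  by rewrite cnth_ccode // fy.
by apply/(fP (sc x e)); exists (cnth y x); apply: Sy.
Qed.

Lemma semidec_subst k n (P : env -> Prop) (x : nat -> env -> nat) :
  semidec k P -> (forall i, i < k -> computable n (x i)) ->
  semidec n (fun e => P (fun i => x i e)).
Proof.
move=> [f cf fP] cx; exists (fun y e => f y (fun i => x i e)) => // .
apply: (computable_subst cf (x := fun i e => if i is j.+1 then x j (fun l => e l.+1) else e 0)).
case=> [|i] lt_ik; first exact: computable_var.
exact: computable_shift (cx _ lt_ik).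
Qed.

(** The program looks for a zero of f * g, that is, for a certificate of either
predicate, and then asks which of the two it has found. *)
Lemma search_program (Y N : env -> Prop) : semidec 2 Y -> semidec 2 N ->
  exists p, forall e, (Y e \/ N e) -> ~ (Y e /\ N e) ->
    (Y e -> computes p [:: e 0; e 1] 1) /\ (~ Y e -> computes p [:: e 0; e 1] 0).
Proof.
move=> [f cf fY] [g cg gN].
have [p fp] := computable_mul cf cg.
have [q fq] : computable 3 (fun e => 1 - f (e 0) (fun i => e i.+1)) by solve_computable.
exists (Comp q [:: Mu p; Proj 0; Proj 1]) => e YN nYN.
have fpE y : computes p [:: y; e 0; e 1] (f y e * g y e).
  exact: (fp (fun i => if i is j.+1 then e j else y)).
have fqE y : computes q [:: y; e 0; e 1] (1 - f y e).
  exact: (fq (fun i => if i is j.+1 then e j else y)).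
have exy : exists y, f y e * g y e == 0.
  by case: YN => [/fY|/gN] [y y0]; exists y; rewrite y0 ?muln0.
case: (ex_minnP exy) => y /eqP y0 miny.
have run : computes (Comp q [:: Mu p; Proj 0; Proj 1]) [:: e 0; e 1] (1 - f y e).
  exists [:: y; e 0; e 1] => //=; split=> //; split; first by have := fpE y; rewrite y0.
  move=> m lt_my; exists (f m e * g m e).-1; rewrite prednK //.
  by rewrite lt0n; apply/negP => /miny; rewrite leqNgt lt_my.
split=> Ye; move: run.
  move/eqP: y0; rewrite muln_eq0 => /orP[/eqP->//|/eqP gy].
  by case: nYN; split=> //; apply/gN; exists y.
suff: f y e <> 0 by case: (f y e) => // m _; rewrite subSS sub0n.
by move=> fy; apply: Ye; apply/fY; exists y.
Qed.

Ltac solve_semidec := repeat first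
  [ assumption
  | simple apply semidec_and
  | simple apply semidec_or
  | simple apply semidec_ex
  | simple apply semidec_all
  | simple apply semidec_eq
  | simple apply semidec_neq
  | simple apply semidec_leq ]; cbv beta; solve_computable.

Lemma semidec_comp1 n (P : nat -> Prop) a :
  semidec 1 (fun e => P (e 0)) ->
  computable n a ->
  semidec n (fun e => P (a e)).
Proof.
move=> sP ca; by apply: (semidec_subst (x := nth a [:: a]) sP) => -[].
Qed.

Lemma semidec_comp2 n (P : nat -> nat -> Prop) a b :
  semidec 2 (fun e => P (e 0) (e 1)) ->
  computable n a -> computable n b ->
  semidec n (fun e => P (a e) (b e)).
Proof.
move=> sP ca cb; by apply: (semidec_subst (x := nth a [:: a; b]) sP) => -[|[]].
Qed.

Lemma semidec_comp3 n (P : nat -> nat -> nat -> Prop) a b c :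
  semidec 3 (fun e => P (e 0) (e 1) (e 2)) ->
  computable n a -> computable n b -> computable n c ->
  semidec n (fun e => P (a e) (b e) (c e)).
Proof.
move=> sP ca cb cc; by apply: (semidec_subst (x := nth a [:: a; b; c]) sP) => -[|[|[]]].
Qed.

Lemma semidec_comp4 n (P : nat -> nat -> nat -> nat -> Prop) a b c d :
  semidec 4 (fun e => P (e 0) (e 1) (e 2) (e 3)) ->
  computable n a -> computable n b -> computable n c -> computable n d ->
  semidec n (fun e => P (a e) (b e) (c e) (d e)).
Proof.
move=> sP ca cb cc cd; by apply: (semidec_subst (x := nth a [:: a; b; c; d]) sP) => -[|[|[|[]]]].
Qed.

Lemma semidec_comp5 n (P : nat -> nat -> nat -> nat -> nat -> Prop) a b c d f :
  semidec 5 (fun e => P (e 0) (e 1) (e 2) (e 3) (e 4)) ->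
  computable n a -> computable n b -> computable n c -> computable n d -> computable n f ->
  semidec n (fun e => P (a e) (b e) (c e) (d e) (f e)).
Proof.
move=> sP ca cb cc cd cf; by apply: (semidec_subst (x := nth a [:: a; b; c; d; f]) sP) => -[|[|[|[|[]]]]].
Qed.

(** * Words and presentations *)

(** The letter 2i is the i-th generator, 2i + 1 is its inverse. *)
Section Words.
Implicit Types (a : nat) (u v w : seq nat).

Definition flip_letter a := if odd a then a.-1 else a.+1.
Definition inverse_word w := rev (map flip_letter w).
Definition over n w := all (fun a => a < n.*2) w.

Lemma half_flip_letter a : (flip_letter a)./2 = a./2.
Proof.
rewrite /flip_letter; case: ifP => oa; last by rewrite /= uphalf_half oa.
by case: a oa => //= a /negPf oa; rewrite uphalf_half oa.
Qed.

Lemma odd_flip_letter a : odd (flip_letter a) = ~~ odd a.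
Proof. by rewrite /flip_letter; case: a => //= a; case: ifP => /= [/negPf->|->]. Qed.

Lemma flip_letterK : involutive flip_letter.
Proof.
move=> a; have := odd_flip_letter a; rewrite /flip_letter.
by case: (boolP (odd a)) => [oa ->|na /= ->] //=; case: a oa.
Qed.

Lemma inverse_wordK : involutive inverse_word.
Proof. by move=> w; rewrite /inverse_word map_rev revK (mapK flip_letterK). Qed.

Lemma over_cat n u v : over n (u ++ v) = over n u && over n v.
Proof. exact: all_cat. Qed.

Lemma ltn_letter a n : (a < n.*2) = (a./2 < n).
Proof.
rewrite -{1}(odd_double_half a); case: (odd a); last by rewrite add0n ltn_double.
by rewrite add1n ltn_Sdouble.
Qed.

Lemma over_inverse n w : over n (inverse_word w) = over n w.
Proof.
rewrite /over all_rev all_map; apply: eq_all => a /=.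
by rewrite !ltn_letter half_flip_letter.
Qed.

Variable G : groupType.
Implicit Types g h : nat -> G.

Definition letter g a : G := if odd a then (g a./2)^-1%g else g a./2.
Definition ev g w : G := foldr (fun a x => letter g a * x)%g 1%g w.

Lemma letter_flip g a : letter g (flip_letter a) = (letter g a)^-1%g.
Proof.
rewrite /letter odd_flip_letter half_flip_letter if_neg.
by case: ifP => //; rewrite invgK.
Qed.

Lemma ev_cat g u v : ev g (u ++ v) = (ev g u * ev g v)%g.
Proof. by elim: u => /= [|a u ->]; rewrite ?mul1g ?mulgA. Qed.

Lemma ev_inverse g w : ev g (inverse_word w) = (ev g w)^-1%g.
Proof.
elim: w => [|a w IHw] /=; first by rewrite invg1.
by rewrite /inverse_word /= rev_cons -cats1 ev_cat IHw /= letter_flip mulg1 invgM.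
Qed.

Lemma eq_ev n g h w : (forall i, i < n -> g i = h i) -> over n w ->
  ev g w = ev h w.
Proof.
move=> gh; elim: w => //= a w IHw /andP[a_n /IHw->]; congr (_ * _)%g.
by rewrite /letter gh // -ltn_letter.
Qed.

Lemma ev_nseq g i n : ev g (nseq n i.*2) = (g i ^+ n)%g.
Proof.
elim: n => [|n IHn] //=; rewrite IHn expgS /letter odd_double.
by rewrite doubleK.
Qed.

Definition generating n g := forall x, exists2 w, over n w & ev g w = x.

End Words.

Section Morphism.
Variables (G H : groupType) (f : G -> H).
Hypothesis fM : {morph f : x y / (x * y)%g}.

Lemma morph_one : f 1%g = 1%g.
Proof. by apply: (mulgI (f 1%g)); rewrite -fM !mulg1. Qed.

Lemma morph_inv : {morph f : x / x^-1%g}.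
Proof. by move=> x; apply: (mulIg (f x)); rewrite -fM !mulVg morph_one. Qed.

Lemma ev_morph (g : nat -> G) w : f (ev g w) = ev (f \o g) w.
Proof.
elim: w => [|a w IHw]; first exact: morph_one.
by rewrite /= fM IHw /letter; case: ifP => //; rewrite morph_inv.
Qed.

End Morphism.

Definition presented_relators (P : finite_presentation) : seq (seq nat) :=
  [seq [seq letter_code a | a <- fg_word r] | r <- relators P].

Definition satisfies (P : finite_presentation) (G : groupType) (g : nat -> G) :=
  forall r, r \in presented_relators P -> ev g r = 1%g.

Section Presentation.
Variable P : finite_presentation.
Local Notation n := (ngens P).

Lemma half_letter_code m (a : 'I_m * bool) : (letter_code a)./2 = a.1.
Proof. by rewrite /letter_code addnC half_bit_double. Qed.

Lemma odd_letter_code m (a : 'I_m * bool) : odd (letter_code a) = a.2.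
Proof. by rewrite /letter_code oddD odd_double oddb. Qed.

Lemma letter_code_inv m (a : 'I_m * bool) :
  letter_code (inv_letter a) = flip_letter (letter_code a).
Proof.
rewrite /flip_letter odd_letter_code /letter_code.
by case: a => i [] /=; rewrite ?addn1 ?addn0.
Qed.

Lemma over_letter_code m (w : seq ('I_m * bool)) : over m (map (@letter_code m) w).
Proof.
apply/allP => a /mapP[b _ ->]; rewrite ltn_letter half_letter_code.
exact: ltn_ord.
Qed.

Lemma over_relator r : r \in presented_relators P -> over n r.
Proof. by move=> /mapP[x _ ->]; apply: over_letter_code. Qed.

Lemma letter_codeP m a : a < m.*2 -> exists b : 'I_m * bool, a = letter_code b.
Proof.
rewrite ltn_letter => lt_a; exists (Ordinal lt_a, odd a).
by rewrite /letter_code /= addnC odd_double_half.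
Qed.

Lemma overP m w : over m w -> exists v, w = map (@letter_code m) v.
Proof.
elim: w => [|a w IHw] /=; first by exists [::].
by move=> /andP[/letter_codeP[b ->] /IHw[v ->]]; exists (b :: v).
Qed.

Section Eval.
Variables (G : groupType) (g : nat -> G).

Lemma ev_reduce m (w : seq ('I_m * bool)) :
  ev g (map (@letter_code m) (reduce w)) = ev g (map (@letter_code m) w).
Proof.
elim: w => //= a w <-; case: (reduce w) => [|b v] //=.
case: eqP => [->|_] //=; rewrite letter_code_inv letter_flip mulgA mulgV.
by rewrite mul1g.
Qed.

Definition free_ev m (x : free_group 'I_m) : G :=
  ev g (map (@letter_code m) (fg_word x)).

Lemma free_evM m : {morph @free_ev m : x y / (x * y)%g}.
Proof. by move=> x y; rewrite /free_ev ev_reduce map_cat ev_cat. Qed.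

Lemma free_evV m x : @free_ev m x^-1%g = (free_ev x)^-1%g.
Proof.
apply: (mulIg (free_ev x)); rewrite -free_evM !mulVg; first by [].
Qed.

Hypothesis gP : satisfies P g.

Lemma free_ev_normal_closure x :
  normal_closure [set` relators P]%classic x -> free_ev x = 1%g.
Proof.
move=> /(_ [set y : free_group _ | free_ev y = 1%g]%classic); apply; split; last first.
  by move=> r /= Pr; apply: gP; apply: map_f.
split=> [|y z /= y1]; last first.
  by rewrite /conjg !free_evM free_evV y1 mul1g mulVg.
split=> [//|y z|y] /=; first by rewrite free_evM => -> ->; rewrite mulg1.
by rewrite free_evV => ->; rewrite invg1.
Qed.

Definition pres_ev (X : group_of P) : G := free_ev (repr X).

Lemma pres_ev_class x :
  pres_ev (pres_class [set` relators P]%classic x) = free_ev x.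
Proof.
rewrite /pres_ev; set y := repr _.
have /pres_classP : pres_class [set` relators P]%classic y = pres_class [set` relators P]%classic x by apply: pres_classK.
move=> /free_ev_normal_closure; rewrite free_evM free_evV => /eqP.
by rewrite mulg_eq1 eqg_inv => /eqP.
Qed.

Lemma pres_evM : {morph pres_ev : X Y / (X * Y)%g}.
Proof.
move=> X Y; rewrite -[in RHS](pres_classK X) -[in RHS](pres_classK Y).
rewrite !pres_ev_class -free_evM -pres_ev_class -pres_classM !pres_classK.
by [].
Qed.

End Eval.

Definition pres_gen i : group_of P :=
  if insub i is Some j then pres_class _ (@FreeGroup _ [:: (j, false)] isT) else 1%g.

Lemma pres_genE (x : free_group 'I_n) :
  free_ev pres_gen x = pres_class [set` relators P]%classic x.
Proof.
suff evE (w : seq ('I_n * bool)) : ev pres_gen (map (@letter_code n) w) =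
    pres_class [set` relators P]%classic (FreeGroup (reduced_reduce w)).
  rewrite /free_ev evE; congr pres_class; apply: val_inj => /=.
  exact/reduce_id/fg_reduced.
elim: w => [|[i b] w IHw] /=.
  by congr pres_class; apply: val_inj.
rewrite {}IHw; set x1 : free_group _ := @FreeGroup _ [:: (i, b)] isT.
have -> : letter pres_gen (letter_code (i, b)) =
    pres_class [set` relators P]%classic x1.
  rewrite /letter odd_letter_code half_letter_code /= /pres_gen valK /x1.
  case: b {x1} => //; rewrite -[LHS]/(pres_inv _) pres_classV.
  by congr pres_class; apply: val_inj.
rewrite -[LHS]/(pres_mul _ _) pres_classM; congr pres_class; apply: val_inj.
exact: (reduce_catr [:: (i, b)] w).
Qed.

Lemma pres_gen_satisfies : satisfies P pres_gen.
Proof.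
move=> r /mapP[x Px ->]; rewrite -/(free_ev _ x) pres_genE.
rewrite -[RHS]/(pres_class [set` relators P]%classic 1%g).
apply/pres_classP; rewrite mulg1 => H [[[_ _ HV] _] HR].
by apply: HV; apply: HR.
Qed.

Lemma pres_gen_generating : generating n pres_gen.
Proof.
move=> X; exists (map (@letter_code n) (fg_word (repr X))).
  exact: over_letter_code.
by rewrite -/(free_ev _ _) pres_genE; apply: pres_classK.
Qed.

Lemma pres_ev_gen (G : groupType) (g : nat -> G) w :
  satisfies P g -> over n w -> pres_ev g (ev pres_gen w) = ev g w.
Proof.
move=> gP /overP[v ->].
have -> : ev pres_gen (map (@letter_code n) v) =
    pres_class [set` relators P]%classic (FreeGroup (reduced_reduce v)).
  by rewrite -pres_genE /free_ev /= ev_reduce.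
by rewrite pres_ev_class // /free_ev /= ev_reduce.
Qed.

Lemma pres_hom (G : groupType) (g : nat -> G) : satisfies P g ->
  exists2 f : group_of P -> G, {morph f : x y / (x * y)%g} &
    forall w, over n w -> f (ev pres_gen w) = ev g w.
Proof.
move=> gP.
exists (pres_ev g) => [|w nw]; [exact: pres_evM | exact: pres_ev_gen].
Qed.

(** This removes quotient types from everything that follows: an epimorphism from
a presented group is a tuple that satisfies the relators and generates. *)
Lemma pres_epimorphism (G : groupType) :
  group_epimorphism (group_of P) G <->
  exists2 g : nat -> G, satisfies P g & generating n g.
Proof.
split=> [[f fT]|[g gP gT]].
  exists (f \o pres_gen) => [r Pr|x].
    by rewrite -ev_morph ?pres_gen_satisfies ?morph_one //; apply: gmulfM.
  have : range f x by rewrite fT.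
  move=> [X _ <-]; have [w nw <-] := pres_gen_generating X.
  by exists w => //; rewrite -ev_morph //; apply: gmulfM.
have [f fM fE] := pres_hom gP.
pose F : {multiplicative group_of P -> G} :=
  HB.pack f (isMultiplicative.Build _ _ f fM).
exists F; apply/seteqP; split=> // x _.
by have [w nw <-] := gT x; exists (ev pres_gen w) => //; apply: fE.
Qed.

End Presentation.

(** * Certificates of existence *)

Section Rewriting.
Variable R : seq nat -> Prop.

(** The consequences of the relators are generated by inserting and deleting
relators at any place. With the words a a^-1 among the relators this is equality
to 1 in the presented group, and a derivation is a finite object. *)
Inductive null : seq nat -> Prop :=
| null_nil : null [::]
| null_insert x r y : R r -> null (x ++ y) -> null (x ++ r ++ y)
| null_delete x r y : R r -> null (x ++ r ++ y) -> null (x ++ y).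

Lemma null_ev (G : groupType) (g : nat -> G) w :
  (forall r, R r -> ev g r = 1%g) -> null w -> ev g w = 1%g.
Proof.
move=> R1; elim=> [//|x r y Rr _|x r y Rr _];
  by rewrite !ev_cat (R1 r) // mul1g.
Qed.

(** Interchangeability inside null words; it is the congruence whose classes form
the presented group, defined so that compatibility with concatenation is
immediate. *)
Record equiv u v : Prop :=
  Equiv { equivP : forall x y, null (x ++ u ++ y) <-> null (x ++ v ++ y) }.

Lemma equiv_refl u : equiv u u. Proof. by []. Qed.
Lemma equiv_sym u v : equiv u v -> equiv v u.
Proof. by move=> [uv]; split=> x y; rewrite uv. Qed.
Lemma equiv_trans v u w : equiv u v -> equiv v w -> equiv u w.
Proof. by move=> [uv] [vw]; split=> x y; rewrite uv. Qed.
Lemma equiv_cat u u' v v' : equiv u u' -> equiv v v' -> equiv (u ++ v) (u' ++ v').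
Proof.
move=> [uu'] [vv']; split=> x y; rewrite -!catA uu' catA vv'.
by rewrite -catA.
Qed.

Lemma null_equiv u : null u -> equiv u [::].
Proof.
move=> nu; have := null_nil.
elim: nu => [_|x r y Rr _ IH _|x r y Rr _ IH _]; first exact: equiv_refl.
  split=> a b; rewrite -(equivP (IH null_nil)) -!catA; split.
    by rewrite catA => /(null_delete Rr); rewrite -!catA.
  by rewrite catA => /(null_insert Rr); rewrite -!catA.
split=> a b; rewrite -(equivP (IH null_nil)) -!catA; split.
  by rewrite catA => /(null_insert Rr); rewrite -!catA.
by rewrite catA => /(null_delete Rr); rewrite -!catA.
Qed.

Lemma equiv_null u : equiv u [::] -> null u.
Proof. by move=> /equivP/(_ [::] [::]); rewrite cats0 => ->; apply: null_nil. Qed.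

Lemma null_rel r : R r -> null r.
Proof.
by move=> Rr; rewrite -[r]cats0; apply: (@null_insert [::]) => //; exact: null_nil.
Qed.

Hypothesis R_flip : forall a, R [:: a; flip_letter a].

Lemma equiv_flip a : equiv [:: a; flip_letter a] [::].
Proof. exact: null_equiv (null_rel (R_flip a)). Qed.

Lemma equiv_inverse w : equiv (w ++ inverse_word w) [::].
Proof.
elim: w => [|a w IHw]; first exact: equiv_refl.
rewrite /inverse_word /= rev_cons -cats1 -/(inverse_word w) catA.
apply: equiv_trans (equiv_flip a).
apply: (@equiv_cat [:: a] [:: a] _ [:: flip_letter a]) => //.
exact: (@equiv_cat _ [::]).
Qed.

Lemma equiv_inversel w : equiv (inverse_word w ++ w) [::].
Proof. by rewrite -{2}(inverse_wordK w); apply: equiv_inverse. Qed.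

Lemma equiv_null_cat u v : null (inverse_word u ++ v) -> equiv u v.
Proof.
move=> /null_equiv uv; apply: equiv_sym.
apply: (@equiv_trans ((u ++ inverse_word u) ++ v)).
  apply: equiv_sym; exact: (equiv_cat (equiv_inverse u) (@equiv_refl v)).
by have := equiv_cat (@equiv_refl u) uv; rewrite cats0 catA.
Qed.

Lemma equiv_inv u v : equiv u v -> equiv (inverse_word u) (inverse_word v).
Proof.
move=> uv; apply: equiv_null_cat; rewrite inverse_wordK.
apply: equiv_null; apply: equiv_trans (equiv_inverse v).
exact: equiv_cat.
Qed.

Lemma equiv_reduce m (w : seq ('I_m * bool)) :
  equiv (map (@letter_code m) (reduce w)) (map (@letter_code m) w).
Proof.
elim: w => [|a w IHw] /=; first exact: equiv_refl.
suff E v : equiv (map (@letter_code m) (cons_reduce a v)) (letter_code a :: map (@letter_code m) v).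
  by apply: equiv_trans (E _) _; apply: (@equiv_cat [:: _] [:: _]).
case: v => [|b v] //=; case: eqP => //= ->; rewrite letter_code_inv.
apply: equiv_sym; exact: (@equiv_cat [:: _; _] [::] _ _ (equiv_flip _) (@equiv_refl _)).
Qed.

Variable P : finite_presentation.
Hypothesis R_relator : forall r, r \in presented_relators P -> R r.

(** The words that are null form a normal subgroup of the free group, so it
contains the normal closure of the relators. *)
Lemma ev_null w : over (ngens P) w -> ev (@pres_gen P) w = 1%g -> null w.
Proof.
move=> /overP[v ->] v1; set n := ngens P in v v1 *.
pose code := map (@letter_code n).
have: pres_class [set` relators P]%classic 1%g =
      pres_class [set` relators P]%classic (FreeGroup (reduced_reduce v)).
  by rewrite -[RHS]pres_genE /free_ev /= ev_reduce v1.
move/pres_classP; rewrite invg1 mul1g.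
move=> /(_ [set x : free_group _ | null (code (fg_word x))]%classic) Nv.
have codeM (x y : free_group 'I_n) : equiv (code (fg_word (x * y)%g)) (code (fg_word x) ++ code (fg_word y)).
  by rewrite -map_cat; apply: equiv_reduce.
have codeV (x : free_group 'I_n) : code (fg_word x^-1%g) = inverse_word (code (fg_word x)).
  rewrite /code /= /inv_word map_rev /inverse_word -!map_comp; congr rev.
  by apply: eq_map => a /=; rewrite letter_code_inv.
have /null_equiv v2 : null (code (reduce v)).
  apply: Nv; split; last by move=> r /= Pr; apply/null_rel/R_relator/map_f.
  split; first split=> /=.
  - exact: null_nil.
  - move=> x y /null_equiv x1 /null_equiv y1; apply: equiv_null.
    apply: equiv_trans (codeM _ _) _.
    exact: (@equiv_cat _ [::] _ [::]).
  - move=> x /null_equiv x1; apply: equiv_null.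
    rewrite codeV; exact: (equiv_inv x1).
  move=> x y /= /null_equiv x1; apply: equiv_null.
  apply: equiv_trans (codeM y^-1%g (x * y)%g) _; rewrite codeV.
  apply: equiv_trans (equiv_inversel (code (fg_word y))).
  apply: equiv_cat => //; apply: equiv_trans (codeM _ _) _.
  exact: (@equiv_cat _ [::]).
apply: equiv_null; apply: equiv_trans v2; apply: equiv_sym; apply: equiv_reduce.
Qed.

End Rewriting.
Lemma generating_sub (G : groupType) m n (g h : nat -> G) :
  generating n h -> (forall j, j < n -> exists2 w, over m w & ev g w = h j) ->
  generating m g.
Proof.
move=> hT gh x; have [w nw <-] := hT x.
elim: w nw => [_|a w IHw /= /andP[a_n /IHw[v mv <-]]]; first by exists [::].
move: a_n; rewrite ltn_letter => /gh[u mu gu].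
rewrite {1}/letter -gu; case: ifP => _.
  exists (inverse_word u ++ v); rewrite ?ev_cat ?ev_inverse // over_cat over_inverse.
  exact/andP.
by exists (u ++ v); rewrite ?ev_cat // over_cat; apply/andP.
Qed.

Definition shift_word n w := map (addn n.*2) w.

Lemma ev_shift (G : groupType) (h : nat -> G) n w :
  ev h (shift_word n w) = ev (fun i => h (n + i)) w.
Proof.
elim: w => //= a w ->; congr (_ * _)%g.
by rewrite /letter oddD odd_double halfD odd_double doubleK.
Qed.

Section EpimorphismCertificate.
Variables P Q : finite_presentation.
Local Notation n := (ngens Q).

(** A presentation of the group of Q on the generators of both presentations: those
of P are shifted behind those of Q, and the i-th one is made equal to the word u
i. Working here makes it unnecessary to substitute words into words. *)
Definition graph_relator (u : nat -> seq nat) r : Prop :=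
  (exists i, r = [:: i.*2; i.*2.+1]) \/ (exists i, r = [:: i.*2.+1; i.*2]) \/
  r \in presented_relators Q \/
  exists2 i, i < ngens P & r = (n + i).*2.+1 :: u i.

Lemma epimorphism_null : group_epimorphism (group_of P) (group_of Q) <->
  exists u v : nat -> seq nat,
  [/\ forall i, i < ngens P -> over n (u i),
      forall r, r \in presented_relators P -> null (graph_relator u) (shift_word n r)
    & forall j, j < n ->
      over (ngens P) (v j) /\ null (graph_relator u) (j.*2.+1 :: shift_word n (v j))].
Proof.
set gQ := @pres_gen Q; split.
  move=> /pres_epimorphism[g gP gT].
  have /choice[u uE] : forall i, exists w, over n w /\ ev gQ w = g i.
    by move=> i; have [w nw <-] := pres_gen_generating (g i); exists w.
  have /choice[v vE] : forall j, exists w, over (ngens P) w /\ ev g w = gQ j.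
    by move=> j; have [w nw <-] := gT (gQ j); exists w.
  have R_flip a : graph_relator u [:: a; flip_letter a].
    rewrite -(odd_double_half a) /flip_letter; case: (odd a).
      by right; left; exists a./2; rewrite add1n /= odd_double.
    by left; exists a./2; rewrite add0n odd_double.
  pose subst w := flatten [seq if odd a then inverse_word (u a./2) else u a./2 | a : nat <- w].
  have over_subst w : over n (subst w).
    elim: w => //= a w IHw; rewrite over_cat IHw andbT.
    by case: ifP; rewrite ?over_inverse (uE _).1.
  have ev_subst w : ev gQ (subst w) = ev g w.
    elim: w => //= a w IHw; rewrite ev_cat -IHw; congr (_ * _)%g; rewrite /letter.
    by case: ifP; rewrite ?ev_inverse (uE _).2.
  have substE w : over (ngens P) w -> equiv (graph_relator u) (shift_word n w) (subst w).
    elim: w => //= a w IHw /andP[a_P /IHw]; apply: (@equiv_cat _ [:: _]).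
    move: a_P; rewrite ltn_letter => a_P.
    have E : equiv (graph_relator u) [:: (n + a./2).*2] (u a./2).
      apply: equiv_null_cat => //; apply: null_rel; do 3!right.
      by exists a./2; rewrite // /inverse_word /= /flip_letter odd_double.
    rewrite -{1}(odd_double_half a); case: (odd a); last by rewrite add0n -doubleD.
    rewrite addnCA -doubleD add1n.
    by have := equiv_inv R_flip E; rewrite /inverse_word /= /flip_letter odd_double.
  have nullP w : over n w -> ev gQ w = 1%g -> null (graph_relator u) w.
    by apply: ev_null => // r Qr; right; right; left.
  exists u, v; split=> [i _|r Pr|j lt_j]; first by have [] := uE i.
    apply: equiv_null; apply: equiv_trans (substE _ (over_relator Pr)) _.
    by apply: null_equiv; apply: nullP; rewrite // ev_subst gP.
  have [nv vj] := vE j; split=> //.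
  apply: equiv_null; apply: (@equiv_trans _ ([:: j.*2.+1] ++ subst (v j))).
    exact: (@equiv_cat _ [:: _] [:: _] _ _ _ (substE _ nv)).
  apply: null_equiv; apply: nullP; first by rewrite /= over_subst ltn_Sdouble lt_j.
  by rewrite /= ev_subst vj /letter /= odd_double /= uphalf_double mulVg.
move=> [u [v [nu Pr Qv]]]; apply/pres_epimorphism.
pose h i := if i < n then gQ i else ev gQ (u (i - n)).
have evh w : over n w -> ev h w = ev gQ w.
  by apply: eq_ev => i lt_i; rewrite /h lt_i.
have h1 r : graph_relator u r -> ev h r = 1%g.
  have lett i : letter h i.*2 = h i by rewrite /letter odd_double doubleK.
  have lettV i : letter h i.*2.+1 = (h i)^-1%g.
    by rewrite /letter /= odd_double uphalf_double.
  case=> [[i ->]|[[i ->]|[Qr|[i lt_i ->]]]] /=.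
  - by rewrite lett lettV mulg1 mulgV.
  - by rewrite lett lettV mulg1 mulVg.
  - by rewrite evh ?over_relator // pres_gen_satisfies.
  rewrite lettV evh ?nu // /h ltnNge leq_addr /= addKn.
  exact: mulVg.
have evu w : ev h (shift_word n w) = ev (fun i => ev gQ (u i)) w.
  rewrite ev_shift; congr ev; apply: funext => i.
  by rewrite /h ltnNge leq_addr /= addKn.
exists (fun i => ev gQ (u i)).
  by move=> r /Pr/(null_ev h1); rewrite evu.
apply: (generating_sub (@pres_gen_generating Q)) => j lt_j.
have [Pv /(null_ev h1) vj] := Qv j lt_j; exists (v j) => //.
move: vj.
rewrite /= evu /letter /= odd_double /= uphalf_double /h lt_j.
by move/mulg1_eq; rewrite invgK => <-.
Qed.

End EpimorphismCertificate.

(** * Semidecidability of existence *)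

Notation decode := CodeSeq.decode.

Lemma decode_ccons x c : decode (ccons x c) = x :: decode c.
Proof. by rewrite cconsE CodeSeq.codeK. Qed.

Lemma eq_decode_nth (c : nat) (w : seq nat) : decode c = w <->
  csize c = size w /\ forall i, i < size w -> cnth c i = nth 0 w i.
Proof.
split=> [<- //|[sz eqn]]; apply: (@eq_from_nth _ 0) => // i.
by rewrite -/(csize c) sz => /eqn.
Qed.

Section WordPredicates.
Variables (n : nat) (f g h : env -> nat).
Hypotheses (cf : computable n f) (cg : computable n g) (ch : computable n h).

Lemma semidec_over : semidec n (fun e => over (f e) (decode (g e))).
Proof.
apply: (semidec_comp2 (P := fun k w => over k (decode w)) _ cf cg).
apply: (@semidec_ext _ (fun e => forall i, i < csize (e 1) -> cnth (e 1) i < e 0 * 2)).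
  by move=> e; rewrite muln2; split=> [nw|/(all_nthP 0)//]; apply/(all_nthP 0).
by solve_semidec.
Qed.

Lemma semidec_cat : semidec n (fun e => decode (h e) = decode (f e) ++ decode (g e)).
Proof.
apply: (semidec_comp3 (P := fun x y z => decode z = decode x ++ decode y) _ cf cg ch).
apply: (@semidec_ext _ (fun e => csize (e 2) = csize (e 0) + csize (e 1) /\
  (forall i, i < csize (e 0) -> cnth (e 2) i = cnth (e 0) i) /\
  (forall i, i < csize (e 1) -> cnth (e 2) (csize (e 0) + i) = cnth (e 1) i))).
  move=> e; rewrite eq_decode_nth size_cat /csize /cnth.
  split=> [[-> [h1 h2]]|[-> eqz]].
    split=> // i lt_i; rewrite nth_cat; case: ltnP => [/h1 //|le_i].
    by rewrite -{1}(subnKC le_i) h2 // ltn_subLR.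
  split=> //; split=> i lt_i; rewrite eqz ?nth_cat ?ltn_add2l ?(ltn_addr _ lt_i) //.
    by rewrite lt_i.
  by rewrite ltnNge leq_addr /= addKn.
by solve_semidec.
Qed.

Lemma semidec_shift_word :
  semidec n (fun e => decode (h e) = shift_word (f e) (decode (g e))).
Proof.
apply: (semidec_comp3 (P := fun x y z => decode z = shift_word x (decode y)) _ cf cg ch).
apply: (@semidec_ext _ (fun e => csize (e 2) = csize (e 1) /\
  (forall i, i < csize (e 1) -> cnth (e 2) i = e 0 * 2 + cnth (e 1) i))).
  move=> e; rewrite eq_decode_nth size_map muln2.
  split=> -[sz eqn]; split=> // i lt_i; rewrite eqn //.
    by rewrite (nth_map 0).
  by rewrite (nth_map 0).
by solve_semidec.
Qed.

End WordPredicates.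

Ltac semidec_word := first
  [ simple apply semidec_over | simple apply semidec_cat
  | simple apply semidec_shift_word ].

(** A derivation is turned into the sequence of codes of the words that occur in
it. The word s is there to express a concatenation of three words through
concatenations of two. *)
Lemma null_trace (R : seq nat -> Prop) w : null R w <->
  exists T N, [/\ cnth T 0 = 0, decode (cnth T N) = w &
    forall k, k < N -> exists x y z r s, [/\ R (decode r),
      decode z = decode x ++ decode y, decode s = decode r ++ decode y &
      (cnth T k = z /\ decode (cnth T k.+1) = decode x ++ decode s) \/
      (decode (cnth T k) = decode x ++ decode s /\ cnth T k.+1 = z)]].
Proof.
pose step a b := exists x y z r s, [/\ R (decode r),
      decode z = decode x ++ decode y, decode s = decode r ++ decode y &
      (a = z /\ decode b = decode x ++ decode s) \/
      (decode a = decode x ++ decode s /\ b = z)].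
have stepP a b : step a b <-> exists x r y, R r /\
   ((decode a = x ++ y /\ decode b = x ++ r ++ y) \/
    (decode a = x ++ r ++ y /\ decode b = x ++ y)).
  split.
    move=> [x [y [z [r [s [Rr zE sE ab]]]]]].
    exists (decode x), (decode r), (decode y); rewrite -sE -zE.
    by split=> //; case: ab => -[-> ->]; [left | right].
  move=> [x [r [y [Rr ab]]]].
  exists (CodeSeq.code x), (CodeSeq.code y), (CodeSeq.code (x ++ y)), (CodeSeq.code r), (CodeSeq.code (r ++ y)).
  rewrite !CodeSeq.codeK; split=> //.
  case: ab => -[aE bE]; [left|right]; split=> //.
    by rewrite -aE CodeSeq.decodeK.
  by rewrite -bE CodeSeq.decodeK.
split=> [nw|[T [N [T0 <- TS]]]].
  have [T [N [T0 TN TS]]] : exists (T : nat -> nat) N, [/\ T 0 = 0, decode (T N) = w &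
      forall k, k < N -> step (T k) (T k.+1)].
    have extend u v : (exists (T : nat -> nat) N, [/\ T 0 = 0, decode (T N) = u &
          forall k, k < N -> step (T k) (T k.+1)]) ->
        step (CodeSeq.code u) (CodeSeq.code v) ->
        exists (T : nat -> nat) N, [/\ T 0 = 0, decode (T N) = v &
          forall k, k < N -> step (T k) (T k.+1)].
      move=> [T [N [T0 TN TS]]] uv.
      exists (fun k => if k <= N then T k else CodeSeq.code v), N.+1; split=> //.
        by rewrite ltnn CodeSeq.codeK.
      move=> k; rewrite ltnS => le_k; rewrite le_k; case: ltnP => [/TS //|ge_k].
      have -> : k = N by apply/eqP; rewrite eqn_leq le_k.
      by rewrite -[T N]CodeSeq.decodeK TN.
    elim: nw => [|x r y Rr _ IH|x r y Rr _ IH].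
    - by exists (fun=> 0), 0.
    - apply: extend IH _; apply/stepP; exists x, r, y; rewrite !CodeSeq.codeK.
      by split=> //; left.
    - apply: extend IH _; apply/stepP; exists x, r, y; rewrite !CodeSeq.codeK.
      by split=> //; right.
  exists (ccode T N.+1), N; rewrite !cnth_ccode //; split=> // k lt_k.
  by rewrite !cnth_ccode ?ltnS ?(ltnW lt_k) //; apply: TS.
have: forall k, k <= N -> null R (decode (cnth T k)).
  elim=> [|k IHk] le_k; first by rewrite T0; apply: null_nil.
  have [x [r [y [Rr ab]]]] := (stepP _ _).1 (TS _ le_k).
  have := IHk (ltnW le_k); case: ab => -[-> ->]; first exact: null_insert.
  exact: null_delete.
exact.
Qed.

Lemma semidec_null (R : nat -> nat -> nat -> nat -> Prop) :
  semidec 4 (fun e => R (e 0) (e 1) (e 2) (e 3)) ->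
  semidec 4 (fun e => null (fun r => R (e 0) (e 1) (e 2) (CodeSeq.code r)) (decode (e 3))).
Proof.
move=> sR.
apply: (@semidec_ext _ (fun e => exists T N, cnth T 0 = 0 /\ cnth T N = e 3 /\
    forall k, k < N -> exists x y z r s, R (e 0) (e 1) (e 2) r /\
      decode z = decode x ++ decode y /\ decode s = decode r ++ decode y /\
      ((cnth T k = z /\ decode (cnth T k.+1) = decode x ++ decode s) \/
      (decode (cnth T k) = decode x ++ decode s /\ cnth T k.+1 = z)))).
  move=> e; rewrite null_trace; split=> -[T [N]].
    move=> [T0 [TN TS]]; exists T, N; rewrite TN; split=> // k /TS.
    move=> [x [y [z [r [s [Rr [zE [sE ab]]]]]]]]; exists x, y, z, r, s.
    by rewrite CodeSeq.decodeK; split.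
  move=> [T0 TN TS]; exists T, N; split=> //; split; first exact: (can_inj CodeSeq.decodeK).
  move=> k /TS [x [y [z [r [s [Rr zE sE ab]]]]]]; exists x, y, z, r, s.
  by rewrite CodeSeq.decodeK in Rr; do !split.
repeat first [progress solve_semidec | semidec_word | simple apply (semidec_comp4 (P := R))].
Qed.

Section PresentationCode.
Variable P : finite_presentation.

Lemma ngens_code : cnth (presentation_code P) 0 = ngens P.
Proof. by rewrite /cnth /presentation_code CodeSeq.codeK. Qed.

Definition crelators c := cnth c 1.

Lemma size_relators_code :
  csize (crelators (presentation_code P)) = size (presented_relators P).
Proof. by rewrite /crelators /csize /cnth /presentation_code !CodeSeq.codeK !size_map. Qed.

Lemma decode_relator k : k < size (presented_relators P) ->
  decode (cnth (crelators (presentation_code P)) k) = nth [::] (presented_relators P) k.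
Proof.
rewrite size_map => lt_k.
rewrite /crelators /cnth /presentation_code !CodeSeq.codeK /=.
by rewrite !(nth_map 1%g) // /word_code CodeSeq.codeK.
Qed.

Lemma all_relators (A : seq nat -> Prop) :
  (forall k, k < csize (crelators (presentation_code P)) ->
     A (decode (cnth (crelators (presentation_code P)) k))) <->
  (forall r, r \in presented_relators P -> A r).
Proof.
rewrite size_relators_code; split=> [Ak r /(nthP [::])[k lt_k <-]|Ar k lt_k].
  by rewrite -decode_relator //; apply: Ak.
by rewrite decode_relator //; apply/Ar/mem_nth.
Qed.

Lemma ex_relators (A : seq nat -> Prop) :
  (exists k, k < csize (crelators (presentation_code P)) /\
     A (decode (cnth (crelators (presentation_code P)) k))) <->
  (exists2 r, r \in presented_relators P & A r).
Proof.
rewrite size_relators_code; split=> [[k [lt_k Ak]]|[r /(nthP [::])[k lt_k <-] Ar]].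
  by rewrite decode_relator // in Ak; exists (nth [::] (presented_relators P) k) => //; apply: mem_nth.
by exists k; split=> //; rewrite decode_relator.
Qed.

End PresentationCode.

Definition graph_relator_code cP cQ U r : Prop :=
  (exists i, r = ccons (i * 2) (ccons (i * 2).+1 0)) \/
  (exists i, r = ccons (i * 2).+1 (ccons (i * 2) 0)) \/
  (exists k, k < csize (cnth cQ 1) /\ cnth (cnth cQ 1) k = r) \/
  (exists i, i < cnth cP 0 /\ r = ccons ((cnth cQ 0 + i) * 2).+1 (cnth U i)).

Lemma graph_relator_codeP P Q U r :
  graph_relator_code (presentation_code P) (presentation_code Q) U (CodeSeq.code r)
  <-> graph_relator P Q (fun i => decode (cnth U i)) r.
Proof.
rewrite /graph_relator_code /graph_relator !ngens_code.
have codeE c : CodeSeq.code r = c <-> r = decode c.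
  by split=> [<-|->]; rewrite ?CodeSeq.codeK ?CodeSeq.decodeK.
split=> [[[i]|[[i]|[|[i]]]]|[[i]|[[i]|[|[i]]]]].
- by rewrite codeE !decode_ccons muln2 => ->; left; exists i.
- by rewrite codeE !decode_ccons muln2 => ->; right; left; exists i.
- move=> [k kr]; right; right; left.
  have /(ex_relators Q (fun q => q = r))[q Qq <- //] : exists k, k < csize (crelators (presentation_code Q)) /\
     decode (cnth (crelators (presentation_code Q)) k) = r.
  by exists k; case: kr => lt_k kr; split=> //; apply/esym/codeE.
- by rewrite codeE !decode_ccons muln2 => -[lt_i ->]; do 3!right; exists i.
- by move=> rE; left; exists i; apply/codeE; rewrite !decode_ccons muln2.
- by move=> rE; right; left; exists i; apply/codeE; rewrite !decode_ccons muln2.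
- move=> Qr; right; right; left.
  have /(ex_relators Q (fun q => q = r))[k [lt_k kr]] : exists2 q, q \in presented_relators Q & q = r by exists r.
  by exists k; split=> //; apply/esym/codeE.
- by move=> lt_i rE; do 3!right; exists i; split=> //; apply/codeE; rewrite !decode_ccons muln2.
Qed.

Definition epimorphism_certificate cP cQ : Prop := exists U V,
  (forall i, i < cnth cP 0 -> over (cnth cQ 0) (decode (cnth U i))) /\
  (forall k, k < csize (cnth cP 1) -> exists w,
     decode w = shift_word (cnth cQ 0) (decode (cnth (cnth cP 1) k)) /\
     null (fun r => graph_relator_code cP cQ U (CodeSeq.code r)) (decode w)) /\
  (forall j, j < cnth cQ 0 -> over (cnth cP 0) (decode (cnth V j)) /\
     exists w, decode w = shift_word (cnth cQ 0) (decode (cnth V j)) /\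
       null (fun r => graph_relator_code cP cQ U (CodeSeq.code r))
            (decode (ccons (j * 2).+1 w))).

Lemma semidec_epimorphism_certificate :
  semidec 2 (fun e => epimorphism_certificate (e 0) (e 1)).
Proof.
have sR : semidec 4 (fun e => graph_relator_code (e 0) (e 1) (e 2) (e 3)).
  by rewrite /graph_relator_code; solve_semidec.
have sN := semidec_null sR; rewrite /epimorphism_certificate.
by repeat first [progress solve_semidec | semidec_word |
  simple apply (semidec_comp4 (P := fun a b c d =>
    null (fun r => graph_relator_code a b c (CodeSeq.code r)) (decode d)))].
Qed.

Lemma epimorphism_certificateP P Q :
  epimorphism_certificate (presentation_code P) (presentation_code Q) <->
  group_epimorphism (group_of P) (group_of Q).
Proof.
rewrite epimorphism_null /epimorphism_certificate !ngens_code.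
have nullE U w :
    null (fun r => graph_relator_code (presentation_code P) (presentation_code Q) U (CodeSeq.code r)) w
    <-> null (graph_relator P Q (fun i => decode (cnth U i))) w.
  suff -> : (fun r => graph_relator_code (presentation_code P) (presentation_code Q) U (CodeSeq.code r)) =
    graph_relator P Q (fun i => decode (cnth U i)) by [].
  by apply: funext => r; apply: propext; apply: graph_relator_codeP.
split=> [[U [V [nU [/(all_relators P (fun r => exists w, decode w = shift_word _ r /\ null _ (decode w))) PU VQ]]]]|[u [v [nu Pu Qv]]]].
  exists (fun i => decode (cnth U i)), (fun i => decode (cnth V i)); split=> //.
    by move=> r /PU[w [<-]]; rewrite nullE.
  move=> j /VQ[nV [w [<-]]]; rewrite nullE decode_ccons muln2.
  by split.
pose U := ccode (fun i => CodeSeq.code (u i)) (ngens P).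
have nullU w : null (graph_relator P Q u) w -> null (graph_relator P Q (fun i => decode (cnth U i))) w.
  suff -> : graph_relator P Q u = graph_relator P Q (fun i => decode (cnth U i)) by [].
  apply: funext => r; apply: propext; rewrite /graph_relator.
  suff: (exists2 i, i < ngens P & r = (ngens Q + i).*2.+1 :: u i) <->
   (exists2 i, i < ngens P & r = (ngens Q + i).*2.+1 :: decode (cnth U i)) by move=> ->.
  by split=> -[i lt_i ->]; exists i; rewrite // cnth_ccode // CodeSeq.codeK.
exists U, (ccode (fun i => CodeSeq.code (v i)) (ngens Q)); split.
  by move=> i lt_i; rewrite cnth_ccode // CodeSeq.codeK nu.
split.
  apply/(all_relators P (fun r => exists w, decode w = shift_word _ r /\ null _ (decode w))).
  move=> r Pr; exists (CodeSeq.code (shift_word (ngens Q) r)).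
  by rewrite nullE CodeSeq.codeK; split=> //; apply/nullU/Pu.
move=> j lt_j; have [nv vj] := Qv j lt_j.
rewrite cnth_ccode // CodeSeq.codeK; split=> //.
exists (CodeSeq.code (shift_word (ngens Q) (v j))).
by rewrite nullE decode_ccons CodeSeq.codeK muln2; split=> //; apply: nullU.
Qed.

(** * Evaluation of words in coded groups *)

(** Evaluation of the word w in a group whose elements are coded by numbers, by the
sequence tr of the values of its prefixes. M is the graph of the multiplication
and 0 is a code of the neutral element. An inverse letter is read as a
multiplication in the opposite direction. The last value is multiplied by 1
because elements may have more than one code, and x is an arbitrary one. *)
Definition ceval (M : nat -> nat -> nat -> nat -> Prop) c g w x : Prop :=
  exists tr, cnth tr 0 = 0 /\ M c (cnth tr (csize w)) 0 x /\
  forall t, t < csize w ->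
    (cnth w t %% 2 = 0 /\ M c (cnth tr t) (cnth g (cnth w t %/ 2)) (cnth tr t.+1)) \/
    (cnth w t %% 2 = 1 /\ M c (cnth tr t.+1) (cnth g (cnth w t %/ 2)) (cnth tr t)).

Lemma semidec_ceval M :
  semidec 4 (fun e => M (e 0) (e 1) (e 2) (e 3)) ->
  semidec 4 (fun e => ceval M (e 0) (e 1) (e 2) (e 3)).
Proof.
move=> sM; rewrite /ceval.
by repeat first [progress solve_semidec | simple apply (semidec_comp4 (P := M))].
Qed.

Record congruence (G : groupType) (R : G -> G -> Prop) : Prop := Congruence {
  cong_refl : forall x, R x x;
  cong_sym : forall x y, R x y -> R y x;
  cong_trans : forall x y z, R x y -> R y z -> R x z;
  cong_mul : forall x y x' y', R x y -> R x' y' -> R (x * x')%g (y * y')%g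
}.

Lemma congruence_eq (G : groupType) : @congruence G eq.
Proof. by split=> // [x y z -> ->|x y x' y' -> ->]. Qed.

Section Ceval.
Variables (G : groupType) (R : G -> G -> Prop) (I : nat -> G).
Variables (M : nat -> nat -> nat -> nat -> Prop) (c : nat) (dom : nat -> Prop).
Hypotheses (congR : congruence R).
Hypothesis I0 : R (I 0) 1%g.

Lemma cong_div x y z : R (x * y)%g z -> R x (z * y^-1)%g.
Proof.
by move=> xyz; have := cong_mul congR xyz (cong_refl congR y^-1%g); rewrite mulgK.
Qed.

Lemma ev_rcons (g : nat -> G) w a : ev g (rcons w a) = (ev g w * letter g a)%g.
Proof. by rewrite -cats1 ev_cat /= mulg1. Qed.

Lemma ceval_sound g w x :
  (forall x y z, M c x y z -> R (I x * I y)%g (I z)) ->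
  ceval M c g w x -> R (ev (fun i => I (cnth g i)) (decode w)) (I x).
Proof.
move=> MR [tr [tr0 [trx trS]]]; set f := fun i => _.
suff evtr t : t <= csize w -> R (ev f (take t (decode w))) (I (cnth tr t)).
  have := MR _ _ _ trx; have := evtr _ (leqnn _); rewrite take_size => e1.
  apply: cong_trans congR _ _ _ _.
  by have := cong_mul congR e1 (cong_sym congR I0); rewrite mulg1.
elim: t => [|t IHt] lt_t; first by rewrite take0 tr0; apply: cong_sym congR _ _ I0.
rewrite (take_nth 0) // ev_rcons.
have {}IHt := IHt (ltnW lt_t); set a := nth _ _ t.
have oddE : odd a = (cnth w t %% 2 == 1) by rewrite modn2 eqb1.
have halfE : a./2 = cnth w t %/ 2 by rewrite divn2.
rewrite /letter oddE halfE; case: (trS t lt_t) => -[-> /MR H] /=.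
  by apply: cong_trans congR _ _ _ _ H; apply: cong_mul => //; apply: cong_refl.
apply: cong_trans congR _ _ _ (cong_mul congR IHt (cong_refl congR _)) _.
exact/(cong_sym congR)/cong_div.
Qed.

Lemma ceval_complete n g w x :
  (forall x y z, dom x -> dom y -> dom z -> R (I x * I y)%g (I z) -> M c x y z) ->
  (forall y, exists2 z, dom z & R (I z) y) -> dom 0 ->
  (forall i, i < n -> dom (cnth g i)) -> over n (decode w) -> dom x ->
  R (ev (fun i => I (cnth g i)) (decode w)) (I x) -> ceval M c g w x.
Proof.
move=> MR domS dom0 domg nw domx evx; set f := fun i => _ in evx.
have /choice[tr trP] : forall t, exists z, dom z /\ R (I z) (ev f (take t (decode w))) /\ (t = 0 -> z = 0).
  case=> [|t]; first by exists 0; rewrite take0.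
  by have [z dz Rz] := domS (ev f (take t.+1 (decode w))); exists z.
(* The trace has to start with the code 0 itself, not with another code of 1. *)
exists (ccode tr (csize w).+1); rewrite !cnth_ccode //.
have tr_dom t : dom (tr t) by case: (trP t).
have trR t : R (I (tr t)) (ev f (take t (decode w))) by case: (trP t) => _ [].
split; first by have [_ [_ ->]] := trP 0.
split.
  apply: MR => //; apply: cong_trans congR _ _ _ _ evx.
  rewrite -[X in R _ X]mulg1 -(take_size (decode w)).
  exact: cong_mul.
move=> t lt_t; rewrite !cnth_ccode ?ltnS ?(ltnW lt_t) //.
have dg : dom (cnth g (cnth w t %/ 2)).
  apply: domg; rewrite divn2 -ltn_letter.
  by move/(all_nthP 0): nw => /(_ t lt_t).
have := trR t.+1; rewrite (take_nth 0) // ev_rcons -/(cnth w t).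
rewrite /letter -divn2.
have: cnth w t %% 2 = odd (cnth w t) by rewrite modn2.
case: (odd _) => -> trS; [right|left]; split=> //; apply: MR => //.
  have := cong_mul congR trS (cong_refl congR (f (cnth w t %/ 2))).
  by rewrite mulgVK => H; apply: cong_trans congR _ _ _ H (cong_sym congR _).
apply: cong_sym => //; apply: cong_trans congR _ _ _ trS _.
by apply: cong_mul => //; [apply: cong_sym | apply: cong_refl].
Qed.

End Ceval.

(** * Signed translations of the integers *)

Section SignedTranslation.
Import GRing.Theory Num.Theory.
Local Open Scope ring_scope.

(** The pair (a, f) stands for the map x |-> a + x if f is false and x |-> a - x if f
is true, so this is the infinite dihedral group. *)
Definition zpm := (int * bool)%type.
HB.instance Definition _ := Choice.on zpm.

Definition sg (f : bool) (a : int) : int := if f then - a else a.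

Definition zpm_mul (x y : zpm) : zpm := (x.1 + sg x.2 y.1, x.2 (+) y.2).
Definition zpm_one : zpm := (0, false).
Definition zpm_inv (x : zpm) : zpm := (- sg x.2 x.1, x.2).

Lemma zpm_mulA : associative zpm_mul.
Proof.
move=> [a f] [b g] [d h]; rewrite /zpm_mul /= addbA; congr (_, _).
by case: f; case: g; rewrite /= ?opprD ?opprK addrA.
Qed.
Lemma zpm_mul1 : left_id zpm_one zpm_mul.
Proof. by move=> [a f]; rewrite /zpm_mul /= add0r. Qed.
Lemma zpm_mulr1 : right_id zpm_one zpm_mul.
Proof. by move=> [a []]; rewrite /zpm_mul /= ?oppr0 addr0. Qed.
Lemma zpm_mulV : left_inverse zpm_one zpm_inv zpm_mul.
Proof. by move=> [a []]; rewrite /zpm_mul /zpm_inv /= ?opprK ?subrr ?addNr. Qed.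
Lemma zpm_mulrV : right_inverse zpm_one zpm_inv zpm_mul.
Proof. by move=> [a []]; rewrite /zpm_mul /zpm_inv /= ?opprK ?subrr ?addNr. Qed.

HB.instance Definition _ :=
  isGroup.Build zpm zpm_mulA zpm_mul1 zpm_mulr1 zpm_mulV zpm_mulrV.

Definition zpm_eqmod (m : nat) (x y : zpm) : Prop :=
  x.2 = y.2 /\ (m%:Z %| x.1 - y.1)%Z.

Lemma congruence_zpm m : congruence (zpm_eqmod m).
Proof.
rewrite /zpm_eqmod; split.
- by move=> x; split=> //; rewrite subrr dvdz0.
- by move=> x y [-> xy]; split=> //; rewrite -opprB rpredN.
- move=> x y z [-> xy] [-> yz]; split=> //.
  by rewrite -(subrK y.1 x.1) -addrA rpredD.
move=> [a f] [b g] [a' f'] [b' g'] [/= -> ab] [/= -> ab']; split=> //=.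
have -> : (a + sg g a' - (b + sg g b') = (a - b) + sg g (a' - b'))%R.
  by rewrite /sg; case: (g); ring.
by rewrite rpredD // /sg; case: (g); rewrite ?rpredN.
Qed.

Lemma zpm_eqmod0 x y : zpm_eqmod 0 x y <-> x = y.
Proof.
case: x y => [a f] [b g]; split=> [[/= -> ]|-> //].
  by rewrite dvd0z subr_eq0 => /eqP->.
by split; rewrite // subrr dvdz0.
Qed.

(** The integer part is coded as a difference of two numbers, the sign as a parity. *)
Definition zpm_decode q : zpm := ((cnth q 0)%:Z - (cnth q 1)%:Z, odd (cnth q 2)).

Definition zpm_code (x : zpm) : nat :=
  CodeSeq.code [:: if x.1 is Posz n then n else 0%N;
                   if x.1 is Negz n then n.+1 else 0%N; nat_of_bool x.2].

Lemma zpm_codeK : cancel zpm_code zpm_decode.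
Proof.
case=> [a f]; rewrite /zpm_decode /zpm_code /cnth CodeSeq.codeK /= oddb.
by case: a => n; rewrite ?subr0 // add0r -NegzE.
Qed.

End SignedTranslation.

(** Multiplication modulo m; the case m = 0 is multiplication itself. The equations
are arranged so that no difference of numbers is needed. *)
Definition czpm_mul m x y z : Prop :=
  ((cnth x 2 %% 2 = 0 /\
    (cnth x 0 + cnth y 0 + cnth z 1) %% m = (cnth x 1 + cnth y 1 + cnth z 0) %% m) \/
   (cnth x 2 %% 2 = 1 /\
    (cnth x 0 + cnth y 1 + cnth z 1) %% m = (cnth x 1 + cnth y 0 + cnth z 0) %% m)) /\
  (cnth x 2 + cnth y 2) %% 2 = cnth z 2 %% 2.

Lemma semidec_czpm_mul : semidec 4 (fun e => czpm_mul (e 0) (e 1) (e 2) (e 3)).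
Proof. by rewrite /czpm_mul; solve_semidec. Qed.

Lemma eqn_mod_dvdz m (a b : nat) : a %% m = b %% m <-> (m%:Z %| (a%:Z - b%:Z)%R)%Z.
Proof.
rewrite -eqz_mod_dvd; split=> [/eqP|/eqP].
  by rewrite -eqz_nat -!modz_nat.
by rewrite !modz_nat => -[].
Qed.

Lemma czpm_mulP m x y z : czpm_mul m x y z <->
  zpm_eqmod m (zpm_decode x * zpm_decode y)%g (zpm_decode z).
Proof.
rewrite /czpm_mul /zpm_eqmod /=.
have -> : ((cnth x 2 + cnth y 2) %% 2 = cnth z 2 %% 2) <->
   odd (cnth x 2) (+) odd (cnth y 2) = odd (cnth z 2).
  rewrite !modn2 oddD; split=> [|-> //].
  by case: (_ (+) _); case: (odd _).
rewrite !eqn_mod_dvdz !modn2 /sg.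
have E1 : ((cnth x 0 + cnth y 0 + cnth z 1)%:Z - (cnth x 1 + cnth y 1 + cnth z 0)%:Z =
   (cnth x 0)%:Z - (cnth x 1)%:Z + ((cnth y 0)%:Z - (cnth y 1)%:Z) - ((cnth z 0)%:Z - (cnth z 1)%:Z))%R.
  by rewrite !PoszD; ring.
have E2 : ((cnth x 0 + cnth y 1 + cnth z 1)%:Z - (cnth x 1 + cnth y 0 + cnth z 0)%:Z =
   (cnth x 0)%:Z - (cnth x 1)%:Z + - ((cnth y 0)%:Z - (cnth y 1)%:Z) - ((cnth z 0)%:Z - (cnth z 1)%:Z))%R.
  by rewrite !PoszD; ring.
rewrite E1 E2; case: (odd (cnth x 2)); split.
- by move=> [[[]//|[_ ->]] ->].
- by move=> [-> ->]; split=> //; right.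
- by move=> [[[_ ->]|[]//] ->].
- by move=> [-> ->]; split=> //; left.
Qed.

(** * Multiplication tables of finite groups *)

Definition tmul tb x y := cnth (cnth tb 1) (x * cnth tb 0 + y).

Definition is_table tb : Prop :=
  0 < cnth tb 0 /\
  (forall x, x < cnth tb 0 ->
    (tmul tb x 0 = x /\ tmul tb 0 x = x) /\
    (exists y, y < cnth tb 0 /\ tmul tb x y = 0) /\
    forall y, y < cnth tb 0 -> tmul tb x y < cnth tb 0 /\
      forall z, z < cnth tb 0 -> tmul tb (tmul tb x y) z = tmul tb x (tmul tb y z)).

Lemma semidec_is_table : semidec 1 (fun e => is_table (e 0)).
Proof. by rewrite /is_table /tmul; solve_semidec. Qed.

Definition ctable_mul tb x y z : Prop :=
  x < cnth tb 0 /\ y < cnth tb 0 /\ z = tmul tb x y.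

Lemma semidec_ctable_mul : semidec 4 (fun e => ctable_mul (e 0) (e 1) (e 2) (e 3)).
Proof. by rewrite /ctable_mul /tmul; solve_semidec. Qed.

(** The proof H is part of the type so that the group laws can be inferred from it. *)
Definition table_group tb (H : is_table tb) := 'I_(cnth tb 0).

Section TableGroup.
Variables (tb : nat) (H : is_table tb).
Local Notation d := (cnth tb 0).
Local Notation E := (table_group H).

HB.instance Definition _ := Choice.on E.

Lemma tmul_lt (x y : E) : tmul tb x y < d.
Proof. by have [_ /(_ x (ltn_ord x))[_ [_ /(_ y (ltn_ord y))[]]]] := H. Qed.

Definition table_mul (x y : E) : E := Ordinal (tmul_lt x y).
Definition table_one : E := Ordinal H.1.

Lemma table_inv_ex (x : E) : exists y : E, table_mul x y = table_one.
Proof.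
have [_ /(_ x (ltn_ord x))[_ [[y [lt_y xy]] _]]] := H.
by exists (Ordinal lt_y); apply: val_inj.
Qed.

Definition table_inv (x : E) : E := projT1 (cid (table_inv_ex x)).

Lemma table_mulA : associative table_mul.
Proof.
move=> x y z; apply: val_inj => /=.
by have [_ /(_ x (ltn_ord x))[_ [_ /(_ y (ltn_ord y))[_ ->]]]] := H.
Qed.
Lemma table_mul1 : left_id table_one table_mul.
Proof.
by move=> x; apply: val_inj => /=; have [_ /(_ x (ltn_ord x))[[_ ->] _]] := H.
Qed.
Lemma table_mulr1 : right_id table_one table_mul.
Proof.
by move=> x; apply: val_inj => /=; have [_ /(_ x (ltn_ord x))[[-> _] _]] := H.
Qed.
Lemma table_mulrV : right_inverse table_one table_inv table_mul.
Proof. by move=> x; rewrite /table_inv; case: cid. Qed.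
Lemma table_mulV : left_inverse table_one table_inv table_mul.
Proof.
move=> x; rewrite -[LHS]table_mulr1 -(table_mulrV (table_inv x)).
by rewrite -table_mulA (table_mulA x) table_mulrV table_mul1.
Qed.

HB.instance Definition _ :=
  isGroup.Build E table_mulA table_mul1 table_mulr1 table_mulV table_mulrV.

Definition table_elt (x : nat) : E := insubd table_one x.

Lemma table_eltK x : x < d -> table_elt x = x :> nat.
Proof. by move=> lt_x; rewrite /table_elt val_insubd lt_x. Qed.

Lemma table_elt_val (x : E) : table_elt x = x.
Proof. exact: valKd. Qed.

Lemma table_elt0 : table_elt 0 = 1%g.
Proof. by apply: val_inj; rewrite /= table_eltK //; case: H. Qed.

Lemma table_eltM x y : x < d -> y < d ->
  (table_elt x * table_elt y)%g = table_elt (tmul tb x y).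
Proof.
move=> lt_x lt_y; apply: val_inj => /=.
rewrite table_eltK ?table_eltK //.
by have [_ /(_ x lt_x)[_ [_ /(_ y lt_y)[]]]] := H.
Qed.

Lemma ceval_tableP n g w x : (forall i, i < n -> cnth g i < d) ->
  over n (decode w) -> x < d ->
  ceval ctable_mul tb g w x <->
  ev (fun i => table_elt (cnth g i)) (decode w) = table_elt x.
Proof.
move=> gd nw lt_x; split.
  apply: (ceval_sound (@congruence_eq E)); first exact: table_elt0.
  by move=> a b z [lt_a [lt_b ->]]; apply: table_eltM.
apply: (@ceval_complete E eq table_elt ctable_mul tb (fun z => z < d) _ _ n) => //.
- exact: congruence_eq.
- exact: table_elt0.
- move=> a b z lt_a lt_b lt_z; rewrite table_eltM // => /(congr1 (@nat_of_ord _)).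
  rewrite !table_eltK //.
  by have [_ /(_ a lt_a)[_ [_ /(_ b lt_b)[]]]] := H.
- by move=> y; exists (nat_of_ord y); [exact: ltn_ord | exact: table_elt_val].
- by case: H.
Qed.

End TableGroup.

Lemma ceval_zpmP n g w x : over n (decode w) ->
  ceval czpm_mul 0 g w x <->
  ev (fun i => zpm_decode (cnth g i)) (decode w) = zpm_decode x.
Proof.
move=> nw; have c0 := @congruence_eq zpm; split.
  apply: (ceval_sound c0) => // a b z.
  by rewrite czpm_mulP zpm_eqmod0.
apply: (@ceval_complete zpm eq zpm_decode czpm_mul 0 (fun=> True) c0 _ n) => //.
- by move=> a b z _ _ _ E; apply/czpm_mulP/zpm_eqmod0.
- by move=> y; exists (zpm_code y) => //; apply: zpm_codeK.
Qed.

(** * The certificate of non-existence *)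

(** Here and below, tb is the table of the finite quotient of the group of Q, gq the
sequence of the images of its generators, and e the tuple that is to be ruled
out. *)
Definition fails_relator tb e cP : Prop :=
  exists k x, k < csize (cnth cP 1) /\
    ceval ctable_mul tb e (cnth (cnth cP 1) k) x /\ x <> 0.

(** U takes different values on an element of the group of Q and on 1, but is
constant on the cosets x<e>. *)
Definition fails_generating tb e gq cP cQ : Prop :=
  exists U, (forall x, x < cnth tb 0 -> forall i, i < cnth cP 0 ->
    cnth U (tmul tb x (cnth e i)) = cnth U x) /\
  exists j, j < cnth cQ 0 /\ cnth U (cnth gq j) <> cnth U 0.

(** b is a homomorphism from the group of Q to the signed translations that has the
translation by 1 in its image (2 is its code), and bt is a homomorphism modulo m
from the finite quotient through which b factors modulo m. *)
Definition ctranslation_target m b bt tb gq cQ : Prop :=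
  (forall k, k < csize (cnth cQ 1) -> ceval czpm_mul 0 b (cnth (cnth cQ 1) k) 0) /\
  (exists c0, over (cnth cQ 0) (decode c0) /\ ceval czpm_mul 0 b c0 2) /\
  (forall x, x < cnth tb 0 -> forall y, y < cnth tb 0 ->
     czpm_mul m (cnth bt x) (cnth bt y) (cnth bt (tmul tb x y))) /\
  (forall j, j < cnth cQ 0 -> czpm_mul m 0 (cnth b j) (cnth bt (cnth gq j))).

(** Modulo N, each cocycle with the same signs as z is a combination of z and of the
coboundary that takes the value 1 on the generators of negative sign. The tuples
modulo N are enumerated by the numbers below N ^ ngens P, through their digits. *)
Definition ccocycle_rank1 N z cP : Prop :=
  1 < N /\
  forall n, n < N ^ cnth cP 0 -> exists v,
    (forall i, i < cnth cP 0 -> cnth (cnth v i) 0 = n %/ N ^ i %% N /\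
       cnth (cnth v i) 1 = 0 /\ cnth (cnth v i) 2 = cnth (cnth z i) 2) /\
    ((exists k q, k < csize (cnth cP 1) /\
        ceval czpm_mul 0 v (cnth (cnth cP 1) k) q /\
        cnth q 0 %% N <> cnth q 1 %% N) \/
     (exists a b, forall i, i < cnth cP 0 ->
        (cnth (cnth v i) 0 + a * cnth (cnth z i) 1) %% N =
        (a * cnth (cnth z i) 0 + b * (cnth (cnth z i) 2 %% 2)) %% N)).

(** By [cocycle_unit], the word kw is sent by any epimorphism to an element whose
integer part is 1 or -1; the image of kw in the finite quotient contradicts this. *)
Definition fails_translation tb e gq cP cQ : Prop :=
  exists m N b bt z, ctranslation_target m b bt tb gq cQ /\
    ccocycle_rank1 N z cP /\
    (forall i, i < cnth cP 0 ->
       cnth (cnth z i) 2 %% 2 = cnth (cnth bt (cnth e i)) 2 %% 2) /\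
    (forall k, k < csize (cnth cP 1) -> ceval czpm_mul 0 z (cnth (cnth cP 1) k) 0) /\
    exists kw x, over (cnth cP 0) (decode kw) /\ ceval czpm_mul 0 z kw 2 /\
      x < cnth tb 0 /\ ceval ctable_mul tb e kw x /\
      cnth (cnth bt x) 0 %% m <> (cnth (cnth bt x) 1).+1 %% m /\
      (cnth (cnth bt x) 0).+1 %% m <> cnth (cnth bt x) 1 %% m.

Definition obstruction cP cQ : Prop :=
  exists tb gq, is_table tb /\
    (forall j, j < cnth cQ 0 -> cnth gq j < cnth tb 0) /\
    (forall k, k < csize (cnth cQ 1) ->
       ceval ctable_mul tb gq (cnth (cnth cQ 1) k) 0) /\
    forall n, n < cnth tb 0 ^ cnth cP 0 -> exists e,
      (forall i, i < cnth cP 0 -> cnth e i = n %/ cnth tb 0 ^ i %% cnth tb 0) /\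
      (fails_relator tb e cP \/
       (fails_generating tb e gq cP cQ \/ fails_translation tb e gq cP cQ)).

Section ObstructionSemidec.
Let s1 := semidec_ceval semidec_ctable_mul.
Let s2 := semidec_ceval semidec_czpm_mul.

Ltac solve_ceval := repeat first
  [ progress solve_semidec
  | semidec_word
  | eapply (semidec_comp1 (P := is_table) semidec_is_table)
  | eapply (semidec_comp4 (P := ceval ctable_mul) s1)
  | eapply (semidec_comp4 (P := ceval czpm_mul) s2)
  | eapply (semidec_comp4 (P := czpm_mul) semidec_czpm_mul) ].

Lemma semidec_fails_relator : semidec 3 (fun e => fails_relator (e 0) (e 1) (e 2)).
Proof. by rewrite /fails_relator; solve_ceval. Qed.

Lemma semidec_fails_generating :
  semidec 5 (fun e => fails_generating (e 0) (e 1) (e 2) (e 3) (e 4)).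
Proof. by rewrite /fails_generating /tmul; solve_ceval. Qed.

Lemma semidec_fails_translation :
  semidec 5 (fun e => fails_translation (e 0) (e 1) (e 2) (e 3) (e 4)).
Proof.
by rewrite /fails_translation /ctranslation_target /ccocycle_rank1 /tmul; solve_ceval.
Qed.

Lemma semidec_obstruction : semidec 2 (fun e => obstruction (e 0) (e 1)).
Proof.
rewrite /obstruction.
by repeat first [ progress solve_ceval
  | eapply (semidec_comp3 (P := fails_relator) semidec_fails_relator)
  | eapply (semidec_comp5 (P := fails_generating) semidec_fails_generating)
  | eapply (semidec_comp5 (P := fails_translation) semidec_fails_translation) ].
Qed.

End ObstructionSemidec.

(** * Soundness of the certificate of non-existence *)

Lemma digits d s (f : nat -> nat) : (forall i, i < s -> f i < d) ->
  exists2 n, n < d ^ s & forall i, i < s -> n %/ d ^ i %% d = f i.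
Proof.
elim: s f => [|s IHs] f lt_f; first by exists 0.
have [n lt_n nf] := IHs (fun i => f i.+1) (fun i lt_i => lt_f i.+1 lt_i).
have f0d := lt_f 0 isT; have d0 : 0 < d by apply: leq_trans f0d.
exists (n * d + f 0).
  rewrite expnSr; apply: leq_trans (_ : n.+1 * d <= _); last by rewrite leq_mul2r lt_n orbT.
  by rewrite mulSnr ltn_add2l.
case=> [|i] lt_i; first by rewrite expn0 divn1 modnMDl modn_small.
by rewrite expnS divnMA divnMDl // (divn_small f0d) addn0 nf.
Qed.

Section Congruence.
Variables (G : groupType) (R : G -> G -> Prop).
Hypothesis cR : congruence R.

Lemma cong_inv x y : R x y -> R x^-1%g y^-1%g.
Proof.
move=> xy; have := cong_mul cR (cong_refl cR x^-1%g) (cong_mul cR xy (cong_refl cR y^-1%g)).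
by rewrite mulKg mulgV mulg1 => /(cong_sym cR).
Qed.

Lemma cong_ev n (g h : nat -> G) w : (forall i, i < n -> R (g i) (h i)) ->
  over n w -> R (ev g w) (ev h w).
Proof.
move=> gh; elim: w => [_|a w IHw /= /andP[]]; first exact: (cong_refl cR).
rewrite ltn_letter => /gh Ra nw; apply: (cong_mul cR); last exact: IHw.
by rewrite /letter; case: (odd a) => //; apply: cong_inv.
Qed.

End Congruence.

Lemma ev_morph_mod (G H : groupType) (R : H -> H -> Prop) (f : G -> H) (g : nat -> G) w :
  congruence R -> (forall x y, R (f x * f y)%g (f (x * y)%g)) ->
  R (f (ev g w)) (ev (f \o g) w).
Proof.
move=> cR fR.
have f1 : R 1%g (f 1%g).
  have /(cong_div cR) := fR 1%g 1%g; rewrite mulg1 mulgV => H1.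
  exact: (cong_sym cR H1).
have fV x : R (f x^-1%g) (f x)^-1%g.
  have := fR x^-1%g x; rewrite mulVg => /(cong_div cR) H1.
  rewrite -[(f x)^-1%g]mul1g; apply: (cong_trans cR H1).
  by apply: (cong_mul cR (cong_sym cR f1)); apply: (cong_refl cR).
elim: w => [|a w IHw] /=; first exact: (cong_sym cR f1).
apply: (cong_trans cR (cong_sym cR (fR _ _))).
apply: (cong_mul cR) IHw; rewrite /letter; case: ifP => _; first exact: fV.
exact: (cong_refl cR).
Qed.

(** For fixed signs eps of the generators, the integer part of the value of a word is
linear in the integer parts of the values of the generators. *)
Section SignedEvaluation.
Import GRing.Theory Num.Theory.
Local Open Scope ring_scope.
Variable eps : nat -> bool.
Implicit Types v z : nat -> int.

Definition signed v i : zpm := (v i, eps i).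
Definition zev v w : int := (ev (signed v) w).1.
Definition zsg w : bool := (ev (signed (fun=> 0)) w).2.
Definition flips i : int := (eps i)%:R.

Lemma zev_cons v a w : zev v (a :: w) =
  (if odd a then - sg (eps a./2) (v a./2) else v a./2) + sg (eps a./2) (zev v w).
Proof. by rewrite /zev /= /letter; case: (odd a). Qed.

Lemma ev_sg v w : (ev (signed v) w).2 = zsg w.
Proof.
rewrite /zsg; elim: w => //= a w ->; congr (_ (+) _).
by rewrite /letter; case: (odd a).
Qed.

Lemma zsg_cons a w : zsg (a :: w) = eps a./2 (+) zsg w.
Proof. by rewrite /zsg /= /letter; case: (odd a). Qed.

Lemma ev_signed v w : ev (signed v) w = (zev v w, zsg w).
Proof. by rewrite -(ev_sg v) /zev; case: (ev (signed v) w). Qed.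

Lemma zev_lin a b v z w :
  zev (fun i => a * v i + b * z i) w = a * zev v w + b * zev z w.
Proof.
elim: w => [|c w IHw]; first by rewrite /zev /= !mulr0 addr0.
rewrite !zev_cons IHw; case: ifP => _; case: (eps _) => /=; ring.
Qed.

Lemma zev_flips w : zev flips w = (zsg w)%:R.
Proof.
elim: w => [//|c w IHw]; rewrite zev_cons IHw zsg_cons /flips.
by case: (odd c); case: (eps _); case: (zsg w).
Qed.

Lemma eq_zev n v z w : (forall i, (i < n)%N -> v i = z i) -> over n w ->
  zev v w = zev z w.
Proof.
move=> vz nw; rewrite /zev (@eq_ev _ n (signed v) (signed z)) // => i lt_i.
by rewrite /signed vz.
Qed.

Lemma zev_dvd d n v w : (forall i, (i < n)%N -> (d %| v i)%Z) -> over n w ->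
  (d %| zev v w)%Z.
Proof.
move=> dv; elim: w => [|c w IHw]; first by rewrite dvdz0.
rewrite zev_cons /= ltn_letter => /andP[c_n /IHw dw].
have dc := dv _ c_n.
by apply: rpredD; rewrite /sg; [case: ifP => _|]; case: (eps _); rewrite ?opprK ?rpredN.
Qed.

Lemma zev_sub v z w : zev v w - zev z w = zev (fun i => v i - z i) w.
Proof.
have := zev_lin 1 (-1) v z w; rewrite !mul1r !mulN1r => <-.
by congr zev; apply: funext => i; rewrite mul1r mulN1r.
Qed.

Definition delta (j i : nat) : int := (i == j)%:R.

Lemma zev_coef n v w : over n w ->
  zev v w = \sum_(j < n) zev (delta j) w * v j.
Proof.
elim: w => [_|c w IHw].
  by rewrite big1 // => i _; rewrite /zev mul0r.
rewrite -[over n (c :: w)]/((c < n.*2)%N && over n w) => /andP[].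
rewrite ltn_letter => c_n /IHw E.
have vE : v c./2 = \sum_(j < n) delta j c./2 * v j.
  rewrite (bigD1 (Ordinal c_n)) //= big1 ?addr0 /delta ?eqxx ?mul1r //.
  move=> i /eqP ni; case: eqP => [ci|]; last by rewrite mul0r.
  by case: ni; apply: val_inj.
have consE z : zev z (c :: w) = (if odd c then - sg (eps c./2) 1 else 1) * z c./2
    + sg (eps c./2) 1 * zev z w.
  by rewrite zev_cons /sg; case: (odd c); case: (eps _); ring.
rewrite consE E vE !mulr_sumr -big_split /=; apply: eq_bigr => j _.
by rewrite consE; ring.
Qed.

End SignedEvaluation.

Section Descent.
Import GRing.Theory Num.Theory Order.TTheory.
Local Open Scope ring_scope.
Variables (P : finite_presentation) (eps : nat -> bool) (z : nat -> int) (N : nat).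
Local Notation s := (ngens P).

Definition cocycle v := forall r, r \in presented_relators P -> zev eps v r = 0.

Hypothesis N_gt1 : (1 < N)%N.
Hypothesis sgP : forall r, r \in presented_relators P -> zsg eps r = false.
Hypothesis zP : cocycle z.
Hypothesis rank1 : forall v, cocycle v -> exists a b : int,
  forall i, (i < s)%N -> (N%:Z %| v i - (a * z i + b * flips eps i))%Z.

(** The difference between a cocycle and its approximation modulo N is N times a
cocycle, which can be approximated in turn. *)
Lemma cocycle_descent j v : cocycle v -> exists a b : int,
  forall i, (i < s)%N -> ((N ^ j)%N%:Z %| v i - (a * z i + b * flips eps i))%Z.
Proof.
elim: j v => [|j IHj] v vP; first by exists 0, 0 => i _; rewrite expn0 dvd1z.
have [a [b ab]] := rank1 vP.
pose u i := ((v i - (a * z i + b * flips eps i)) %/ N%:Z)%Z.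
have uE i : (i < s)%N -> v i - (a * z i + b * flips eps i) = N%:Z * u i.
  by move=> /ab lt_i; rewrite /u [RHS]mulrC divzK.
have uP : cocycle u.
  move=> r Pr; have nr := over_relator Pr.
  have N0 : N%:Z != 0 by rewrite eqz_nat -lt0n ltnW.
  apply/(mulfI N0); rewrite mulr0.
  have := zev_lin eps N%:Z 0 u u r; rewrite mul0r addr0 => <-.
  rewrite (@eq_zev _ s _ (fun i => 1 * v i + (-1) * (a * z i + b * flips eps i))) //.
    by rewrite zev_lin zev_lin vP // zP // zev_flips sgP // ?mulr0n !(mulr0, addr0).
  by move=> i lt_i; rewrite mul0r addr0 -uE // mul1r mulN1r.
have [a' [b' ab']] := IHj _ uP.
exists (a + N%:Z * a'), (b + N%:Z * b') => i lt_i.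
have -> : v i - ((a + N%:Z * a') * z i + (b + N%:Z * b') * flips eps i) =
  N%:Z * (u i - (a' * z i + b' * flips eps i)) by rewrite mulrBr -uE //; ring.
by rewrite expnS PoszM dvdz_mul // ab'.
Qed.

Lemma dvdz_all_exp (x : int) : (forall j, ((N ^ j)%N%:Z %| x)%Z) -> x = 0.
Proof.
move=> dv; apply/eqP; rewrite -absz_eq0; apply: contraT; rewrite -lt0n => x0.
have := dv `|x|%N; rewrite dvdzE absz_nat => /dvdn_leq -/(_ x0).
by rewrite leqNgt ltn_expl.
Qed.

(** On words of positive sign coboundaries vanish, so v is a multiple of z modulo each
power of N. Comparing the values on k and w gives v(k) z(w) = 1. *)
Lemma cocycle_unit v k w : cocycle v -> over s k -> over s w ->
  zsg eps k = false -> zsg eps w = false -> zev eps z k = 1 -> zev eps v w = 1 ->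
  zev eps v k = 1 \/ zev eps v k = -1.
Proof.
move=> vP nk nw sk sw zk vw.
suff E : zev eps v k * zev eps z w = 1.
  have := dvdz_mulr (zev eps z w) (dvdzz (zev eps v k)); rewrite E.
  by rewrite dvdz1; case: (zev eps v k) => [[|[|?]]|[|?]] //= _; [left|right].
apply/esym/eqP; rewrite -subr_eq0; apply/eqP/dvdz_all_exp => j.
have [a [b ab]] := cocycle_descent j vP.
have D u : over s u -> zsg eps u = false ->
    ((N ^ j)%N%:Z %| zev eps v u - a * zev eps z u)%Z.
  move=> nu su; have <- : zev eps (fun i => a * z i + b * flips eps i) u = a * zev eps z u.
    by rewrite zev_lin zev_flips su mulr0 addr0.
  by rewrite zev_sub; apply: zev_dvd nu => i /ab.
have := D _ nk sk; have := D _ nw sw; rewrite vw zk mulr1.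
set A := zev eps v k; set B := zev eps z w => d1 d2.
have -> : 1 - A * B = (1 - a * B) - (A - a) * B by ring.
by rewrite rpredB // dvdz_mulr.
Qed.

End Descent.

Section Soundness.
Variables P Q : finite_presentation.
Local Notation cP := (presentation_code P).
Local Notation cQ := (presentation_code Q).

Lemma satisfies_table tb (H : is_table tb) gq :
  (forall j, j < ngens Q -> cnth gq j < cnth tb 0) ->
  (forall k, k < csize (cnth cQ 1) -> ceval ctable_mul tb gq (cnth (cnth cQ 1) k) 0) ->
  satisfies Q (fun j => table_elt H (cnth gq j)).
Proof.
move=> gqd gqQ; apply/(all_relators Q (fun r => ev _ r = 1%g)) => k lt_k.
rewrite -(table_elt0 H); apply/(ceval_tableP _ gqd); last exact: gqQ.
  move: k lt_k; apply/(all_relators Q (over (ngens Q))).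
  exact: over_relator.
by case: H.
Qed.

Lemma satisfies_zpm (R : finite_presentation) b :
  (forall k, k < csize (cnth (presentation_code R) 1) ->
     ceval czpm_mul 0 b (cnth (cnth (presentation_code R) 1) k) 0) <->
  satisfies R (fun j => zpm_decode (cnth b j)).
Proof.
rewrite /satisfies -(all_relators R (fun r => ev _ r = 1%g)).
have E k : k < csize (crelators (presentation_code R)) ->
    over (ngens R) (decode (cnth (crelators (presentation_code R)) k)).
  by move: k; apply/(all_relators R (over (ngens R))); apply: over_relator.
by split=> bR k lt_k; have := bR k lt_k; rewrite (ceval_zpmP _ _ (E k lt_k)).
Qed.

Lemma rank1_certificate N z : ccocycle_rank1 N z cP ->
  satisfies P (fun i => zpm_decode (cnth z i)) ->
  forall v, cocycle P (fun i => (zpm_decode (cnth z i)).2) v -> exists a b : int,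
  forall i, i < ngens P -> (N%:Z %| (v i -
    (a * (zpm_decode (cnth z i)).1 + b * flips (fun i => (zpm_decode (cnth z i)).2) i))%R)%Z.
Proof.
set eps := fun i => (zpm_decode (cnth z i)).2.
rewrite /ccocycle_rank1 ngens_code => -[N_gt1 cert] zP v vP.
have N0 : (N%:Z != 0)%R by rewrite eqz_nat -lt0n ltnW.
pose f i := absz (v i %% N%:Z)%Z.
have fE i : Posz (f i) = (v i %% N%:Z)%Z by rewrite /f gez0_abs // modz_ge0.
have fN i : (N%:Z %| ((f i)%:Z - v i)%R)%Z.
  by rewrite fE -eqz_mod_dvd modz_mod.
have lt_f i : i < ngens P -> f i < N.
  by move=> _; rewrite -ltz_nat fE ltz_pmod // ltz_nat ltnW.
have [n lt_n nf] := digits lt_f.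
have [u [uE]] := cert n lt_n.
have uD i : i < ngens P -> zpm_decode (cnth u i) = signed eps (fun i => Posz (f i)) i.
  move=> lt_i; rewrite /zpm_decode /signed; have [-> [-> ->]] := uE i lt_i.
  by rewrite nf // GRing.subr0.
case=> [[k [q [lt_k [kq q0]]]]|[a [b ab]]]; last first.
  exists (Posz a), (Posz b) => i lt_i; have [u0 [u1 u2]] := uE i lt_i.
  have := ab i lt_i; rewrite u0 nf // => /eqn_mod_dvdz.
  have -> : (v i - (a%:Z * (zpm_decode (cnth z i)).1 + b%:Z * flips eps i) =
    ((f i + a * cnth (cnth z i) 1)%:Z - (a * cnth (cnth z i) 0 + b * (cnth (cnth z i) 2 %% 2))%:Z)
     - ((f i)%:Z - v i))%R.
    rewrite /flips /eps /= modn2; case: (odd _) => /=;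
    rewrite !PoszD !PoszM /=; ring.
  by move=> d1; rewrite GRing.rpredB.
case: q0; apply/eqn_mod_dvdz.
have [Pr nr] : decode (cnth (cnth cP 1) k) \in presented_relators P /\
    over (ngens P) (decode (cnth (cnth cP 1) k)).
  move: k lt_k {kq}; apply/(all_relators P (fun r => r \in _ /\ over _ r)).
  by move=> r Pr; rewrite (over_relator Pr).
move/(ceval_zpmP _ _ nr): kq.
rewrite (@eq_ev _ (ngens P) _ (signed eps (fun i => Posz (f i)))) // => /(congr1 fst) /= <-.
have := vP _ Pr; rewrite -/(zev _ _ _) => v0; rewrite -[zev _ _ _]GRing.subr0 -v0 zev_sub.
exact: zev_dvd nr.
Qed.

(** An epimorphism g composed with the homomorphism sigma to the finite quotient is a
tuple e, and each of the three reasons against e is refuted. *)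
Lemma obstruction_sound : obstruction cP cQ -> ~ group_epimorphism (group_of P) (group_of Q).
Proof.
rewrite /obstruction !ngens_code => -[tb [gq [H [gqd [gqQ cert]]]]].
move=> /pres_epimorphism[g gP gT].
have [sigma sM sE] := pres_hom (@satisfies_table tb H gq gqd gqQ).
have [n lt_n nE] := @digits (cnth tb 0) (ngens P) (fun i => nat_of_ord (sigma (g i))) (fun i _ => ltn_ord _).
have [e [eE fails]] := cert n lt_n.
have eG i : i < ngens P -> table_elt H (cnth e i) = sigma (g i).
  by move=> lt_i; rewrite eE // nE // table_elt_val.
have ed i : i < ngens P -> cnth e i < cnth tb 0.
  by move=> lt_i; rewrite eE // nE.
have evE w : over (ngens P) w ->
    ev (fun i => table_elt H (cnth e i)) w = sigma (ev g w).
  by move=> nw; rewrite ev_morph //; apply: eq_ev nw.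
have gqE j : j < ngens Q -> sigma (pres_gen Q j) = table_elt H (cnth gq j).
  move=> lt_j; have := sE [:: j.*2]; rewrite /= ltn_double lt_j => /(_ isT).
  by rewrite /letter odd_double doubleK !mulg1.
case: fails => [[k [x [lt_k [kx x0]]]]|[[U]|]].
- have [Pr nr] : decode (cnth (cnth cP 1) k) \in presented_relators P /\
    over (ngens P) (decode (cnth (cnth cP 1) k)).
    move: k lt_k {kx}; apply/(all_relators P (fun r => r \in _ /\ over _ r)).
    by move=> r Pr; rewrite (over_relator Pr).
  have lt_x : x < cnth tb 0.
    case: kx => tr [_ [[lt_t [_ ->]] _]].
    by have [_ /(_ _ lt_t)[[-> _] _]] := H.
  move/(ceval_tableP H ed nr lt_x): kx; rewrite evE // gP // morph_one // => x1.
  by apply: x0; rewrite -(table_eltK H lt_x) -x1.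
- rewrite !ngens_code => -[Ue [j [lt_j Uj]]].
  have Uinv w : over (ngens P) w -> cnth U (ev (fun i => table_elt H (cnth e i)) w : table_group H) = cnth U 0.
    elim/last_ind: w => [//|w a IHw]; rewrite /over all_rcons => /andP[].
    rewrite ltn_letter => a_n /IHw <-; rewrite ev_rcons; set x := ev _ w.
    have Ux (y : table_group H) : cnth U (y * table_elt H (cnth e a./2))%g = cnth U y.
      by rewrite -(Ue y (ltn_ord y) a./2 a_n) /= table_eltK // ed.
    by rewrite /letter; case: (odd a); rewrite ?Ux // -{2}(mulgVK (table_elt H (cnth e a./2)) x) Ux.
  have [w nw gw] := gT (pres_gen Q j).
  case: Uj; rewrite -(Uinv w nw) evE // gw gqE //.
  by rewrite table_eltK // gqd.
rewrite /fails_translation !ngens_code.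
move=> [m [N [b [bt [z [[bQ [[c0 [nc0 bc0]] [btM btb]]] [rk [ze [/satisfies_zpm zP [kw [x [nkw [zkw [lt_x [kx [x1 x2]]]]]]]]]]]]]]]].
rewrite ?ngens_code in nc0 btb.
have /pres_hom[pi piM piE] : satisfies Q (fun j => zpm_decode (cnth b j)) by apply/satisfies_zpm.
have cm := congruence_zpm m.
pose beta (y : table_group H) := zpm_decode (cnth bt y).
have betaM y y' : zpm_eqmod m (beta y * beta y')%g (beta (y * y')%g).
  by have /czpm_mulP := btM y (ltn_ord y) y' (ltn_ord y').
have betaE h : zpm_eqmod m (beta (sigma h)) (pi h).
  have [w nw <-] := pres_gen_generating h; rewrite sE // piE //.
  have := ev_morph_mod (fun j => table_elt H (cnth gq j)) w cm betaM.
  move=> Hm; apply: (cong_trans cm Hm).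
  apply: (cong_ev cm) nw => j lt_j; have /czpm_mulP := btb j lt_j.
  rewrite (_ : zpm_decode 0 = 1%g) // mul1g => /(cong_sym cm).
  by rewrite /= /beta table_eltK ?gqd.
pose eps i := (zpm_decode (cnth z i)).2.
pose z1 i := (zpm_decode (cnth z i)).1.
pose v i := (pi (g i)).1.
have epsE i : i < ngens P -> (pi (g i)).2 = eps i.
  move=> lt_i; have [<- _] := betaE (g i); rewrite /beta -nE // -eE //=.
  have := ze i lt_i; rewrite !modn2 /eps /=.
  by case: (odd _); case: (odd _).
have signedE w : ev (signed eps z1) w = ev (fun i => zpm_decode (cnth z i)) w.
  by congr ev; apply: funext => i; rewrite /signed /eps /z1; case: (zpm_decode _).
have pig w : over (ngens P) w -> pi (ev g w) = (zev eps v w, zsg eps w).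
  move=> nw; rewrite -ev_signed ev_morph //; apply: eq_ev nw => i lt_i /=.
  by rewrite /signed /v -epsE //; case: (pi (g i)).
have two : zpm_decode 2 = (1%R, false).
  by rewrite /zpm_decode -[2]/(CodeSeq.code [:: 1]) /cnth CodeSeq.codeK.
have vP : cocycle P eps v.
  by move=> r Pr; have := pig r (over_relator Pr); rewrite gP // morph_one // => -[<- _].
have z1R r : r \in presented_relators P -> (zev eps z1 r, zsg eps r) = (0%R, false).
  by move=> Pr; rewrite -ev_signed signedE zP.
have sgP r : r \in presented_relators P -> zsg eps r = false by move=> /z1R[].
have z1P : cocycle P eps z1 by move=> r /z1R[].
have [w nw gw] := gT (ev (pres_gen Q) (decode c0)).
have := pig w nw; rewrite gw piE //.
move/(ceval_zpmP _ _ nc0): bc0 => ->; rewrite two => -[vw sw].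
move/(ceval_zpmP _ _ nkw): zkw; rewrite -signedE two ev_signed => -[zk sk].
have N_gt1 : 1 < N by case: rk.
have unitk := cocycle_unit N_gt1 sgP z1P (rank1_certificate rk zP) vP nkw nw sk (esym sw) zk (esym vw).
have [] := betaE (ev g (decode kw)); rewrite pig // -evE //.
have /(ceval_tableP H ed nkw lt_x) -> := kx; rewrite /beta table_eltK //= => _ dk.
case: unitk => vk; rewrite vk in dk.
  case: x1; apply/eqn_mod_dvdz; congr (_ %| _)%Z: dk.
  by rewrite (intS (cnth (cnth bt x) 1)); ring.
case: x2; apply/eqn_mod_dvdz; congr (_ %| _)%Z: dk.
by rewrite (intS (cnth (cnth bt x) 0)); ring.
Qed.

End Soundness.

(** * Integer matrices *)

Section IntegerMatrices.
Import GRing.Theory Num.Theory Order.TTheory.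
Local Open Scope ring_scope.

(** The columns of Y are a basis of the kernel of E, and X is a retraction of Z^s onto
Z^r. The last equation, obtained from the Smith normal form, says that z - YXz is
killed by D modulo each integer that divides Ez: up to the factor D, solutions of
Ez = 0 modulo m come from integral ones. *)
Lemma int_kernel_split l s (E : 'M[int]_(l, s)) :
  exists r (X : 'M[int]_(r, s)) (Y : 'M[int]_(s, r)) (W : 'M[int]_(s, l)) (D : nat),
  [/\ (0 < D)%N, E *m Y = 0, X *m Y = 1%:M & D%:Z *: (1%:M - Y *m X) = W *m E].
Proof.
have [L Lu [R Ru [d _ EE]]] := int_Smith_normal_form E.
set Dl := (\matrix_(i, j) _) in EE.
pose J := [set j : 'I_s | (l <= j)%N || (d`_j == 0)].
pose e (k : 'I_#|J|) := enum_val k.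
have eJ k : (l <= e k)%N || (d`_(e k) == 0).
  by have := enum_valP k; rewrite inE.
pose X := rowsub e R; pose Y := colsub e (invmx R).
have RY : R *m Y = colsub e 1%:M by rewrite -(mulmxV Ru) -mulmx_colsub.
have XY : X *m Y = 1%:M.
  apply/matrixP=> i j; transitivity ((R *m invmx R) (e i) (e j)).
    by rewrite !mxE; apply: eq_bigr => k _; rewrite !mxE.
  by rewrite mulmxV // !mxE (inj_eq (@enum_val_inj _ _)).
pose dd (j : nat) := d`_j.
pose D := (\prod_(j < s | dd j != 0) `|dd j|)%N.
have D_gt0 : (0 < D)%N.
  by rewrite /D prodn_cond_gt0 // => j; rewrite absz_gt0.
have dD (j : 'I_s) : d`_j != 0 -> (d`_j %| D%:Z)%Z.
  by move=> dj; rewrite dvdzE /= /D (bigD1 j) //= dvdn_mulr.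
pose P : 'M[int]_s := \matrix_(i, j) ((i == j) && (j \in J))%:R.
have YX : Y *m X = invmx R *m P *m R.
  apply/matrixP => i j; rewrite !mxE.
  transitivity (\sum_(k in J) invmx R i k * R k j).
    rewrite (big_enum_val (fun k => invmx R i k * R k j)) /=.
    by apply: eq_bigr => k _; rewrite !mxE.
  rewrite big_mkcond /=; apply: eq_bigr => k _; rewrite !mxE.
  rewrite (bigD1 k) //= big1 ?addr0 => [|k' nk]; rewrite mxE.
    by rewrite eqxx /=; case: (k \in J); rewrite ?mulr1 // mulr0 mul0r.
  by rewrite (negPf nk) mulr0.
pose Di : 'M[int]_(s, l) := \matrix_(j, i)
   ((if dd j == 0 then 0 else (D%:Z %/ dd j)%Z) *+ (j == i :> nat)).
have DiD : Di *m Dl = D%:Z *: (1%:M - P).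
  apply/matrixP => i j; rewrite !mxE inE.
  have [le_i|lt_i] := leqP l i.
    rewrite big1 => [|k _]; last first.
      rewrite !mxE; case: (nat_of_ord i =P k) => [ik|_]; last by rewrite mulr0n mul0r.
      by have := ltn_ord k; rewrite -ik ltnNge le_i.
    case: (eqVneq i j) => [<-|_] /=; last by rewrite subr0 mulr0.
    by rewrite le_i subrr mulr0.
  rewrite (bigD1 (Ordinal lt_i)) //= big1 => [|k nk]; last first.
    rewrite !mxE; case: (nat_of_ord i =P k) => [ki|_]; last by rewrite mulr0n mul0r.
    by case/eqP: nk; apply: val_inj.
  rewrite !mxE /= eqxx mulr1n addr0 -val_eqE /=.
  case: (eqVneq (i : nat) j) => [ij|nij]; last first.
    by case: eqP => [ij|_]; rewrite ?mulr0n ?mulr0 ?subr0 ?mulr0 //; rewrite ij eqxx in nij.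
  have {j ij} <- : i = j by apply: val_inj.
  rewrite ?eqxx [(l <= i)%N]leqNgt lt_i /= mulr1n; case: (eqVneq (dd i) 0) => [di|di] /=.
    by rewrite mul0r subrr mulr0.
  by rewrite divzK ?dD // subr0 mulr1.
exists #|J|, X, Y, (invmx R *m Di *m invmx L), D; split=> //.
  rewrite EE -mulmxA RY; rewrite -mulmxA.
  suff -> : Dl *m colsub e 1%:M = 0 by rewrite mulmx0.
  rewrite mulmx_colsub mulmx1; apply/matrixP => i j; rewrite !mxE.
  have := eJ j; case: (nat_of_ord i =P e j) => [<-|]; last by rewrite mulr0n.
  by rewrite leqNgt ltn_ord /= => /eqP->.
rewrite EE !mulmxA (mulmxKV Lu) -(mulmxA _ Di) DiD YX.
rewrite -scalemxAr -scalemxAl; congr (_ *: _).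
by rewrite mulmxBr mulmxBl mulmx1 mulVmx.
Qed.

(** In a suitable basis y is g times the first basis vector, with g prime to m.
Adding m times the second basis vector makes it unimodular; one dimension would
not be enough for that. *)
Lemma unimodular_lift r m (y : 'cV[int]_r.+2) (a : 'rV[int]_r.+2) :
  (m%:Z %| ((a *m y) 0 0 - 1)%R)%Z ->
  exists2 y' : 'cV[int]_r.+2, (forall i, (m%:Z %| (y' i 0 - y i 0)%R)%Z) &
    exists a' : 'rV[int]_r.+2, (a' *m y') 0 0 = 1.
Proof.
have [L Lu [R Ru [d _ yE]]] := int_Smith_normal_form y.
pose g := d`_0 * R 0 0.
have {}yE : y = L *m (g *: delta_mx 0 0).
  rewrite yE -mulmxA; congr (_ *m _); apply/colP => i; rewrite !mxE big_ord1 !mxE.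
  rewrite eqxx andbT -val_eqE /=; case: eqVneq => [->|_]; last by rewrite mulr0n mul0r mulr0.
  by rewrite mulr1n mulr1.
move=> /dvdzP[q aq].
pose u := (a *m L) 0 0.
have ug : u * g + (- q) * m%:Z = 1.
  have uy : u * g = (a *m y) 0 0.
    by rewrite yE mulmxA -scalemxAr mxE -colE [in RHS]mxE mulrC.
  by rewrite mulNr -aq uy; ring.
exists (L *m (g *: delta_mx 0 0 + m%:Z *: delta_mx 1 0)).
  move=> i; rewrite yE mulmxDr mxE addrAC subrr add0r -scalemxAr mxE.
  exact: dvdz_mulr.
exists ((u *: delta_mx 0 0 + (- q) *: delta_mx 0 1) *m invmx L).
rewrite mulmxA mulmxKV // mulmxDl !mulmxDr -!scalemxAl -!scalemxAr.
by rewrite !mul_delta_mx_cond /= !mulr0n !mulr1n !scaler0 addr0 add0r !mxE /= !mulr1.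
Qed.

(** If G' has diagonal entries d_i in its Smith normal form, the hypothesis makes them
units modulo m. Projecting on the first r vectors of the basis on the right gives a
B for which the rows of G'B and of eB together generate Z^r. *)
Lemma unimodular_combination r k (m e : nat) (G' : 'M[int]_(r, k)) (B0 : 'M[int]_(k, r)) :
  (1 < m)%N -> (e %| m)%N ->
  (forall i j, (m%:Z %| ((G' *m B0) i j - (i == j)%:R)%R)%Z) ->
  exists (B : 'M[int]_(k, r)) (A1 : 'M[int]_r) (A2 : 'M[int]_(r, k)),
    A1 *m G' *m B + e%:Z *: (A2 *m B) = 1%:M.
Proof.
move=> m_gt1 /dvdnP[f mE] GB.
have [A Au [R Ru [d _ GE]]] := int_Smith_normal_form G'.
pose J : 'M[int]_(k, r) := \matrix_(i, j) (i == j :> nat)%:R.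
pose Di : 'M[int]_(r, k) := \matrix_(i, j) (d`_i *+ (i == j :> nat)).
pose N := R *m B0 *m A.
have [K KE] : exists K : 'M[int]_r, Di *m N = 1%:M + m%:Z *: K.
  have /choice[q qE] : forall ij : 'I_r * 'I_r, exists q : int,
      (G' *m B0) ij.1 ij.2 - (ij.1 == ij.2)%:R = q * m%:Z.
    by move=> [i j]; apply/dvdzP.
  exists (invmx A *m (\matrix_(i, j) q (i, j)) *m A).
  have -> : Di *m N = invmx A *m (G' *m B0) *m A.
    by rewrite GE /N !mulmxA (mulVmx Au) mul1mx.
  have -> : G' *m B0 = 1%:M + m%:Z *: (\matrix_(i, j) q (i, j)).
    by apply/matrixP => i j; rewrite !mxE mulrC -(qE (i, j)) /= addrC subrK mxE.
  by rewrite mulmxDr mulmx1 mulmxDl (mulVmx Au) -scalemxAr -scalemxAl.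
clearbody N; have lt_k (i : 'I_r) : (i < k)%N.
  rewrite ltnNge; apply/negP => le_ki.
  have := congr1 (fun M : 'M[int]_r => M i i) KE; rewrite !mxE big1 => [|j _].
    rewrite eqxx => /esym/eqP; rewrite addrC addr_eq0 => /eqP E.
    have : (m%:Z %| (- (1 : int))%R)%Z by rewrite -E dvdz_mulr.
    by rewrite rpredN dvdz1 absz_nat => /eqP m1; rewrite m1 in m_gt1.
  rewrite mxE; case: (nat_of_ord i =P j) => [ij|_]; last by rewrite mulr0n mul0r.
  by have := ltn_ord j; rewrite -ij ltnNge le_ki.
pose o (i : 'I_r) := Ordinal (lt_k i).
have DiE (i : 'I_r) : d`_i * N (o i) i = 1 + m%:Z * K i i.
  have := congr1 (fun M : 'M[int]_r => M i i) KE; rewrite !mxE eqxx.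
  rewrite (bigD1 (o i)) //= big1 ?addr0 => [|j nj].
    by rewrite mxE eqxx mulr1n => <-.
  rewrite mxE; case: (nat_of_ord i =P j) => [ij|_]; last by rewrite mulr0n mul0r.
  by case/eqP: nj; apply: val_inj.
pose U := diag_mx (\row_i N (o i) i).
pose V := diag_mx (\row_i K i i).
have UDJ : U *m (Di *m J) = 1%:M + m%:Z *: V.
  apply/matrixP => i j; rewrite mul_diag_mx !mxE.
  rewrite (bigD1 (o i)) //= big1 ?addr0 => [|t nt].
    rewrite !mxE /= eqxx mulr1n (inj_eq val_inj).
    case: (eqVneq i j) => [_|_]; last by rewrite ?mulr0n ?mulr0 ?addr0.
    by rewrite !mulr1n mulr1 mulrC DiE.
  rewrite mxE; case: (nat_of_ord i =P t) => [it|_]; last by rewrite mulr0n mul0r.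
  by case/eqP: nt; apply: val_inj.
have JJ : J^T *m J = 1%:M.
  apply/matrixP => i j; rewrite !mxE (bigD1 (o i)) //= big1 ?addr0 => [|t nt].
    by rewrite !mxE /= eqxx mul1r (inj_eq val_inj).
  rewrite !mxE; case: (nat_of_ord t =P i) => [it|_]; last by rewrite mul0r.
  by case/eqP: nt; apply: val_inj.
exists (invmx R *m J), (U *m invmx A), (- (f%:Z *: (V *m J^T *m R))).
rewrite GE -/Di !mulmxA (mulmxKV Au) (mulmxK Ru) -mulmxA UDJ.
rewrite !mulNmx -!scalemxAl (mulmxK Ru) -(mulmxA V) JJ mulmx1.
by rewrite scalerN scalerA -PoszM mulnC -mE addrK.
Qed.

Section Sublattice.
Variables (s : nat) (N : 'rV[int]_s -> Prop).
Hypotheses (N0 : N 0) (ND : forall u v, N u -> N v -> N (u + v)).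
Hypothesis NN : forall u, N u -> N (- u).

Lemma lattice_scale (a : int) u : N u -> N (a *: u).
Proof.
move=> Nu; have NMn n : N (u *+ n).
  by elim: n => [|n IHn]; rewrite ?mulr0n // mulrSr; apply: ND.
rewrite -[a]intz scaler_int; case: a => n; first exact: NMn.
by rewrite NegzE mulrNz; apply: NN; apply: NMn.
Qed.

Lemma lattice_combination l (E : 'M[int]_(l, s)) (c : 'rV_l) :
  (forall i, N (row i E)) -> N (c *m E).
Proof.
by move=> NE; rewrite mulmx_sum_row; elim/big_ind: _ => // i _; apply: lattice_scale.
Qed.

End Sublattice.

(** A subgroup N of Z^s need not be given by generators here, so [int_kernel_split] is
applied to a matrix with rows in N whose rank is as large as possible. *)
Lemma lattice_split s (N : 'rV[int]_s -> Prop) :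
  N 0 -> (forall u v, N u -> N v -> N (u + v)) -> (forall u, N u -> N (- u)) ->
  exists r (X : 'M[int]_(r, s)) (Y : 'M[int]_(s, r)) (D : nat),
  [/\ (0 < D)%N, X *m Y = 1%:M, forall u, N u -> u *m Y = 0
    & forall u, u *m Y = 0 -> N (D%:Z *: u)].
Proof.
move=> N0 ND NN.
(* E has rows in N and maximal rank over the rationals. *)
pose ranks k := `[< exists l (E : 'M[int]_(l, s)), (forall i, N (row i E)) /\
   \rank (map_mx (intr : int -> rat) E) = k >].
have ex_rank : exists k, ranks k.
  by exists 0%N; apply/asboolP; exists 0%N, 0; split=> [[]//|]; rewrite map_mx0 mxrank0.
have rank_le k : ranks k -> (k <= s)%N.
  by move=> /asboolP[l [E [_ <-]]]; apply: rank_leq_col.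
case: (ex_maxnP ex_rank rank_le) => k /asboolP[l [E [NE rE]]] maxk.
have [r [X [Y [W [D [D_gt0 EY XY DE]]]]]] := int_kernel_split E.
exists r, X, Y, D; split=> // u.
  move=> Nu; pose E' := col_mx E u.
  have /maxk le_k : ranks (\rank (map_mx (intr : int -> rat) E')).
    apply/asboolP; exists (l + 1)%N, E'; split=> // i.
    rewrite -(splitK i); case: (split i) => j /=; first by rewrite rowKu.
    by rewrite rowKd; have -> : row j u = u by apply/rowP => t; rewrite mxE ord1.
  have /submxP[c cE] : (map_mx (intr : int -> rat) u <= map_mx (intr : int -> rat) E)%MS.
    have sE : (map_mx (intr : int -> rat) E <= map_mx (intr : int -> rat) E')%MS.
      by rewrite map_col_mx -addsmxE addsmxSl.
    have := mxrank_leqif_sup sE; case=> le_r eq_r.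
    have : (map_mx (intr : int -> rat) E' <= map_mx (intr : int -> rat) E)%MS.
      by rewrite -eq_r eqn_leq le_r rE le_k.
    by apply: submx_trans; rewrite map_col_mx -addsmxE addsmxSr.
  have uY0 : map_mx (intr : int -> rat) (u *m Y) = 0.
    by rewrite map_mxM cE -mulmxA -map_mxM EY map_mx0 mulmx0.
  apply/matrixP => i j; apply: (@intr_inj rat).
  by have /matrixP/(_ i j) := uY0; rewrite !mxE.
move=> uY; have := congr1 (mulmx u) DE.
rewrite -scalemxAr mulmxBr mulmx1 (mulmxA u Y) uY mul0mx subr0 => ->.
by rewrite mulmxA; apply: lattice_combination.
Qed.

End IntegerMatrices.

(** * From finite congruences to certificates *)

Section Numbering.
Variables (G : groupType) (R : G -> G -> Prop).
Hypothesis cR : congruence R.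

Definition covering (l : seq G) := forall x, exists2 y, y \in l & R x y.

Lemma congruence_numbering l : covering l -> exists d (rep : nat -> G),
  [/\ 0 < d, rep 0 = 1%g, forall x, exists2 i, i < d & R x (rep i) &
      forall i j, i < d -> j < d -> R (rep i) (rep j) -> i = j].
Proof.
move=> lT.
have [l' [l'_gt0 l'1 l'inj l'l]] : exists l' : seq G, [/\ 0 < size l', nth 1%g l' 0 = 1%g,
    forall i j, i < size l' -> j < size l' -> R (nth 1%g l' i) (nth 1%g l' j) -> i = j &
    forall x, x \in l -> exists2 y, y \in l' & R x y].
  elim: l {lT} => [|x l [l' [l'_gt0 l'1 l'inj l'l]]].
    by exists [:: 1%g]; split=> // -[|//] [|].
  have [[y l'y xy]|nx] := pselect (exists2 y, y \in l' & R x y).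
    exists l'; split=> // x'; rewrite inE => /orP[/eqP->|/l'l //]; by exists y.
  exists (rcons l' x); split=> [||i j|x'].
  - by rewrite size_rcons.
  - by rewrite nth_rcons l'_gt0.
  - have nthE k : k < (size l').+1 -> k < size l' \/ k = size l'.
      by rewrite ltnS leq_eqVlt => /orP[/eqP|]; [right|left].
    rewrite size_rcons => /nthE[lt_i|->] /nthE[lt_j|->] //.
    + by rewrite !nth_rcons lt_i lt_j; apply: l'inj.
    + rewrite !nth_rcons lt_i ltnn eqxx => ix; case: nx.
      by exists (nth 1%g l' i); [apply: mem_nth | apply: (cong_sym cR)].
    + rewrite !nth_rcons lt_j ltnn eqxx => ix; case: nx.
      by exists (nth 1%g l' j); first apply: mem_nth.
  rewrite inE => /orP[/eqP->|/l'l[y l'y xy]].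
    by exists x; [rewrite mem_rcons mem_head | apply: (cong_refl cR)].
  by exists y; rewrite // mem_rcons inE l'y orbT.
exists (size l'), (nth 1%g l'); split=> // x.
have [y /l'l[z /(nthP 1%g)[i lt_i <-] yz] xy] := lT x.
by exists i => //; apply: (cong_trans cR xy yz).
Qed.

End Numbering.

Lemma mem_relator P k : k < csize (cnth (presentation_code P) 1) ->
  decode (cnth (cnth (presentation_code P) 1) k) \in presented_relators P.
Proof. by move: k; apply/(all_relators P (fun r => r \in _)). Qed.

Section Certificate.
Variables P Q : finite_presentation.
Local Notation L := (group_of Q).
Local Notation s := (ngens P).
Variable R : L -> L -> Prop.
Hypothesis cR : congruence R.

(** A homomorphism onto the quotient of L by the congruence R, given by
representatives in L of the images of the generators. *)
Definition hom_modulo (g : nat -> L) : Prop :=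
  (forall r, r \in presented_relators P -> R (ev g r) 1%g) /\
  (forall x, exists2 w, over s w & R (ev g w) x).

(** The third reason, [fails_translation], stated for the group L and integers instead
of tables and codes. *)
Definition translation_obstruction (g : nat -> L) : Prop :=
  exists (m N : nat) (pi : L -> zpm) (z : nat -> int) (kw : seq nat),
  let eps i := (pi (g i)).2 in
  [/\ [/\ {morph pi : x y / (x * y)%g}, exists x, pi x = (1%R, false) &
          forall x y, R x y -> zpm_eqmod m (pi x) (pi y)],
      1 < N /\ (forall v : nat -> int,
        (forall r, r \in presented_relators P -> (N%:Z %| zev eps v r)%Z) ->
        exists a b : int, forall i, i < s ->
          (N%:Z %| (v i - (a * z i + b * flips eps i))%R)%Z),
      forall r, r \in presented_relators P -> zev eps z r = 0%R /\ zsg eps r = false &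
      [/\ over s kw, zev eps z kw = 1%R, zsg eps kw = false &
        ~ (m%:Z %| ((pi (ev g kw)).1 - 1)%R)%Z /\
        ~ (m%:Z %| ((pi (ev g kw)).1 + 1)%R)%Z]].

Variables (d : nat) (rep : nat -> L).
Hypothesis rep0 : rep 0 = 1%g.
Hypothesis d_gt0 : 0 < d.
Hypothesis rep_ex : forall x, exists2 i, i < d & R x (rep i).
Hypothesis rep_inj : forall i j, i < d -> j < d -> R (rep i) (rep j) -> i = j.

Let idx (x : L) : nat := projT1 (cid2 (rep_ex x)).

Let idx_lt x : idx x < d. Proof. by rewrite /idx; case: cid2. Qed.
Let idxP x : R x (rep (idx x)). Proof. by rewrite /idx; case: cid2. Qed.

Let idx_eq x i : i < d -> R x (rep i) -> idx x = i.
Proof.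
move=> lt_i xi; apply: rep_inj => //.
exact: (cong_trans cR (cong_sym cR (idxP x)) xi).
Qed.

Let tb := CodeSeq.code [:: d; ccode (fun k => idx (rep (k %/ d) * rep (k %% d))%g) (d * d)].

Let tb0 : cnth tb 0 = d. Proof. by rewrite /cnth CodeSeq.codeK. Qed.

Let tmulE x y : x < d -> y < d -> tmul tb x y = idx (rep x * rep y)%g.
Proof.
move=> lt_x lt_y; rewrite /tmul tb0.
have -> : cnth tb 1 = ccode (fun k => idx (rep (k %/ d) * rep (k %% d))%g) (d * d).
  by rewrite {1}/cnth CodeSeq.codeK.
rewrite cnth_ccode; last first.
  by apply: leq_trans (_ : x.+1 * d <= _); [rewrite mulSnr ltn_add2l | rewrite leq_mul2r lt_x orbT].
by rewrite divnMDl // divn_small // addn0 modnMDl modn_small.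
Qed.

Let tb_table : is_table tb.
Proof.
rewrite /is_table tb0; split=> // x lt_x; split; [split|split].
- by rewrite tmulE // rep0 mulg1; apply: idx_eq => //; apply: (cong_refl cR).
- by rewrite tmulE // rep0 mul1g; apply: idx_eq => //; apply: (cong_refl cR).
- exists (idx (rep x)^-1%g); split=> //; rewrite tmulE //.
  apply: idx_eq => //; rewrite rep0 -(mulgV (rep x)).
  exact: (cong_mul cR (cong_refl cR _) (cong_sym cR (idxP _))).
move=> y lt_y; rewrite tmulE //; split=> // z lt_z.
rewrite tmulE // [tmul tb y z]tmulE // tmulE //; apply: idx_eq => //.
apply: (cong_trans cR) (idxP _).
apply: (cong_trans cR (cong_mul cR (cong_sym cR (idxP _)) (cong_refl cR (rep z)))).
by rewrite -mulgA; apply: (cong_mul cR (cong_refl cR _) (idxP _)).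
Qed.

Let ceval_tb n g w x : (forall i, i < n -> cnth g i < d) -> over n (decode w) ->
  x < d -> R (ev (fun i => rep (cnth g i)) (decode w)) (rep x) ->
  ceval ctable_mul tb g w x.
Proof.
move=> gd nw lt_x; apply: (@ceval_complete L R rep ctable_mul tb (fun z => z < d) cR _ n) => //.
- by rewrite rep0; apply: (cong_refl cR).
- move=> a b c lt_a lt_b lt_c abc; rewrite /ctable_mul tb0; split=> //; split=> //.
  by rewrite tmulE // (idx_eq lt_c).
- by move=> y; have [i lt_i yi] := rep_ex y; exists i => //; apply: (cong_sym cR).
Qed.

(** If a tuple satisfies the relators and generates modulo R, only the third reason
is left. *)
Lemma obstruction_complete :
  (forall g, hom_modulo g -> translation_obstruction g) ->
  obstruction (presentation_code P) (presentation_code Q).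
Proof.
move=> trans; rewrite /obstruction.
pose gq := ccode (fun j => idx (pres_gen Q j)) (ngens Q).
have gqE j : j < ngens Q -> cnth gq j = idx (pres_gen Q j) by apply: cnth_ccode.
exists tb, gq; split=> //; rewrite !ngens_code tb0; split.
  by move=> j lt_j; rewrite gqE.
split.
  move=> k lt_k; have Qr := mem_relator lt_k; have nr := over_relator Qr.
  apply: (ceval_tb (n := ngens Q)) => // [j lt_j|]; first by rewrite gqE.
  rewrite rep0 -(pres_gen_satisfies Qr); apply: (cong_sym cR).
  by apply: (cong_ev cR) nr => j lt_j; rewrite gqE.
move=> n lt_n; pose e := ccode (fun i => n %/ d ^ i %% d) s.
have eE i : i < s -> cnth e i = n %/ d ^ i %% d by apply: cnth_ccode.
have ed i : i < s -> cnth e i < d by move=> lt_i; rewrite eE // ltn_mod.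
exists e; split=> //.
pose g i := rep (cnth e i).
have [[r Pr nr]|hg] := pselect (exists2 r, r \in presented_relators P & ~ R (ev g r) 1%g).
  left.
  have /(ex_relators P (fun r => ~ R (ev g r) 1%g))[k [lt_k kr]] :
    exists2 r, r \in presented_relators P & ~ R (ev g r) 1%g by exists r.
  exists k, (idx (ev g (decode (cnth (crelators (presentation_code P)) k)))).
  split=> //; split.
    by apply: (ceval_tb ed) => //; apply/over_relator/mem_relator.
  by move=> i0; apply: kr; rewrite -rep0 -i0.
pose S x := exists2 w, over s w & R (ev g w) x.
have SM x y : S x -> S y -> S (x * y)%g.
  move=> [u nu ux] [v nv vy]; exists (u ++ v); first by rewrite over_cat nu.
  by rewrite ev_cat; apply: (cong_mul cR).
have SV x : S x -> S x^-1%g.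
  move=> [u nu ux]; exists (inverse_word u); rewrite ?over_inverse // ev_inverse.
  exact: cong_inv.
have SR x y : R x y -> S x -> S y.
  by move=> xy [u nu ux]; exists u => //; apply: (cong_trans cR ux xy).
have Sg i : i < s -> S (g i).
  move=> lt_i; exists [:: i.*2]; first by rewrite /= ltn_double lt_i.
  by rewrite /= mulg1 /letter odd_double doubleK; apply: (cong_refl cR).
right; have [[j lt_j Sj]|Sall] := pselect (exists2 j, j < ngens Q & ~ S (pres_gen Q j)).
  left; rewrite /fails_generating tb0 !ngens_code.
  pose U := ccode (fun x => `[< S (rep x) >] : nat) d.
  have UE x : x < d -> cnth U x = `[< S (rep x) >] by apply: cnth_ccode.
  exists U; split.
    move=> x lt_x i lt_i; rewrite tmulE ?ed // !UE //; congr nat_of_bool.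
    apply/asboolP/asboolP => [|Sx].
      move/(SR _ _ (cong_sym cR (idxP _))) => Sx.
      by rewrite -(mulgK (g i) (rep x)); apply: SM => //; apply/SV/Sg.
    by apply: (SR _ _ (idxP _)); apply: SM => //; apply: Sg.
  exists j; split=> //; rewrite gqE // !UE // rep0.
  have -> : `[< S 1%g >] = true by apply/asboolP; exists [::] => //; apply: (cong_refl cR).
  case: asboolP => // Sj'; case: Sj; exact: (SR _ _ (cong_sym cR (idxP _))).
right.
have ST x : S x.
  have [w nw <-] := pres_gen_generating x.
  elim: w nw => [_|a w IHw /= /andP[]]; first by exists [::] => //; apply: (cong_refl cR).
  rewrite ltn_letter => lt_a /IHw Sw; apply: SM => //.
  have Sa : S (pres_gen Q a./2) by apply: contrapT => Sa; apply: Sall; exists a./2.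
  by rewrite /letter; case: (odd a) => //; apply: SV.
have homg : hom_modulo g.
  split=> [r Pr|x]; last exact: ST.
  by apply: contrapT => nr; apply: hg; exists r.
have [m [N [pi [z [kw [[piM [x1 px1] piR] [N_gt1 rk] zR [nkw zkw skw [mis1 mis2]]]]]]]] := trans g homg.
pose eps i := (pi (g i)).2.
rewrite -/eps in rk zR zkw skw.
pose b := ccode (fun j => zpm_code (pi (pres_gen Q j))) (ngens Q).
have bE j : j < ngens Q -> zpm_decode (cnth b j) = pi (pres_gen Q j).
  by move=> lt_j; rewrite cnth_ccode // zpm_codeK.
have evb w : over (ngens Q) w -> ev (fun j => zpm_decode (cnth b j)) w = pi (ev (pres_gen Q) w).
  by move=> nw; rewrite ev_morph //; apply: eq_ev nw.
pose bt := ccode (fun x => zpm_code (pi (rep x))) d.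
have btE x : x < d -> zpm_decode (cnth bt x) = pi (rep x).
  by move=> lt_x; rewrite cnth_ccode // zpm_codeK.
pose cz v := ccode (fun i => zpm_code (signed eps v i)) s.
have czE v i : i < s -> zpm_decode (cnth (cz v) i) = signed eps v i.
  by move=> lt_i; rewrite cnth_ccode // zpm_codeK.
have cz2 v i : i < s -> cnth (cnth (cz v) i) 2 = eps i.
  by move=> lt_i; rewrite cnth_ccode // /cnth CodeSeq.codeK.
have evz v w : over s w -> ev (fun j => zpm_decode (cnth (cz v) j)) w = (zev eps v w, zsg eps w).
  by move=> nw; rewrite -ev_signed; apply: eq_ev nw => i; apply: czE.
have two : zpm_decode 2 = (1%R, false).
  by rewrite /zpm_decode -[2]/(CodeSeq.code [:: 1]) /cnth CodeSeq.codeK.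
have zero : zpm_decode 0 = 1%g by [].
have cm := congruence_zpm m.
exists m, N, b, bt, (cz z); rewrite ?ngens_code ?tb0; split.
  split; first by apply/satisfies_zpm => r Qr; rewrite evb ?over_relator // pres_gen_satisfies // morph_one.
  rewrite !ngens_code tb0; split.
    have [w nw wx] := pres_gen_generating x1; exists (CodeSeq.code w); rewrite CodeSeq.codeK.
    split=> //; apply/(@ceval_zpmP (ngens Q)); rewrite CodeSeq.codeK // evb // wx two.
    exact: px1.
  split=> [x lt_x y lt_y|j lt_j]; apply/czpm_mulP.
    rewrite tmulE // !btE // -piM; apply: piR; exact: idxP.
  by rewrite zero mul1g bE // btE ?gqE //; apply: piR; exact: idxP.
split.
  split=> //; rewrite ngens_code => n' lt_n'.
  pose v i := (n' %/ N ^ i %% N : nat)%:Z%R.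
  exists (ccode (fun i => CodeSeq.code [:: n' %/ N ^ i %% N; 0; eps i : nat]) s).
  have vD i : i < s -> cnth (ccode (fun i => CodeSeq.code [:: n' %/ N ^ i %% N; 0; eps i : nat]) s) i
       = CodeSeq.code [:: n' %/ N ^ i %% N; 0; eps i : nat].
    exact: cnth_ccode.
  split; first by move=> i lt_i; rewrite vD // {1 2 3}/cnth CodeSeq.codeK cz2.
  set cv := ccode _ s in vD *.
  have evv w : over s w -> ev (fun j => zpm_decode (cnth cv j)) w = (zev eps v w, zsg eps w).
    move=> nw; rewrite -ev_signed; apply: eq_ev nw => i lt_i; rewrite vD //.
    by rewrite /zpm_decode /cnth CodeSeq.codeK /signed /= oddb GRing.subr0.
  have [[r Pr nr]|vP] := pselect (exists2 r, r \in presented_relators P & ~ (N%:Z %| zev eps v r)%Z).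
    left; have /(ex_relators P (fun r => ~ (N%:Z %| zev eps v r)%Z))[k [lt_k kr]] :
      exists2 r, r \in presented_relators P & ~ (N%:Z %| zev eps v r)%Z by exists r.
    have nk := over_relator (mem_relator lt_k).
    set w := decode _ in nk kr.
    exists k, (zpm_code (zev eps v w, zsg eps w)); split=> //; split.
      by apply/(ceval_zpmP _ _ nk); rewrite evv // zpm_codeK.
    have E : (zpm_decode (zpm_code (zev eps v w, zsg eps w))).1 = zev eps v w.
      by rewrite zpm_codeK.
    by move/eqn_mod_dvdz => dq; apply: kr; rewrite -E; exact: dq.
  right; have [|a [b' ab]] := rk v.
    by move=> r Pr; apply: contrapT => nr; apply: vP; exists r.
  have N0 : (N%:Z != 0)%R by rewrite eqz_nat -lt0n ltnW.
  pose red (x : int) := absz (x %% N%:Z)%Z.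
  have redE x : (N%:Z %| ((red x)%:Z - x)%R)%Z.
    by rewrite /red gez0_abs ?modz_ge0 // -eqz_mod_dvd modz_mod.
  exists (red a), (red b') => i lt_i; apply/eqn_mod_dvdz.
  rewrite cz2 // vD // {1}/cnth CodeSeq.codeK /=.
  have zE : ((cnth (cnth (cz z) i) 0)%:Z - (cnth (cnth (cz z) i) 1)%:Z = z i)%R.
    by have := czE z i lt_i => -[].
  have := ab i lt_i; rewrite -zE /flips modn2 oddb !PoszD !PoszM.
  set z0 := cnth _ 0; set z1 := cnth _ 1 => dv.
  have -> : ((n' %/ N ^ i %% N)%:Z + (red a)%:Z * z1%:Z - ((red a)%:Z * z0%:Z + (red b')%:Z * (eps i)%:Z) =
    (v i - (a * (z0%:Z - z1%:Z) + b' * (eps i)%:R)) - ((red a)%:Z - a) * (z0%:Z - z1%:Z)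
     - ((red b')%:Z - b') * (eps i)%:R)%R.
    by rewrite /v; case: (eps i) => /=; ring.
  apply: GRing.rpredB; last exact: dvdz_mulr.
  by apply: GRing.rpredB => //; exact: dvdz_mulr.
split.
  move=> i lt_i; rewrite cz2 // -/(g i) modn2 oddb modn2.
  by have /(congr1 snd) /= -> := btE _ (ed i lt_i).
split.
  apply/satisfies_zpm => r Pr; rewrite evz ?over_relator //.
  by have [-> ->] := zR r Pr.
exists (CodeSeq.code kw), (idx (ev g kw)); rewrite CodeSeq.codeK; split=> //; split.
  by apply/(@ceval_zpmP s); rewrite CodeSeq.codeK // evz // zkw skw two.
split=> //; split; first by apply: (ceval_tb ed); rewrite ?CodeSeq.codeK.
have [_] := piR _ _ (idxP (ev g kw)); rewrite -btE // [(zpm_decode _).1]/=.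
set x0 := cnth _ 0; set y0 := cnth _ 1 => dk.
split=> /eqn_mod_dvdz dx.
  apply: mis1; have -> : ((pi (ev g kw)).1 - 1 =
    ((pi (ev g kw)).1 - (x0%:Z - y0%:Z)) + (x0%:Z - y0.+1%:Z))%R by rewrite (intS y0); ring.
  by rewrite GRing.rpredD.
apply: mis2; have -> : ((pi (ev g kw)).1 + 1 =
    ((pi (ev g kw)).1 - (x0%:Z - y0%:Z)) + (x0.+1%:Z - y0%:Z))%R by rewrite (intS x0); ring.
by rewrite GRing.rpredD.
Qed.

End Certificate.

Import GRing.Theory Num.Theory.

(** * Finite groups and products of a lattice and a finite group *)

Lemma pigeonhole (T : eqType) (l : seq T) (f : nat -> T) :
  (forall i, f i \in l) -> exists i j, [/\ i < j, j <= size l & f i = f j].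
Proof.
move=> fl; have: ~~ uniq (mkseq f (size l).+1).
  apply/negP => uf; suff: size (mkseq f (size l).+1) <= size l by rewrite size_mkseq ltnn.
  by apply: uniq_leq_size uf _ => x /mapP[i _ ->]; apply: fl.
case/(uniqPn (f 0)) => i [j [lt_ij]]; rewrite size_mkseq ltnS => le_j.
by rewrite !nth_mkseq ?ltnS // ?(leq_trans (ltnW lt_ij)) //; exists i, j.
Qed.

Lemma finite_exponent (G : groupType) (T : G -> Prop) (l : seq G) :
  (forall x, T x -> x \in l) -> (forall x n, T x -> T (x ^+ n)%g) ->
  forall x, T x -> (x ^+ ((size l)`!) = 1)%g.
Proof.
move=> Tl TX x Tx; have [i [j [lt_ij le_j xij]]] := pigeonhole (fun n => Tl _ (TX x n Tx)).
have x1 : (x ^+ (j - i) = 1)%g by rewrite expgnFr ?(ltnW lt_ij) // xij mulgV.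
have /dvdnP[q ->] : j - i %| (size l)`!.
  by rewrite dvdn_fact // subn_gt0 lt_ij (leq_trans (leq_subr _ _)).
by rewrite mulnC expgnA x1 expg1n.
Qed.

Section FiniteTarget.
Variables P Q : finite_presentation.

Lemma obstruction_finite (l : seq (group_of Q)) :
  (forall x, x \in l) -> ~ group_epimorphism (group_of P) (group_of Q) ->
  obstruction (presentation_code P) (presentation_code Q).
Proof.
move=> lT nepi; have cR := @congruence_eq (group_of Q).
have [d [rep [d_gt0 rep0 rep_ex rep_inj]]] : exists d (rep : nat -> group_of Q),
  [/\ 0 < d, rep 0 = 1%g, forall x, exists2 i, i < d & x = (rep i) &
      forall i j, i < d -> j < d -> (rep i) = (rep j) -> i = j].
  by apply: (congruence_numbering cR (l := l)) => x; exists x.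
apply: (obstruction_complete cR rep0 d_gt0 rep_ex rep_inj) => g [gP gT].
by case: nepi; apply/pres_epimorphism; exists g.
Qed.

End FiniteTarget.

Section Coefficients.
Local Open Scope ring_scope.
Variable s : nat.

Definition letter_coef a : 'rV[int]_s :=
  \row_i (if odd a then - (i == a./2 :> nat)%:R else (i == a./2 :> nat)%:R).

Definition word_coef (w : seq nat) : 'rV[int]_s :=
  foldr (fun a u => letter_coef a + u) 0 w.

Lemma word_coef_cat u v : word_coef (u ++ v) = word_coef u + word_coef v.
Proof. by elim: u => /= [|a u ->]; rewrite ?add0r ?addrA. Qed.

Lemma letter_coefE a (lt_a : (a./2 < s)%N) :
  letter_coef a = (if odd a then -1 else 1) *: delta_mx 0 (Ordinal lt_a).
Proof.
apply/rowP => i; rewrite !mxE eqxx /= -val_eqE /=.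
by case: (odd a); rewrite ?mulN1r ?mul1r.
Qed.

Lemma word_coef_inverse w : word_coef (inverse_word w) = - word_coef w.
Proof.
elim: w => [|a w IHw] /=; first by rewrite oppr0.
rewrite /inverse_word /= rev_cons -cats1 word_coef_cat -/(inverse_word w) IHw.
rewrite opprD addrC /= addr0; congr (_ + _).
apply/rowP => i; rewrite !mxE odd_flip_letter half_flip_letter if_neg.
by case: (odd a); rewrite ?opprK.
Qed.

Lemma word_coef_nseq n (i : 'I_s) :
  word_coef (nseq n (i : nat).*2) = n%:Z *: delta_mx 0 i.
Proof.
elim: n => [|n IHn] /=; first by rewrite scale0r.
rewrite IHn intS scalerDl scale1r; congr (_ + _).
by apply/rowP => j; rewrite !mxE odd_double doubleK.
Qed.

Variables (G : groupType) (r : nat) (f : G -> 'rV[int]_r).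
Hypothesis fM : forall x y, f (x * y)%g = f x + f y.

Lemma additive1 : f 1%g = 0.
Proof. by apply: (addrI (f 1%g)); rewrite -fM mulg1 addr0. Qed.

Lemma additiveV x : f x^-1%g = - f x.
Proof. by apply: (addrI (f x)); rewrite -fM mulgV additive1 subrr. Qed.

Lemma additive_ev g w : over s w ->
  f (ev g w) = word_coef w *m \matrix_(i < s) f (g i).
Proof.
elim: w => [_|a w IHw /=]; first by rewrite mul0mx; apply: additive1.
rewrite ltn_letter => /andP[lt_a nw]; rewrite fM mulmxDl -IHw //; congr (_ + _).
rewrite letter_coefE -scalemxAl -rowE rowK /letter; case: (odd a); last by rewrite scale1r.
by rewrite additiveV scaleN1r.
Qed.

End Coefficients.

Section AbelianSplitting.
Local Open Scope ring_scope.

(** The kernel of f is the torsion subgroup, finite because it is contained in l: V is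
the direct sum of Z^r, embedded by c, and a finite group. *)
Lemma fg_zmodule_split (V : zmodType) s (a : 'I_s -> V) :
  (forall x, exists n : 'rV[int]_s, x = \sum_i a i *~ n 0 i) ->
  exists r (f : V -> 'rV[int]_r) (c : 'rV[int]_r -> V) (l : seq V),
  [/\ {morph f : x y / x + y}, {morph c : u v / u + v}, cancel c f &
      forall x, f x = 0 -> x \in l].
Proof.
move=> aT; pose psi (n : 'rV[int]_s) := \sum_i a i *~ n 0 i.
have psiD u v : psi (u + v) = psi u + psi v.
  by rewrite /psi -big_split; apply: eq_bigr => i _; rewrite mxE mulrzDr.
have psi0 : psi 0 = 0.
  by rewrite /psi big1 // => i _; rewrite mxE mulr0z.
have psiN u : psi (- u) = - psi u.
  by apply: (addrI (psi u)); rewrite -psiD !subrr.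
have [|u v Nu Nv|u Nu|r [X [Y [D [D_gt0 XY NY YN]]]]] := @lattice_split s (fun n => psi n = 0).
- exact: psi0.
- by rewrite psiD Nu Nv addr0.
- by rewrite psiN Nu oppr0.
have /choice[n nE] : forall x, exists n, x = psi n by exact: aT.
have nY u v : psi u = psi v -> u *m Y = v *m Y.
  move=> uv; apply/eqP; rewrite -subr_eq0 -mulmxBl; apply/eqP/NY.
  by rewrite psiD psiN uv subrr.
pose f x := n x *m Y; pose c v := psi (v *m X).
have fpsi u : f (psi u) = u *m Y by apply: nY; rewrite -nE.
pose th u := psi (u *m (1%:M - Y *m X)).
have thD u v : th (u + v) = th u + th v by rewrite /th mulmxDl psiD.
have thZ (u : 'rV[int]_s) : th (D%:Z *: u) = 0.
  rewrite /th -scalemxAl; apply: YN.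
  by rewrite -mulmxA mulmxBl mul1mx -mulmxA XY mulmx1 subrr mulmx0.
exists r, f, c, [seq th (\row_i (k i : nat)%:Z) | k : {ffun 'I_s -> 'I_D}]; split.
- by move=> x y; rewrite {1}(nE x) {1}(nE y) -psiD fpsi mulmxDl.
- by move=> u v; rewrite /c mulmxDl psiD.
- by move=> v; rewrite /c fpsi -mulmxA XY mulmx1.
move=> x fx.
have -> : x = th (n x).
  by rewrite /th mulmxBr mulmx1 mulmxA -/(f x) fx mul0mx subr0.
have D0 : D%:Z != 0 by rewrite eqz_nat -lt0n.
have lt_D i : (absz (n x 0%R i %% D%:Z)%Z < D)%N.
  by rewrite -ltz_nat gez0_abs ?modz_ge0 // ltz_pmod.
apply/mapP; exists [ffun i => Ordinal (lt_D i)]; first by rewrite mem_enum.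
rewrite -[LHS]addr0 -(thZ (\row_i (n x 0%R i %/ D%:Z)%Z)) -[RHS]addr0.
set u := \row_i _; set v := \row_i _.
have -> : n x = D%:Z *: u + v.
  apply/rowP => i; rewrite !mxE ffunE /= gez0_abs ?modz_ge0 //.
  by rewrite mulrC -divz_eq.
by rewrite thD !thZ add0r.
Qed.

(** A copy of A that carries the additive notation, for the use of sums and of
multiples by integers. *)
Definition zmodule_of (A : groupType) (_ : abelian_group A) : Type := A.

Section ZmoduleOf.
Variables (A : groupType) (H : abelian_group A).
Local Notation V := (zmodule_of H).
HB.instance Definition _ := Choice.on V.
Let add (x y : V) : V := (x * y)%g.
Let opp (x : V) : V := x^-1%g.
Let zero : V := 1%g.
Let addA : associative add. Proof. exact: mulgA. Qed.
Let addC : commutative add. Proof. by move=> x y; apply: H. Qed.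
Let add0 : left_id zero add. Proof. exact: mul1g. Qed.
Let addN : left_inverse zero opp add. Proof. exact: mulVg. Qed.
HB.instance Definition _ := GRing.isZmodule.Build V addA addC add0 addN.
End ZmoduleOf.

Lemma fg_abelian_split (A : groupType) : abelian_group A -> finitely_generated A ->
  exists r (f : A -> 'rV[int]_r) (c : 'rV[int]_r -> A) (l : seq A),
  [/\ forall x y, f (x * y)%g = f x + f y, forall u v, c (u + v) = (c u * c v)%g,
      cancel c f & forall x, f x = 0 -> x \in l].
Proof.
move=> H [A0 /finite_seqP[a ->] genA].
pose V : zmodType := zmodule_of H.
suff: forall x : V, exists n : 'rV[int]_(size a), x = \sum_(i < size a) (nth 1%g a i : V) *~ n 0 i.
  move=> /fg_zmodule_split[r [f [c [l [fM cM cf ker]]]]].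
  by exists r, f, c, l.
move=> x; have: generated [set` a]%classic x by rewrite genA.
move=> /(_ [set x : A | exists n : 'rV[int]_(size a), (x : V) = \sum_(i < size a) (nth 1%g a i : V) *~ n 0 i]%classic).
apply; split; last first.
  move=> y /= /(nthP 1%g)[i lt_i <-]; exists (delta_mx 0 (Ordinal lt_i)).
  rewrite (bigD1 (Ordinal lt_i)) //= big1 ?addr0 => [|j nj]; rewrite mxE eqxx /=.
    by rewrite eqxx mulr1z.
  by rewrite (negPf nj) mulr0z.
split=> [|y z [u yu] [v zv]|y [u yu]] /=.
- by exists 0; rewrite big1 // => i _; rewrite mxE mulr0z.
- exists (u + v); rewrite -[LHS]/((y : V) + (z : V)) yu zv -big_split.
  by apply: eq_bigr => i _; rewrite mxE mulrzDr.
- exists (- u); rewrite -[LHS]/(- (y : V)) yu -sumrN.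
  by apply: eq_bigr => i _; rewrite mxE mulrNz.
Qed.

End AbelianSplitting.

Section LatticeTimesFinite.
Local Open Scope ring_scope.

(** G is the product of the central subgroup c(Z^r) and the kernel of f, which is
contained in the finite list l. *)
Definition lattice_times_finite (G : groupType) : Prop :=
  exists r (f : G -> 'rV[int]_r) (c : 'rV[int]_r -> G) (l : seq G),
  [/\ forall x y, f (x * y)%g = f x + f y, forall u v, c (u + v) = (c u * c v)%g,
      cancel c f, forall u x, (c u * x = x * c u)%g & forall x, f x = 0 -> x \in l].

Lemma fg_abelian_times_finite_split (G : groupType) :
  fg_abelian_times_finite G -> lattice_times_finite G.
Proof.
move=> [A [F [abA fgA [phi [psi phiK psiK]]]]].
have [r [f [c [l [fM cM cK ker]]]]] := fg_abelian_split abA fgA.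
have phiM : {morph phi : x y / (x * y)%g} by exact: gmulfM.
have psiM : {morph psi : x y / (x * y)%g}.
  by move=> x y; rewrite -{1}(psiK x) -{1}(psiK y) -phiM phiK.
exists r, (fun x => f (phi x).1), (fun u => psi (c u, 1%g)),
  [seq psi (a, y) | a <- l, y <- enum F]; split.
- by move=> x y; rewrite phiM fM.
- by move=> u v; rewrite cM -psiM; congr psi; congr (_, _); rewrite mulg1.
- by move=> u; rewrite psiK /= cK.
- move=> u x; rewrite -(phiK x) -!psiM; congr psi; case: (phi x) => a y.
  by congr (_, _); rewrite ?mul1g ?mulg1 //; apply: abA.
move=> x /ker xl; apply/allpairsP; exists ((phi x).1, (phi x).2); split=> //=.
  by rewrite mem_enum.
by rewrite -surjective_pairing phiK.
Qed.

Lemma scale_mx_inj m n (a : int) (A B : 'M[int]_(m, n)) :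
  a != 0 -> a *: A = a *: B -> A = B.
Proof.
move=> a0 /matrixP AB; apply/matrixP => i j; apply: (mulfI a0).
by have := AB i j; rewrite !mxE.
Qed.

Section Obstruction.
Variables P Q : finite_presentation.
Local Notation L := (group_of Q).
Local Notation s := (ngens P).
Variables (r : nat) (f : L -> 'rV[int]_r) (c : 'rV[int]_r -> L) (l : seq L).
Hypotheses (fM : forall x y, f (x * y)%g = f x + f y).
Hypotheses (cM : forall u v, c (u + v) = (c u * c v)%g) (cK : cancel c f).
Hypotheses (cC : forall u x, (c u * x = x * c u)%g).
Hypothesis ker : forall x, f x = 0 -> x \in l.

Let rho x : L := (x * (c (f x))^-1)%g.

Let f1 : f 1%g = 0. Proof. exact: additive1 fM. Qed.
Let fV x : f x^-1%g = - f x. Proof. exact: (additiveV fM). Qed.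
Let c0 : c 0 = 1%g.
Proof. by apply: (mulgI (c 0)); rewrite -cM addr0 mulg1. Qed.
Let f_rho x : f (rho x) = 0. Proof. by rewrite /rho fM fV cK subrr. Qed.
Let rhoE x : x = (rho x * c (f x))%g. Proof. by rewrite /rho mulgVK. Qed.
Let rhoM x y : rho (x * y)%g = (rho x * rho y)%g.
Proof.
have cVC u z : ((c u)^-1 * z = z * (c u)^-1)%g.
  by apply: (mulgI (c u)); rewrite mulKVg ?mulVKg // !mulgA cC mulgK.
by rewrite /rho fM cM invgM -!mulgA (cVC (f x) (y * (c (f y))^-1)%g) !mulgA.
Qed.
Let rho_id x : f x = 0 -> rho x = x. Proof. by move=> fx; rewrite /rho fx c0 invg1 mulg1. Qed.
Let rho_c u : rho (c u) = 1%g. Proof. by rewrite /rho cK mulgV. Qed.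
Let rho_ev g w : rho (ev g w) = ev (rho \o g) w.
Proof. by apply: ev_morph; exact: rhoM. Qed.

Let R m x y := (exists u, f x - f y = m%:Z *: u) /\ rho x = rho y.

Let congruence_R m : congruence (R m).
Proof.
rewrite /R; split.
- by move=> x; split=> //; exists 0; rewrite subrr scaler0.
- by move=> x y [[u uE] ->]; split=> //; exists (- u); rewrite scalerN -uE opprB.
- move=> x y z [[u uE] ->] [[v vE] ->]; split=> //; exists (u + v).
  by rewrite scalerDr -uE -vE addrA subrK.
move=> x y x' y' [[u uE] xy] [[v vE] xy']; split; last by rewrite !rhoM xy xy'.
by exists (u + v); rewrite scalerDr -uE -vE !fM opprD addrACA.
Qed.

Let covering_R m : (0 < m)%N ->
  covering (R m) [seq (t * c (\row_i (k i : nat)%:Z))%g | t : L <- l, k : {ffun 'I_r -> 'I_m} <- enum {: {ffun 'I_r -> 'I_m}}].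
Proof.
move=> m_gt0 x; have m0 : m%:Z != 0 by rewrite eqz_nat -lt0n.
have lt_m i : (absz (f x 0%R i %% m%:Z)%Z < m)%N.
  by rewrite -ltz_nat gez0_abs ?modz_ge0 // ltz_pmod.
pose k := [ffun i => Ordinal (lt_m i)].
exists (rho x * c (\row_i (k i : nat)%:Z))%g.
  apply/allpairsP; exists (rho x, k); split=> //=; last by rewrite mem_enum.
  exact: ker.
split; last by rewrite rhoM rho_c mulg1 (rho_id (f_rho x)).
exists (\row_i (f x 0%R i %/ m%:Z)%Z); rewrite fM f_rho add0r cK.
apply/rowP => i; rewrite !mxE ffunE /= gez0_abs ?modz_ge0 //.
by apply/eqP; rewrite subr_eq mulrC -divz_eq.
Qed.

(** The components rho (g i) in the finite factor are kept, and those in the lattice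
are replaced by a homomorphism that factors through the matrix Y, that is,
through the torsion free quotient of the abelianization of the group of P. The
words that are trivial in the finite factor form, in Z^k, a subgroup that contains e
Z^k, and r vectors whose images under X V are the standard basis modulo m1; this is
the situation of [unimodular_combination]. *)
Lemma lattice_epimorphism : exists2 m, (0 < m)%N &
  forall g, hom_modulo P (R m) g -> group_epimorphism (group_of P) L.
Proof.
pose rels := presented_relators P.
pose E : 'M[int]_(size rels, s) := \matrix_(i, j) word_coef s (nth [::] rels i) 0 j.
have EE (i : 'I_(size rels)) : row i E = word_coef s (nth [::] rels i).
  by apply/rowP => j; rewrite !mxE.
have [k [X [Y [W [D [D_gt0 EY XY DE]]]]]] := int_kernel_split E.
pose e := ((size l)`!)%N; pose m1 := (e * 2)%N.
have e_gt0 : (0 < e)%N by rewrite fact_gt0.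
exists (D * m1)%N; first by rewrite !muln_gt0 D_gt0 e_gt0.
move=> g [gP gT]; apply/pres_epimorphism.
pose V := \matrix_(i < s) f (g i).
have fV_ev w : over s w -> f (ev g w) = word_coef s w *m V by apply: additive_ev.
have [K VK] : exists K, V - Y *m (X *m V) = m1%:Z *: K.
  have /choice[u uE] : forall i : 'I_(size rels), exists u, word_coef s (nth [::] rels i) *m V = (D * m1)%N%:Z *: u.
    move=> i; have Pr : nth [::] rels i \in rels by apply: mem_nth.
    have [[u uE] _] := gP _ Pr; exists u.
    by rewrite -uE f1 subr0 fV_ev ?over_relator.
  exists (W *m \matrix_i u i).
  have D0 : D%:Z != 0 by rewrite eqz_nat -lt0n.
  apply: (scale_mx_inj D0); rewrite scalerA -PoszM -[V in V - _]mul1mx mulmxA -mulmxBl.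
  rewrite (scalemxAl D%:Z (1%:M - Y *m X)) DE -mulmxA scalemxAr; congr (_ *m _).
  by apply/row_matrixP => i; rewrite row_mul EE uE rowE -scalemxAr -rowE rowK.
have /choice[wb wbE] : forall j : 'I_r, exists w, over s w /\ R (D * m1)%N (ev g w) (c (delta_mx 0 j)).
  by move=> j; have [w nw Rw] := gT (c (delta_mx 0 j)); exists w.
pose G' := \matrix_(j < r) (word_coef s (wb j) *m Y).
have [B [A1 [A2 BE]]] : exists (B : 'M[int]_(k, r)) A1 A2, A1 *m G' *m B + e%:Z *: (A2 *m B) = 1%:M.
  apply: (@unimodular_combination r k m1 e G' (X *m V)).
  - by rewrite /m1 (@leq_mul 1 2).
  - exact: dvdn_mulr.
  move=> i j; have [nw [[u uE] _]] := wbE i.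
  have E1 : G' *m (X *m V) = \matrix_i (word_coef s (wb i) *m V) - m1%:Z *: \matrix_i (word_coef s (wb i) *m K).
    apply/row_matrixP => t; rewrite row_mul rowK linearB /= linearZ /= !rowK -mulmxA.
    by rewrite scalemxAr -VK mulmxBr opprB addrC subrK.
  have E2 : word_coef s (wb i) *m V = delta_mx 0 i + (D * m1)%N%:Z *: u.
    by rewrite -fV_ev // -uE cK addrC subrK.
  rewrite E1 mxE [X in X + _ - _]mxE E2 !mxE eqxx /= eq_sym.
  set a := \sum_(_ < _) _; rewrite addrAC (addrC (i == j)%:R) addrK.
  apply: rpredB; last exact: dvdz_mulr.
  by rewrite PoszM -mulrA mulrCA; apply: dvdz_mulr.
have rho_exp x : (rho x ^+ e)%g = 1%g.
  apply: (@finite_exponent _ (fun x => f x = 0) l ker) => // {}x n fx.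
  by elim: n => [//|n IHn]; rewrite expgS fM fx IHn addr0.
pose fB i := if insub i is Some j then row (j : 'I_s) (Y *m B) else 0.
pose g' i := (rho (g i) * c (fB i))%g.
have f_ev' w : over s w -> f (ev g' w) = word_coef s w *m Y *m B.
  move=> nw; rewrite (@additive_ev s _ _ f fM) // -mulmxA; congr (_ *m _).
  by apply/row_matrixP => i; rewrite rowK /g' fM f_rho cK add0r /fB valK.
have rho_ev' w : rho (ev g' w) = rho (ev g w).
  rewrite !rho_ev; congr ev; apply: funext => i /=.
  by rewrite /g' rhoM rho_c mulg1 (rho_id (f_rho _)).
exists g'.
  move=> w Pw; rewrite (rhoE (ev g' w)) rho_ev' f_ev' ?over_relator //.
  have -> : word_coef s w *m Y = 0.
    have [i lt_i <-] := nthP [::] Pw; rewrite -(EE (Ordinal lt_i)) -row_mul EY.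
    by apply/rowP => j; rewrite !mxE.
  have [_ ->] := gP _ Pw; rewrite mul0mx c0 mulg1.
  exact: (rho_id f1).
pose S (v : 'rV[int]_k) := exists w, [/\ over s w, rho (ev g w) = 1%g & word_coef s w *m Y = v].
have S0 : S 0 by exists [::]; split; rewrite ?mul0mx // (rho_id f1).
have SD u v : S u -> S v -> S (u + v).
  move=> [w [nw w1 <-]] [w' [nw' w1' <-]]; exists (w ++ w').
  by rewrite over_cat nw ev_cat rhoM w1 w1' mulg1 word_coef_cat mulmxDl.
have SN u : S u -> S (- u).
  move=> [w [nw w1 <-]]; exists (inverse_word w).
  rewrite over_inverse; split=> //.
    by rewrite ev_inverse (morph_inv rhoM) w1 invg1.
  by rewrite word_coef_inverse mulNmx.
have Sv (v : 'rV[int]_r) : exists2 w, over s w & rho (ev g w) = 1%g /\ word_coef s w *m Y *m B = v.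
  suff [w [nw w1 wE]] : S (v *m A1 *m G' + e%:Z *: (v *m A2)).
    exists w => //; split=> //; rewrite wE mulmxDl -scalemxAl -!mulmxA scalemxAr -mulmxDr.
    by rewrite (mulmxA A1) BE mulmx1.
  apply: (SD).
    apply: (lattice_combination S0 SD SN) => i; rewrite rowK.
    have [nw [_ wE]] := wbE i; exists (wb i); split=> //.
    by rewrite wE rho_c.
  rewrite -(mulmx1 (v *m A2)) -XY mulmxA scalemxAr; apply: (lattice_combination S0 SD SN) => i.
  exists (nseq e (i : nat).*2); split.
  - by rewrite /over all_nseq ltn_double ltn_ord orbT.
  - rewrite ev_nseq; have -> : rho (g i ^+ e)%g = (rho (g i) ^+ e)%g; last exact: rho_exp.
    by elim: (e) => [|t IHt]; rewrite ?(rho_id f1) // !expgS rhoM IHt.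
  - by rewrite word_coef_nseq rowE -scalemxAl -scalemxAr.
move=> x; have [w nw [_ wx]] := gT x.
have [w' nw' [w1' fw']] := Sv (f x - f (ev g' w)).
exists (w ++ w'); first by rewrite over_cat nw.
rewrite (rhoE x) (rhoE (ev _ _)) ev_cat rhoM fM !rho_ev' w1' mulg1 wx.
by rewrite [f (ev g' w')]f_ev' // fw' addrC subrK.
Qed.

Lemma obstruction_split : ~ group_epimorphism (group_of P) L ->
  obstruction (presentation_code P) (presentation_code Q).
Proof.
move=> nepi; have [m m_gt0 epi] := lattice_epimorphism.
have [d [rep [d_gt0 rep0 rep_ex rep_inj]]] :=
  congruence_numbering (congruence_R m) (covering_R m_gt0).
apply: (obstruction_complete (congruence_R m) rep0 d_gt0 rep_ex rep_inj).
by move=> g /epi.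
Qed.

End Obstruction.

Lemma obstruction_lattice P Q : fg_abelian_times_finite (group_of Q) ->
  ~ group_epimorphism (group_of P) (group_of Q) ->
  obstruction (presentation_code P) (presentation_code Q).
Proof.
move=> /fg_abelian_times_finite_split[r [f [c [l [fM cM cK cC ker]]]]].
exact: obstruction_split fM cM cK cC ker.
Qed.

End LatticeTimesFinite.

Import GRing.Theory Num.Theory Order.TTheory.

(** * Virtually cyclic groups *)

Section IntegerPower.
Variable G : groupType.
Implicit Types (x y : G) (k : int).

Definition zpow x k : G :=
  match k with Posz n => (x ^+ n)%g | Negz n => (x ^- n.+1)%g end.

Lemma zpowS x k : zpow x (k + 1)%R = (zpow x k * x)%g.
Proof.
case: k => [n|[|n]] /=; first by rewrite addn1 expgSr.
  by rewrite mulVg.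
by rewrite subn1 /= [in RHS]expgS invgM mulgVK.
Qed.

Lemma zpowD x k1 k2 : zpow x (k1 + k2)%R = (zpow x k1 * zpow x k2)%g.
Proof.
elim/int_rect: k2 => [|n IHn|n IHn]; first by rewrite addr0 mulg1.
  by rewrite -[n.+1]addn1 PoszD addrA !zpowS IHn mulgA.
apply: (mulIg x); rewrite -mulgA -!zpowS.
have E : (- n.+1%:Z + 1 = - n%:Z)%R by rewrite intS; ring.
by rewrite -addrA !E.
Qed.

Lemma zpow1 x : zpow x 1 = x. Proof. by []. Qed.

Lemma zpowN x k : zpow x (- k)%R = (zpow x k)^-1%g.
Proof. by apply: (mulIg (zpow x k)); rewrite -zpowD addNr mulVg. Qed.

Lemma zpowM x k1 k2 : zpow x (k1 * k2)%R = zpow (zpow x k1) k2.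
Proof.
elim/int_rect: k2 => [|n IHn|n IHn]; first by rewrite mulr0.
  by rewrite -[n.+1]addn1 PoszD mulrDr mulr1 !zpowD IHn.
apply: (mulIg (zpow x k1)); rewrite -zpowS -zpowD.
have E : (- n.+1%:Z + 1 = - n%:Z)%R by rewrite intS; ring.
have E2 : (k1 * - n.+1%:Z + k1 = k1 * - n%:Z)%R by rewrite intS; ring.
by rewrite E E2.
Qed.

Lemma zpow_cond (S : G -> Prop) x k : S 1%g -> (forall y z, S y -> S z -> S (y * z)%g) ->
  (forall y, S y -> S y^-1%g) -> S x -> S (zpow x k).
Proof.
move=> S1 SM SV Sx; have SX n : S (x ^+ n)%g.
  by elim: n => // n IHn; rewrite expgS; apply: SM.
by case: k => n /=; [|apply: SV]; apply: SX.
Qed.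

Lemma zpow_conj x y k : (zpow x k ^ y)%g = zpow (x ^ y)%g k.
Proof. by case: k => n /=; rewrite -?conjVg -conjXg // conjVg. Qed.

Lemma zpow_commute x k1 k2 : (zpow x k1 * zpow x k2)%g = (zpow x k2 * zpow x k1)%g.
Proof. by rewrite -!zpowD addrC. Qed.

End IntegerPower.

Lemma zpow_morph (G H : groupType) (f : G -> H) x k : {morph f : x y / (x * y)%g} ->
  f (zpow x k) = zpow (f x) k.
Proof.
move=> fM; have fX n : f (x ^+ n)%g = (f x ^+ n)%g.
  by elim: n => [|n IHn]; rewrite ?morph_one // !expgS fM IHn.
by case: k => n /=; rewrite ?morph_inv ?fX.
Qed.

Section VirtuallyCyclic.
Variable L : groupType.

Lemma virtually_cyclic_covering : virtually_cyclic L ->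
  exists (g : L) (l : seq L), forall x, exists2 y, y \in l & exists k, x = (y * zpow g k)%g.
Proof.
move=> [C [g ->]] fin; exists g.
have gen y : generated [set g]%classic y -> exists k, y = zpow g k.
  move=> /(_ [set y | exists k, y = zpow g k]%classic); apply; split; last first.
    by move=> z ->; exists 1%R.
  split=> [|y1 y2 [k1 ->] [k2 ->]|y1 [k1 ->]]; first by exists 0%R.
    by exists (k1 + k2)%R; rewrite zpowD.
  by exists (- k1)%R; rewrite zpowN.
have gen1 : generated [set g]%classic 1%g by move=> H [[]].
have /finite_seqP[cs csE] := fin.
pose coset (x : L) := [set (x * h)%g | h in generated [set g]]%classic.
have /choice[rp rpE] : forall c : set L, exists x : L,
    (exists z, c = coset z) -> c = coset x.
  move=> c; have [[z zc]|nz] := pselect (exists z, c = coset z); first by exists z.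
  by exists 1%g.
exists (map rp cs) => x; set c := coset x.
have cc : c \in cs.
  suff : [set` cs]%classic c by [].
  by rewrite -csE; exists x.
exists (rp c); first exact: map_f.
have : c x by exists 1%g; rewrite ?mulg1.
rewrite {1}(rpE c); last by exists x.
by move=> [h /gen[k ->] <-]; exists k.
Qed.

Section InfiniteOrder.
Variables (g : L) (l : seq L).
Hypothesis gl : forall x, exists2 y, y \in l & exists k, x = (y * zpow g k)%g.
Hypothesis g_inf : forall k, zpow g k = 1%g -> k = 0%R.

(** The powers of g all of whose conjugates are powers of g form a normal subgroup, and
conjugation acts on it by an automorphism of an infinite cyclic group. *)
Lemma normal_cyclic_core : exists (c : L) (l' : seq L), [/\
  forall k, zpow c k = 1%g -> k = 0%R,
  forall x, (c ^ x = c \/ c ^ x = c^-1)%g &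
  forall x, exists2 y, y \in l' & exists k, x = (y * zpow c k)%g].
Proof.
pose S a := forall x, exists k, (zpow g a ^ x)%g = zpow g k.
have SD a b : S a -> S b -> S (a + b)%R.
  move=> Sa Sb x; have [k ka] := Sa x; have [k' kb] := Sb x.
  by exists (k + k')%R; rewrite !zpowD conjMg ka kb.
have SN a : S a -> S (- a)%R.
  by move=> Sa x; have [k ka] := Sa x; exists (- k)%R; rewrite !zpowN conjVg ka.
have SZ a b : S a -> S (a * b)%R.
  by move=> Sa x; have [k ka] := Sa x; exists (k * b)%R; rewrite !zpowM zpow_conj ka.
pose T n := (0 < n) && `[< S (Posz n) >].
have exT : exists n, T n.
  exists (size l)`!; rewrite /T fact_gt0; apply/asboolP => x.
  have /choice[y yE] : forall i : nat, exists y, y \in l /\ exists k, (zpow g i * x)%g = (y * zpow g k)%g.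
    by move=> i; have [y yl yk] := gl (zpow g i * x)%g; exists y.
  have [i [j [lt_ij le_j yij]]] := pigeonhole (fun i => (yE i).1).
  have [_ [k ik]] := yE i; have [_ [k' jk]] := yE j; rewrite -yij in jk.
  have gij : (zpow g (j%:Z - i%:Z)%R ^ x)%g = zpow g (k' - k)%R.
    rewrite [(Posz j - Posz i)%R]addrC [(k' - k)%R]addrC !zpowD !zpowN conjgE.
    by rewrite -!mulgA jk mulgA -invgM ik invgM -mulgA mulKg.
  have /dvdnP[q ->] : j - i %| (size l)`!.
    by rewrite dvdn_fact // subn_gt0 lt_ij (leq_trans (leq_subr _ _)).
  exists ((k' - k) * q%:Z)%R; rewrite mulnC PoszM zpowM zpow_conj zpowM.
  by rewrite -subzn ?(ltnW lt_ij) // gij.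
case: (ex_minnP exT) => n /andP[n_gt0 /asboolP Sn] minn.
have n0 : Posz n != 0%R by rewrite eqz_nat -lt0n.
have nS a : S a -> (n%:Z %| a)%Z.
  move=> Sa; have aE := divz_eq a (Posz n); apply/dvdz_mod0P.
  have Sr : S (a %% n%:Z)%Z.
    have -> : (a %% n%:Z)%Z = (a + - (n%:Z * (a %/ n%:Z)%Z))%R by rewrite {2}aE mulrC addrC addKr.
    by apply: (SD) => //; apply: SN; apply: SZ.
  have r0 : (0 <= (a %% n%:Z)%Z)%R by apply: modz_ge0.
  have := ltz_pmod a (d := Posz n) n_gt0.
  case: (a %% n%:Z)%Z Sr r0 => // r Sr _; rewrite ltz_nat => lt_r.
  case: r Sr lt_r => // r Sr lt_r; suff /minn : T r.+1 by rewrite leqNgt lt_r.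
  by apply/andP; split=> //; apply/asboolP.
pose c := zpow g (Posz n); exists c.
exists [seq (y * zpow g (Posz i))%g | y <- l, i <- iota 0 n]; split.
- move=> k; rewrite -zpowM => /g_inf/eqP; rewrite mulf_eq0 (negPf n0) /=.
  by move/eqP.
- have cx x : exists k, (c ^ x)%g = zpow c k.
    have [a ca] := Sn x; have /nS/dvdzP[q aq] : S a.
      move=> y; have [b cb] := Sn (x * y)%g; exists b.
      by rewrite -ca -conjgM.
    by exists q; rewrite ca aq mulrC zpowM.
  move=> x; have [k ck] := cx x; have [k' ck'] := cx x^-1%g.
  have kk : (k * k' = 1)%R.
    apply/eqP; rewrite -subr_eq0; apply/eqP.
    have: zpow c (k * k' - 1)%R = 1%g.
      rewrite zpowD zpowN zpow1 mulrC zpowM -ck' -zpow_conj -ck.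
      by rewrite -conjgM mulgV conjg1 mulgV.
    rewrite -zpowM => /g_inf/eqP; rewrite mulf_eq0 (negPf n0) /=.
    by move/eqP.
  have : (k %| 1%R)%Z by rewrite -kk dvdz_mulr.
  rewrite dvdz1 ck; case: k {ck kk} => [[|[|?]]|[|?]] //= _; first by left.
  by right.
move=> x; have [y yl [k xk]] := gl x.
exists (y * zpow g (k %% n%:Z)%Z)%g.
  apply/allpairsP; exists (y, absz (k %% n%:Z)%Z); split=> //=.
    by rewrite mem_iota add0n -ltz_nat gez0_abs ?modz_ge0 // ltz_pmod.
  by rewrite -{1}(gez0_abs (modz_ge0 k n0)).
exists (k %/ n%:Z)%Z; rewrite xk {1}(divz_eq k (Posz n)) addrC zpowD mulgA.
by rewrite /c -zpowM mulrC.
Qed.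

End InfiniteOrder.

Section Transfer.
Variables (c : L) (l : seq L).
Hypothesis c_inf : forall k, zpow c k = 1%g -> k = 0%R.
Hypothesis c_normal : forall x, (c ^ x = c \/ c ^ x = c^-1)%g.
Hypothesis cl : forall x, exists2 y, y \in l & exists k, x = (y * zpow c k)%g.

Let inj k k' : zpow c k = zpow c k' -> k = k'.
Proof.
move=> kk; apply/eqP; rewrite -subr_eq0; apply/eqP/c_inf.
by rewrite zpowD zpowN kk mulgV.
Qed.

Let eps (x : L) : bool := `[< (c ^ x <> c)%g >].

Let conjE x k : (zpow c k ^ x)%g = zpow c (sg (eps x) k).
Proof.
rewrite zpow_conj /eps /sg; case: asboolP => [nc|/contrapT -> //].
case: (c_normal x) => // ->; rewrite -[(- k)%R]mulN1r zpowM.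
by congr zpow.
Qed.

Let epsM x y : eps (x * y)%g = eps x (+) eps y.
Proof.
have := conjE (x * y)%g 1; rewrite conjgM !conjE => /inj.
by case: (eps (x * y)%g); case: (eps x); case: (eps y) => // /eqP.
Qed.

Let eps_c k : eps (zpow c k) = false.
Proof.
have := conjE (zpow c k) 1; rewrite conjgE zpow_commute mulKg => /inj.
by case: (eps _) => // /eqP.
Qed.

Let eps1 : eps 1%g = false. Proof. exact: (eps_c 0). Qed.

Let epsV x : eps x^-1%g = eps x.
Proof. by have := epsM x x^-1%g; rewrite mulgV eps1; case: (eps x); case: (eps _). Qed.

Let left_form x k : (x * zpow c k)%g = (zpow c (sg (eps x) k) * x)%g.
Proof. by rewrite -epsV -conjE conjgE invgK mulgA mulgVK. Qed.

Let R x y := exists k, x = (y * zpow c k)%g.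

Let cR : congruence R.
Proof.
split.
- by move=> x; exists 0%R; rewrite mulg1.
- by move=> x y [k ->]; exists (- k)%R; rewrite zpowN mulgK.
- by move=> x y z [k ->] [k' ->]; exists (k' + k)%R; rewrite zpowD mulgA.
move=> x y x' y' [k ->] [k' ->]; exists (sg (eps y') k + k')%R.
rewrite zpowD -conjE conjgE -!mulgA; congr (_ * _)%g.
by rewrite !mulgA mulgV mul1g.
Qed.

(** The transfer to the subgroup of the powers of c, with the powers written on the
left of the representatives. Moving a power of c to the left past an element that
inverts c changes its sign, so that the sum V of the exponents is a cocycle for
the signs eps instead of a homomorphism. The restriction of V to the powers of c is
multiplication by the index d. *)
Lemma signed_transfer : exists (pi : L -> zpm) (d : nat), [/\ 0 < d,
  {morph pi : x y / (x * y)%g}, forall k, pi (zpow c k) = ((d%:Z * k)%R, false) &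
  forall x k, (zpow c k ^ x)%g = zpow c (sg (pi x).2 k)].
Proof.
have [d [rep [d_gt0 _ rep_ex rep_inj]]] := congruence_numbering cR cl.
have uniq_form h h' i j : i < d -> j < d ->
    (zpow c h * rep i)%g = (zpow c h' * rep j)%g -> h = h' /\ i = j.
  move=> lt_i lt_j E; have ij : i = j.
    apply: rep_inj => //; exists (sg (eps (rep j)) (h' - h)%R).
    rewrite left_form; have -> : sg (eps (rep j)) (sg (eps (rep j)) (h' - h)%R) = (h' - h)%R.
      by case: (eps _); rewrite /= ?opprK.
    by rewrite addrC zpowD zpowN -mulgA -E mulKg.
  by move: E; rewrite ij => /mulIg/inj.
have /choice[H HE] : forall xi : L * 'I_d, exists hj : int * 'I_d,
    (xi.1 * rep xi.2)%g = (zpow c hj.1 * rep hj.2)%g.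
  move=> [x i] /=; have [j lt_j [k xk]] := rep_ex (x * rep i)%g.
  exists (sg (eps (rep j)) k, Ordinal lt_j) => /=.
  by rewrite -left_form.
pose V x := (\sum_(i < d) (H (x, i)).1)%R.
have HM x y i : (H ((x * y)%g, i)).1 = (sg (eps x) (H (y, i)).1 + (H (x, (H (y, i)).2)).1)%R.
  have [] := @uniq_form (H ((x * y)%g, i)).1 (sg (eps x) (H (y, i)).1 + (H (x, (H (y, i)).2)).1)%R
    (H ((x * y)%g, i)).2 (H (x, (H (y, i)).2)).2 (ltn_ord _) (ltn_ord _) => //.
  rewrite -(HE ((x * y)%g, i)) /= -mulgA (HE (y, i)) /= mulgA left_form -mulgA.
  by rewrite (HE (x, (H (y, i)).2)) /= mulgA -zpowD.
have Jinj x : injective (fun i => (H (x, i)).2).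
  move=> i i' E; apply: val_inj; apply: rep_inj; rewrite ?ltn_ord //.
  have := HE (x, i); have := HE (x, i'); rewrite /= E => E1 E2.
  set y := rep (H (x, i')).2 in E1 E2; exists (sg (eps y) ((H (x, i)).1 - (H (x, i')).1)%R).
  apply: (mulgI x); rewrite mulgA E1 E2 -conjE conjgE -!mulgA mulVKg.
  by rewrite mulgA -zpowD addrC subrK.
have VM x y : V (x * y)%g = (V x + sg (eps x) (V y))%R.
  rewrite /V [X in (X + _)%R](reindex_inj (Jinj y)) /=.
  have -> : sg (eps x) (\sum_i (H (y, i)).1)%R = (\sum_i sg (eps x) (H (y, i)).1)%R.
    by rewrite /sg; case: (eps x); rewrite ?sumrN.
  by rewrite -big_split; apply: eq_bigr => i _; rewrite HM addrC.
exists (fun x => (V x, eps x)), d; split=> //.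
- by move=> x y; rewrite VM epsM.
move=> k; rewrite eps_c; congr (_, _).
transitivity (\sum_(i < d) k)%R; last by rewrite sumr_const card_ord mulrC -mulr_natr natz.
apply: eq_bigr => i _; have [] // := @uniq_form (H (zpow c k, i)).1 k (H (zpow c k, i)).2 i.
by rewrite -(HE (zpow c k, i)).
Qed.

End Transfer.

Definition infinite_structure (pi : L -> zpm) (c : L) (kappa : nat) (l : seq L) : Prop :=
  [/\ {morph pi : x y / (x * y)%g} /\ (exists x, pi x = (1%R, false)),
      0 < kappa /\ forall k, pi (zpow c k) = ((kappa%:Z * k)%R, false),
      forall x k, (zpow c k ^ x)%g = zpow c (sg (pi x).2 k) &
      forall x, exists2 y, y \in l & exists k, x = (y * zpow c k)%g].

(** After subtraction of a coboundary, all values are multiples of the least positive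
translation n in the image, so that one can divide by n. *)
Lemma normalize_translation (pi : L -> zpm) (c : L) (d : nat) (l : seq L) :
  {morph pi : x y / (x * y)%g} -> 0 < d ->
  (forall k, pi (zpow c k) = ((d%:Z * k)%R, false)) ->
  (forall x k, (zpow c k ^ x)%g = zpow c (sg (pi x).2 k)) ->
  (forall x, exists2 y, y \in l & exists k, x = (y * zpow c k)%g) ->
  exists pi' kappa, infinite_structure pi' c kappa l.
Proof.
move=> piM d_gt0 pic cpi cl.
have pi2M x y : (pi (x * y)%g).2 = (pi x).2 (+) (pi y).2 by rewrite piM.
have pi1M x y : (pi (x * y)%g).1 = ((pi x).1 + sg (pi x).2 (pi y).1)%R by rewrite piM.
pose T n := (0 < n) && `[< exists x, pi x = (Posz n, false) >].
have exT : exists n, T n.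
  exists d; rewrite /T d_gt0; apply/asboolP; exists c.
  by have := pic 1%R; rewrite mulr1.
case: (ex_minnP exT) => n /andP[n_gt0 /asboolP[x0 px0]] minn.
have n0 : Posz n != 0%R by rewrite eqz_nat -lt0n.
have dvd_plus x : (pi x).2 = false -> (n%:Z %| (pi x).1)%Z.
  move=> sx; apply/dvdz_mod0P; set a := (pi x).1.
  have pr : pi (x * zpow x0 (- (a %/ n%:Z)%Z)%R)%g = ((a %% n%:Z)%Z, false).
    have px0k k : pi (zpow x0 k) = ((n%:Z * k)%R, false).
      rewrite zpow_morph // px0; elim/int_rect: k => [|k IHk|k IHk]; first by rewrite mulr0.
        by rewrite intS addrC zpowS IHk -[RHS]/(_, _); congr (_, _) => /=; ring.
      apply: (mulIg ((Posz n, false) : zpm)).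
      have E : (- k.+1%:Z + 1 = - k%:Z)%R by rewrite intS; ring.
      rewrite -zpowS E IHk; congr (_, _) => /=; rewrite intS; ring.
    rewrite piM px0k (surjective_pairing (pi x)) sx -/a; congr (_, _) => /=.
    by rewrite {1}(divz_eq a (Posz n)) mulrN mulrC addrAC subrr add0r.
  have r0 : (0 <= (a %% n%:Z)%Z)%R by apply: modz_ge0.
  have := ltz_pmod a (d := Posz n) n_gt0.
  case: (a %% n%:Z)%Z r0 pr => // r _ pr; rewrite ltz_nat => lt_r.
  case: r pr lt_r => // r pr lt_r; suff /minn : T r.+1 by rewrite leqNgt lt_r.
  by apply/andP; split=> //; apply/asboolP; eexists; exact: pr.
have [vt vtP] : exists vt : int, forall x, (n%:Z %| ((pi x).1 - vt * (pi x).2%:R)%R)%Z.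
  have [[t st]|nt] := pselect (exists t, (pi t).2 = true).
    exists (pi t).1 => x; case sx: (pi x).2; last by rewrite mulr0 subr0 dvd_plus.
    rewrite mulr1; have := dvd_plus (x * t^-1)%g; rewrite pi2M pi1M sx.
    have -> : pi t^-1%g = pi t.
      by rewrite morph_inv // -[LHS]/(zpm_inv _) /zpm_inv st /= opprK -st -surjective_pairing.
    by rewrite st; apply.
  exists 0%R => x; rewrite mul0r subr0 dvd_plus //.
  by apply/negP => sx; apply: nt; exists x.
pose pi' x : zpm := (((pi x).1 - vt * (pi x).2%:R)%R %/ n%:Z, (pi x).2)%Z.
have pi'E x : (n%:Z * (pi' x).1 = (pi x).1 - vt * (pi x).2%:R)%R.
  by rewrite mulrC divzK.
have pi'P x a f : (n%:Z * a = (pi x).1 - vt * (pi x).2%:R)%R -> (pi x).2 = f -> pi' x = (a, f).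
  move=> aE <-; rewrite /pi'; congr (_, _); apply: (mulfI n0).
  by rewrite aE -[RHS]pi'E.
have [kappa kE] : exists kappa : nat, d = n * kappa.
  have := dvd_plus (zpow c 1%R); rewrite pic mulr1 => /(_ erefl); rewrite dvdzE /=.
  by case/dvdnP => kappa ->; exists kappa; rewrite mulnC.
exists pi', kappa; split=> //; last 1 first.
- split; first by case: kappa kE => // kE; rewrite kE muln0 in d_gt0.
  move=> k; apply: pi'P; rewrite pic //= mulr0 subr0 kE PoszM; ring.
split; last by exists x0; apply: pi'P; rewrite px0 // mulr0 subr0 mulr1.
move=> x y; apply: pi'P; last by rewrite pi2M.
rewrite pi1M pi2M /= mulrDr pi'E.
have -> : (n%:Z * sg (pi x).2 (pi' y).1 = sg (pi x).2 (n%:Z * (pi' y).1))%R.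
  by case: (pi x).2; rewrite /= ?mulrN.
by rewrite pi'E; case: (pi x).2; case: (pi y).2 => /=; ring.
Qed.

Lemma virtually_cyclic_structure : virtually_cyclic L ->
  (exists l : seq L, forall x, x \in l) \/
  (exists pi c kappa l, infinite_structure pi c kappa l).
Proof.
move=> /virtually_cyclic_covering[g [l gl]].
have [[n n_gt0 gn]|g_inf] := pselect (exists2 n, 0 < n & (g ^+ n)%g = 1%g).
  left; exists [seq (y * zpow g (Posz i))%g | y <- l, i <- iota 0 n] => x.
  have [y yl [k ->]] := gl x; have n0 : Posz n != 0%R by rewrite eqz_nat -lt0n.
  apply/allpairsP; exists (y, absz (k %% n%:Z)%Z); split=> //=.
    by rewrite mem_iota add0n -ltz_nat gez0_abs ?modz_ge0 // ltz_pmod.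
  rewrite {1}(divz_eq k (Posz n)) zpowD mulrC zpowM [zpow g (Posz n)]/= gn.
  have -> : zpow 1%g (k %/ n%:Z)%Z = 1%g :> L.
    by apply: (zpow_cond (S := fun z => z = 1%g)) => // [u v -> ->|u ->]; rewrite ?mulg1 ?invg1.
  by rewrite mul1g -{1}(gez0_abs (modz_ge0 k n0)).
right; have [|c [l' [c_inf c_normal cl]]] := normal_cyclic_core gl.
  case=> [[|n]|n] //= gn; case: g_inf; exists n.+1 => //.
  by apply: invg_inj; rewrite gn invg1.
have [pi [d [d_gt0 piM pic cpi]]] := signed_transfer c_inf c_normal cl.
have [pi' [kappa st]] := normalize_translation piM d_gt0 pic cpi cl.
by exists pi', c, kappa, l'.
Qed.

End VirtuallyCyclic.

(** * Virtually cyclic targets *)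

Section VirtuallyCyclicTargets.
Import GRing.Theory Num.Theory Order.TTheory.
Local Open Scope ring_scope.

Section CocycleMatrix.
Variable P : finite_presentation.
Local Notation s := (ngens P).
Local Notation rels := (presented_relators P).

Lemma eq_signed_ev eps eps' v w : (forall i, (i < s)%N -> eps i = eps' i) -> over s w ->
  zev eps v w = zev eps' v w /\ zsg eps w = zsg eps' w.
Proof.
move=> ee nw; have E u : ev (signed eps u) w = ev (signed eps' u) w.
  by apply: eq_ev nw => i lt_i; rewrite /signed ee.
by rewrite /zev /zsg !E.
Qed.

Variable eps : nat -> bool.

Definition flipped : option 'I_s := [pick i : 'I_s | eps i].

Definition colu (u : nat -> int) : 'cV[int]_s := \col_(i < s) u i.

(** Cocycles are normalized to vanish on one generator of negative sign, if there is
one; this is a complement to the coboundaries. The condition is one more row of the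
matrix whose kernel consists of the cocycles. *)
Definition norm_row : 'rV[int]_s :=
  if flipped is Some i0 then delta_mx 0 i0 else 0.

Definition cocycle_matrix : 'M[int]_(size rels + 1, s) :=
  col_mx (\matrix_(i, j) zev eps (delta j) (nth [::] rels i)) norm_row.

Definition norm_value (u : nat -> int) : int := if flipped is Some i0 then u i0 else 0.

Lemma zev_row u w : over s w ->
  zev eps u w = ((\row_(j < s) zev eps (delta j) w) *m colu u) 0 0.
Proof.
by move=> nw; rewrite (zev_coef eps u nw) mxE; apply: eq_bigr => j _; rewrite !mxE.
Qed.

Lemma cocycle_matrix_mul u : cocycle_matrix *m colu u =
  col_mx (\col_i zev eps u (nth [::] rels i)) (norm_value u)%:M.
Proof.
rewrite mul_col_mx; congr col_mx.
  apply/colP => i; rewrite mxE [RHS]mxE zev_row ?mxE; last first.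
    by apply/over_relator/mem_nth.
  by apply: eq_bigr => j _; rewrite !mxE.
rewrite /norm_row /norm_value; case: flipped => [i0|].
  by rewrite -rowE; apply/rowP => j; rewrite !mxE ord1 eqxx.
by rewrite mul0mx; apply/rowP => j; rewrite !mxE mul0rn.
Qed.

Definition normalize (u : nat -> int) i : int := u i - norm_value u * flips eps i.

Lemma norm_normalize u : norm_value (normalize u) = 0.
Proof.
rewrite /normalize /norm_value /flipped; case: pickP => // i0 e0.
by rewrite /flips e0 mulr1 subrr.
Qed.

Lemma zev_normalize u w : zsg eps w = false -> zev eps (normalize u) w = zev eps u w.
Proof.
move=> sw; have := zev_lin eps 1 (- norm_value u) u (flips eps) w.
rewrite zev_flips sw mulr0 addr0 mul1r => <-.
by congr zev; apply: funext => i; rewrite /normalize mul1r mulNr.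
Qed.

Lemma cocycle_matrix_dvd (d : int) u :
  (forall r, r \in rels -> (d %| zev eps u r)%Z) -> norm_value u = 0 ->
  exists K, cocycle_matrix *m colu u = d *: K.
Proof.
move=> du nu; have /choice[q qE] : forall i : 'I_(size rels), exists q, zev eps u (nth [::] rels i) = q * d.
  by move=> i; apply/dvdzP/du/mem_nth.
exists (col_mx (\col_i q i) 0); rewrite cocycle_matrix_mul scale_col_mx scaler0 nu.
congr col_mx; first by apply/colP => i; rewrite !mxE qE mulrC.
by apply/matrixP => i j; rewrite !mxE mul0rn.
Qed.

Lemma cocycle_matrix0 u : cocycle_matrix *m colu u = 0 ->
  (forall r, r \in rels -> zev eps u r = 0) /\ norm_value u = 0.
Proof.
rewrite cocycle_matrix_mul -[0]col_mx0 => /eq_col_mx[/colP E1 /matrixP E2]; split.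
  by move=> r /(nthP [::])[i lt_i <-]; have := E1 (Ordinal lt_i); rewrite !mxE.
by have := E2 0 0; rewrite !mxE eqxx mulr1n.
Qed.

(** For a generator i of negative sign the word i i0^-1 has positive sign, and its value
is the value at i because the one at i0 is zero. *)
Lemma translation_word (b : 'rV[int]_s) : exists w,
  [/\ over s w, zsg eps w = false &
      forall u, norm_value u = 0 -> zev eps u w = (b *m colu u) 0 0].
Proof.
rewrite -(mulmx1 b).
pose N (b : 'rV[int]_s) := exists w, [/\ over s w, zsg eps w = false &
      forall u, norm_value u = 0 -> zev eps u w = (b *m colu u) 0 0].
have catE u w w' : zsg eps w = false -> zev eps u (w ++ w') = zev eps u w + zev eps u w' /\ zsg eps (w ++ w') = zsg eps w'.
  move=> sw; have := ev_signed eps u (w ++ w').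
  by rewrite ev_cat !ev_signed => -[<- <-] /=; rewrite sw.
have invE u w : zsg eps w = false -> zev eps u (inverse_word w) = - zev eps u w /\ zsg eps (inverse_word w) = false.
  move=> sw; have := ev_signed eps u (inverse_word w).
  by rewrite ev_inverse !ev_signed => -[<- <-] /=; rewrite sw.
apply: (lattice_combination (N := N)).
- exists [::]; split=> // u _; by rewrite mul0mx mxE.
- move=> u v [w [nw sw wE]] [w' [nw' sw' wE']]; exists (w ++ w').
  rewrite over_cat nw; split=> //; first by have [_ ->] := catE (fun=> 0) w w' sw.
  move=> z nz; have [-> _] := catE z w w' sw.
  by rewrite wE // wE' // mulmxDl [RHS]mxE.
- move=> u [w [nw sw wE]]; exists (inverse_word w).
  rewrite over_inverse; split=> //; first by have [_ ->] := invE (fun=> 0) w sw.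
  move=> z nz; have [-> _] := invE z w sw.
  by rewrite wE // mulNmx [RHS]mxE.
move=> i; rewrite row1; case ei: (eps i).
  have [i0 fi0] : exists i0, flipped = Some i0.
    by rewrite /flipped; case: pickP => [i0 _|/(_ i)]; [exists i0 | rewrite ei].
  have ei0 : eps i0.
    by move: fi0; rewrite /flipped; case: pickP => // i1 e1 [<-].
  exists [:: (i : nat).*2; (i0 : nat).*2.+1]; split.
  - by rewrite /= ltn_double ltn_ord ltn_Sdouble ltn_ord.
  - by rewrite !zsg_cons /= uphalf_double doubleK ei ei0.
  move=> u; rewrite /norm_value fi0 => u0.
  rewrite !zev_cons /= odd_double /= uphalf_double doubleK ei ei0 /= u0.
  by rewrite -rowE !mxE !(oppr0, subr0, addr0, opprK) odd_double /= subr0.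
exists [:: (i : nat).*2]; split.
- by rewrite /= ltn_double ltn_ord.
- by rewrite !zsg_cons /= doubleK ei.
move=> u _; rewrite zev_cons odd_double doubleK ei /=.
by rewrite -rowE !mxE addr0.
Qed.

End CocycleMatrix.

Section InfiniteTarget.
Variables P Q : finite_presentation.
Local Notation L := (group_of Q).
Local Notation s := (ngens P).
Local Notation rels := (presented_relators P).
Variables (pi : L -> zpm) (c : L) (kappa : nat) (l : seq L).
Hypothesis piM : {morph pi : x y / (x * y)%g}.
Hypothesis pi_onto : exists x, pi x = (1, false).
Hypothesis kappa_gt0 : (0 < kappa)%N.
Hypothesis pic : forall k, pi (zpow c k) = (kappa%:Z * k, false).
Hypothesis cpi : forall x k, (zpow c k ^ x)%g = zpow c (sg (pi x).2 k).
Hypothesis cl : forall x, exists2 y, y \in l & exists k, x = (y * zpow c k)%g.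

Let kappa0 : kappa%:Z != 0. Proof. by rewrite eqz_nat -lt0n. Qed.

Let R (M : nat) x y := exists k, x = (y * zpow c (M%:Z * k))%g.

Let cR M : congruence (R M).
Proof.
rewrite /R; split.
- by move=> x; exists 0; rewrite mulr0 mulg1.
- by move=> x y [k ->]; exists (- k); rewrite mulrN zpowN mulgK.
- by move=> x y z [k ->] [k' ->]; exists (k' + k); rewrite mulrDr zpowD mulgA.
move=> x y x' y' [k ->] [k' ->]; exists (sg (pi y').2 k + k').
have -> : M%:Z * (sg (pi y').2 k + k') = sg (pi y').2 (M%:Z * k) + M%:Z * k'.
  by rewrite mulrDr; congr (_ + _); case: (pi y').2; rewrite /= ?mulrN.
rewrite zpowD -cpi conjgE -!mulgA; congr (_ * _)%g.
by rewrite !mulgA mulgV mul1g.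
Qed.

Let R_pi M x y : R M x y -> zpm_eqmod (kappa * M) (pi x) (pi y).
Proof.
move=> [k ->]; rewrite piM pic; split; rewrite /= ?addbF //.
rewrite addrC addKr; case: (pi y).2 => /=; rewrite ?rpredN mulrA -PoszM; exact: dvdz_mulr.
Qed.

Let R_dvd M M1 x y : (M1 %| M)%N -> R M x y -> R M1 x y.
Proof.
move=> /dvdnP[q ->] [k ->]; exists (q%:Z * k); congr (_ * zpow _ _)%g.
by rewrite mulrA -PoszM mulnC.
Qed.

Let covering_R M : (0 < M)%N ->
  covering (R M) [seq (y * zpow c (Posz i))%g | y <- l, i <- iota 0 M].
Proof.
move=> M_gt0 x; have [y yl [k ->]] := cl x; have M0 : M%:Z != 0 by rewrite eqz_nat -lt0n.
exists (y * zpow c (k %% M%:Z)%Z)%g.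
  apply/allpairsP; exists (y, absz (k %% M%:Z)%Z); split=> //=.
    by rewrite mem_iota add0n -ltz_nat gez0_abs ?modz_ge0 // ltz_pmod.
  by rewrite -{1}(gez0_abs (modz_ge0 k M0)).
exists (k %/ M%:Z)%Z; rewrite -mulgA -zpowD; congr (_ * zpow _ _)%g.
by rewrite {1}(divz_eq k M%:Z) addrC mulrC.
Qed.

Let kernel_list : exists2 lT : seq L, size lT = size l & forall x, pi x = 1%g -> x \in lT.
Proof.
have /choice[k kE] : forall y, exists k, (exists k', pi (y * zpow c k')%g = 1%g) -> pi (y * zpow c k)%g = 1%g.
  move=> y; have [[k' yk']|nk] := pselect (exists k', pi (y * zpow c k')%g = 1%g).
    by exists k'.
  by exists 0.
exists [seq (y * zpow c (k y))%g | y <- l]; first by rewrite size_map.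
move=> x px; have [y yl [k' xk']] := cl x; apply/mapP; exists y => //.
rewrite xk' in px *; congr (_ * zpow _ _)%g.
have := kE y (ex_intro _ k' px); rewrite -px !piM => /mulgI; rewrite !pic => -[].
by move=> /(mulfI kappa0).
Qed.

Section Lift.
Variables (g : nat -> L) (M M1 : nat) (u : nat -> int).
Local Notation eps := (fun i => (pi (g i)).2).
Hypotheses (M1M : (M1 %| M)%N) (FM1 : ((size l)`! %| M1)%N).
Hypothesis gR : hom_modulo P (R M) g.
Hypothesis ug : forall i, (i < s)%N -> ((kappa * M1)%N%:Z %| u i - (pi (g i)).1)%Z.
Hypothesis u_rels : forall r, r \in rels -> zev eps u r = 0.
Hypothesis u_onto : exists w, [/\ over s w, zsg eps w = false & zev eps u w = 1].

(** The tuple g is corrected by powers of c so that the integer parts become u. As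
the powers of c that are involved are multiples of M1, the relators hold modulo
c^M1, and hence exactly, because pi is injective on the powers of c. The image S
maps onto the image of pi, so it contains some power c^i with 0 < i <= size l, by
the pigeonhole principle in the kernel of pi; then it contains c^M1, and therefore
everything. *)
Lemma lift_epimorphism : group_epimorphism (group_of P) L.
Proof.
have [gP gT] := gR.
have /choice[q qE] : forall i, exists q, (i < s)%N -> u i - (pi (g i)).1 = q * (kappa * M1)%N%:Z.
  move=> i; have [lt_i|_] := boolP (i < s)%N; last by exists 0.
  by have /dvdzP[q qE] := ug lt_i; exists q.
pose g' i := (g i * zpow c (M1%:Z * sg (eps i) (q i)))%g.
have gg' i : R M1 (g' i) (g i) by exists (sg (eps i) (q i)).
have pig' i : (i < s)%N -> pi (g' i) = signed eps u i.
  move=> /qE qi; rewrite /g' piM pic (surjective_pairing (pi (g i))) /signed.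
  rewrite -[LHS]/(_ + sg _ _, _ (+) _) /= addbF; congr (_, _).
  rewrite -[u i](subrK (pi (g i)).1) qi addrC; congr (_ + _).
  by rewrite /sg; case: (pi (g i)).2; rewrite PoszM; ring.
have piev w : over s w -> pi (ev g' w) = (zev eps u w, zsg eps w).
  by move=> nw; rewrite ev_morph // -ev_signed; apply: eq_ev nw => i; apply: pig'.
have g'P : satisfies P g'.
  move=> r Pr; have nr := over_relator Pr.
  have : R M1 (ev g' r) 1%g.
    apply: (cong_trans (cR M1)) (R_dvd M1M (gP r Pr)).
    by apply: (cong_ev (cR M1)) nr => i _; apply: gg'.
  move=> [k kE]; rewrite mul1g in kE.
  have := piev r nr; rewrite kE pic u_rels // => -[/eqP].
  by rewrite mulf_eq0 (negPf kappa0) /= => /eqP -> _.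
pose S x := exists2 w, over s w & ev g' w = x.
have S1 : S 1%g by exists [::].
have SM x y : S x -> S y -> S (x * y)%g.
  by move=> [w nw <-] [w' nw' <-]; exists (w ++ w'); rewrite ?over_cat ?nw // ev_cat.
have SV x : S x -> S x^-1%g.
  by move=> [w nw <-]; exists (inverse_word w); rewrite ?over_inverse // ev_inverse.
have [x1 Sx1 px1] : exists2 x1, S x1 & pi x1 = (1, false).
  have [w [nw sw wE]] := u_onto; exists (ev g' w); first by exists w.
  by rewrite piev // sw wE.
have px1k a : pi (zpow x1 a) = (a, false).
  rewrite zpow_morph // px1; elim/int_rect: a => [//|n IHn|n IHn].
    by rewrite intS addrC zpowS IHn.
  apply: (mulIg ((1, false) : zpm)).
  have E : (- n.+1%:Z + 1 = - n%:Z)%R by rewrite intS; ring.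
  rewrite -zpowS E IHn; congr (_, _); rewrite /= intS; ring.
have Spi x : exists2 x', S x' & pi x' = pi x.
  have plus y : (pi y).2 = false -> exists2 x', S x' & pi x' = pi y.
    move=> sy; exists (zpow x1 (pi y).1); first exact: zpow_cond.
    by rewrite px1k -sy -surjective_pairing.
  case sx: (pi x).2; last exact: plus.
  have [w nw Rw] := gT x; pose t := ev g' w.
  have st : (pi t).2 = true.
    have [<- _] : zpm_eqmod (kappa * M1) (pi (ev g w)) (pi t).
      apply: R_pi; apply: (cong_sym (cR M1)); apply: (cong_ev (cR M1)) nw => i _; exact: gg'.
    by have [-> _] := R_pi Rw.
  have [|x' Sx' px'] := plus (x * t^-1)%g.
    by rewrite piM /= sx morph_inv //= st.
  exists (x' * t)%g; first by apply: SM => //; exists w.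
  by rewrite piM px' -piM mulgVK.
have SF : S (zpow c (size l)`!%:Z).
  have [lT sizeT lTP] := kernel_list.
  have /choice[x' xE] : forall i : nat, exists x', S x' /\ pi x' = pi (zpow c i%:Z).
    by move=> i; have [x' Sx' px'] := Spi (zpow c i%:Z); exists x'.
  have [|i [j [lt_ij le_j ij]]] := @pigeonhole _ lT (fun i => ((x' i)^-1 * zpow c i%:Z)%g).
    by move=> i; apply: lTP; rewrite piM morph_inv // (xE i).2 mulVg.
  rewrite sizeT in le_j.
  have Sij : S (zpow c (j - i)%N%:Z).
    have -> : zpow c (j - i)%N%:Z = (x' j * (x' i)^-1)%g.
      rewrite -subzn ?(ltnW lt_ij) // zpowD zpowN.
      apply: (mulIg (zpow c i%:Z)); rewrite mulgVK -mulgA ij mulgA mulgV mul1g; done.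
    by apply: SM; [apply: (xE j).1 | apply: SV; apply: (xE i).1].
  have /dvdnP[n ->] : (j - i %| (size l)`!)%N.
    by rewrite dvdn_fact // subn_gt0 lt_ij (leq_trans (leq_subr _ _)).
  by rewrite mulnC PoszM zpowM; apply: zpow_cond.
apply/pres_epimorphism; exists g' => // x.
have [w nw Rw] := gT x.
have [k ->] : R M1 x (ev g' w).
  apply: (cong_sym (cR M1)); apply: (cong_trans (cR M1)) (R_dvd M1M Rw).
  by apply: (cong_ev (cR M1)) nw => i _; apply: gg'.
suff [v nv vE] : S (zpow c (M1%:Z * k)).
  by exists (w ++ v); rewrite ?over_cat ?nw // ev_cat vE.
have /dvdnP[n ->] := FM1.
by rewrite mulnC PoszM -mulrA zpowM; apply: zpow_cond.
Qed.

End Lift.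

Let extend (n : nat) (f : 'I_n -> int) i : int := if insub i is Some j then f j else 0.

Let extendE n (f : 'I_n -> int) (j : 'I_n) : extend f j = f j.
Proof. by rewrite /extend valK. Qed.

Let colu_extend (z : 'cV[int]_s) : colu P (extend (fun j => z j 0)) = z.
Proof. by apply/colP => i; rewrite mxE extendE. Qed.

Definition pattern (e : {ffun 'I_s -> bool}) (i : nat) : bool :=
  if insub i is Some j then e j else false.

Lemma eq_cocycle_matrix eps eps' : (forall i, (i < s)%N -> eps i = eps' i) ->
  cocycle_matrix P eps = cocycle_matrix P eps'.
Proof.
move=> ee; congr col_mx.
  apply/matrixP => i j; rewrite !mxE.
  by have [] := eq_signed_ev (delta j) ee (over_relator (mem_nth [::] (ltn_ord i))).
rewrite /norm_row /flipped (eq_pick (Q := fun i : 'I_s => eps' i)) // => i.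
by rewrite /= ee.
Qed.

(** M is divisible by the constants D of [int_kernel_split] for all patterns of signs,
so that it can be chosen before g. The factor 2 excludes m1 = 1, which would allow
rank 0; the factorial is the one required by [lift_epimorphism]. *)
Lemma epimorphism_or_obstruction : exists2 M, (0 < M)%N &
  forall g, hom_modulo P (R M) g ->
    group_epimorphism (group_of P) L \/ translation_obstruction P (R M) g.
Proof.
have /choice[D DP] : forall e : {ffun 'I_s -> bool}, exists D, (0 < D)%N /\
    exists k (X : 'M[int]_(k, s)) (Y : 'M[int]_(s, k)) W,
    [/\ cocycle_matrix P (pattern e) *m Y = 0, X *m Y = 1%:M &
        D%:Z *: (1%:M - Y *m X) = W *m cocycle_matrix P (pattern e)].
  move=> e; have [k [X [Y [W [D [D_gt0 EY XY DE]]]]]] := int_kernel_split (cocycle_matrix P (pattern e)).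
  by exists D; split=> //; exists k, X, Y, W.
pose F := (size l)`!; pose B := (\prod_e D e)%N.
have B_gt0 : (0 < B)%N by apply: prodn_gt0 => e; have [] := DP e.
exists (F * 2 * B)%N; first by rewrite !muln_gt0 fact_gt0 B_gt0.
set M := (F * 2 * B)%N => g gR; have [gP gT] := gR.
pose eps i := (pi (g i)).2; pose v i := (pi (g i)).1.
pose e := [ffun i : 'I_s => eps i].
have [D_gt0 [k [X [Y [W []]]]]] := DP e.
have -> : cocycle_matrix P (pattern e) = cocycle_matrix P eps.
  apply: eq_cocycle_matrix => i lt_i; rewrite /pattern insubT /= ffunE.
  by [].
move=> EY XY DE; set d := D e in D_gt0 DE.
pose M1 := (F * 2 * \prod_(e' | e' != e) D e')%N.
have MM1 : M = (d * M1)%N by rewrite /M /M1 /B (bigD1 e) //= mulnCA.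
have M1M : (M1 %| M)%N by rewrite MM1 dvdn_mull.
have FM1 : (F %| M1)%N by rewrite /M1 -mulnA dvdn_mulr.
pose m1 := (kappa * M1)%N.
have mm1 : (kappa * M)%N = (d * m1)%N by rewrite MM1 mulnCA.
have m1_neq1 : ~ (m1%:Z %| 1)%Z.
  rewrite dvdz1 absz_nat /m1 /M1 => /eqP/(congr1 odd).
  by rewrite !oddM /= andbF /= andbF.
have piev w : over s w -> pi (ev g w) = (zev eps v w, zsg eps w).
  by move=> nw; rewrite ev_morph // -ev_signed; apply: eq_ev nw => i _; rewrite /signed -surjective_pairing.
have relP r : r \in rels -> zsg eps r = false /\ ((kappa * M)%N%:Z %| zev eps v r)%Z.
  move=> Pr; have := R_pi (gP r Pr); rewrite piev ?over_relator // morph_one // => -[/= -> ].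
  by rewrite subr0.
pose v' := normalize P eps v.
have [K KE] : exists K, cocycle_matrix P eps *m colu P v' = (kappa * M)%N%:Z *: K.
  apply: cocycle_matrix_dvd; last exact: norm_normalize.
  by move=> r Pr; have [sr dr] := relP r Pr; rewrite zev_normalize.
have d0 : d%:Z != 0 by rewrite eqz_nat -lt0n.
have DV : colu P v' - Y *m (X *m colu P v') = m1%:Z *: (W *m K).
  apply: (scale_mx_inj d0); rewrite scalerA -PoszM -mm1.
  rewrite -{1}(mul1mx (colu P v')) mulmxA -mulmxBl (scalemxAl d%:Z) DE -mulmxA KE.
  by rewrite scalemxAr.
set y := X *m colu P v' in DV.
have [a aP] : exists a : 'rV[int]_s, (m1%:Z %| ((a *m Y *m y) 0%R 0%R - 1)%R)%Z.
  have [x1 px1] := pi_onto; have [w nw Rw] := gT x1.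
  have [] := R_pi Rw; rewrite piev // px1 /= => sw dw.
  exists (\row_(j < s) zev eps (delta j) w); set a := \row_j _.
  have := zev_row eps v' nw; rewrite zev_normalize // -/a.
  rewrite -[colu P v'](subrK (Y *m y)) DV mulmxDr mxE -scalemxAr [X in X + _]mxE mulmxA => E.
  have -> : (a *m Y *m y) 0 0 - 1 = (zev eps v w - 1) - m1%:Z * (a *m (W *m K)) 0 0.
    by rewrite E; ring.
  apply: rpredB; last exact: dvdz_mulr.
  by apply: dvdz_trans dw; rewrite mm1 PoszM dvdz_mull.
have lift (y' : 'cV[int]_k) : (forall i, (m1%:Z %| (y' i 0%R - y i 0%R)%R)%Z) ->
    (exists a' : 'rV[int]_k, (a' *m y') 0 0 = 1) -> group_epimorphism (group_of P) L.
  move=> yy' [a' ay']; pose z := extend (fun j => (Y *m y') j 0).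
  have zE : colu P z = Y *m y' by apply: colu_extend.
  have [z_rels z_norm] : (forall r, r \in rels -> zev eps z r = 0) /\ norm_value P eps z = 0.
    by apply: cocycle_matrix0; rewrite zE mulmxA EY mul0mx.
  pose u i := z i + norm_value P eps v * flips eps i.
  have uE w : zsg eps w = false -> zev eps u w = zev eps z w.
    move=> sw; have := zev_lin eps 1 (norm_value P eps v) z (flips eps) w.
    rewrite zev_flips sw mulr0 addr0 mul1r => <-.
    by congr zev; apply: funext => i; rewrite /u mul1r.
  apply: (lift_epimorphism M1M FM1 gR (u := u)).
  - move=> i lt_i.
    have /choice[q qE] : forall j : 'I_k, exists q, y' j 0 - y j 0 = q * m1%:Z.
      by move=> j; apply/dvdzP.
    have y'E : y' = y + m1%:Z *: \col_j q j.
      apply/colP => j; rewrite [RHS]mxE [X in _ = _ + X]mxE [X in _ = _ + _ * X]mxE.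
      by rewrite [_ * q j]mulrC -qE addrC subrK.
    have uvE : colu P z - colu P v' = m1%:Z *: (Y *m \col_j q j - W *m K).
      rewrite zE y'E mulmxDr scalerBr -DV -scalemxAr opprB.
      by rewrite [in RHS]addrA [X in X - _ = _]addrC.
    have -> : u i - (pi (g i)).1 = (colu P z - colu P v') (Ordinal lt_i) 0.
      by rewrite !mxE /u /v' /normalize -/(v i) /=; ring.
    by rewrite uvE mxE dvdz_mulr.
  - by move=> r Pr; have [sr _] := relP r Pr; rewrite uE // z_rels.
  have [w [nw sw wE]] := translation_word eps (a' *m X).
  exists w; split=> //; rewrite uE // wE // zE -mulmxA (mulmxA X) XY mul1mx.
  exact: ay'.
have [epi|nepi] := pselect (group_epimorphism (group_of P) L); [by left | right].
destruct k as [|[|k]].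
- by case: m1_neq1; move: aP; rewrite mxE big_ord0 sub0r rpredN.
- pose z := extend (fun j => Y j 0).
  have zE : colu P z = Y by apply: colu_extend.
  have [z_rels z_norm] : (forall r, r \in rels -> zev eps z r = 0) /\ norm_value P eps z = 0.
    by apply: cocycle_matrix0; rewrite zE EY.
  have [kw [nkw skw kwE]] := translation_word eps X.
  have yE : (pi (ev g kw)).1 = y 0 0.
    by rewrite piev //= -(zev_normalize P v skw) kwE // norm_normalize.
  (* If y is 1 or -1 modulo m1, the cocycle lifts. *)
  have unit1 (b : int) : b = 1 \/ b = -1 -> ~ ((kappa * M)%N%:Z %| (y 0%R 0%R - b)%R)%Z.
    move=> b1 dy; case: nepi; apply: (lift b%:M).
      move=> i; rewrite ord1 [X in (X - _)%R]mxE eqxx mulr1n -opprB rpredN.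
      by apply: dvdz_trans dy; rewrite mm1 PoszM dvdz_mull.
    exists b%:M; rewrite -scalar_mxM mxE eqxx mulr1n.
    by case: b1 => ->.
  (* N = d + 1 is prime to d, so modulo N the factor d can be cancelled. *)
  exists (kappa * M)%N, d.+1, pi, z, kw; rewrite -/eps; split.
  + by split=> //; exact: R_pi.
  + split=> // v2 v2P; pose v2' := normalize P eps v2.
    have [K2 K2E] : exists K2, cocycle_matrix P eps *m colu P v2' = d.+1%:Z *: K2.
      apply: cocycle_matrix_dvd; last exact: norm_normalize.
      by move=> r Pr; have [sr _] := relP r Pr; rewrite zev_normalize // v2P.
    have E2 : d%:Z *: (colu P v2' - Y *m (X *m colu P v2')) = d.+1%:Z *: (W *m K2).
      rewrite -{1}(mul1mx (colu P v2')) mulmxA -mulmxBl (scalemxAl d%:Z) DE -mulmxA K2E.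
      by rewrite scalemxAr.
    set T := colu P v2' - Y *m (X *m colu P v2') in E2.
    have TE : T = d.+1%:Z *: (T - W *m K2).
      by rewrite scalerBr -E2 -scalerBl intS addrK scale1r.
    exists ((X *m colu P v2') 0 0), (norm_value P eps v2) => i lt_i.
    have -> : v2 i - ((X *m colu P v2') 0 0 * z i + norm_value P eps v2 * flips eps i) = T (Ordinal lt_i) 0.
      have zi : z i = Y (Ordinal lt_i) 0 by rewrite -zE mxE.
      have TiE (x2 : 'cV[int]_1) : (colu P v2' - Y *m x2) (Ordinal lt_i) 0 =
          v2' i - Y (Ordinal lt_i) 0 * x2 0 0 by rewrite !mxE big_ord1.
      by rewrite /T TiE -zi /v2' /normalize; ring.
    by rewrite TE mxE dvdz_mulr.
  + by move=> r Pr; have [sr _] := relP r Pr; rewrite z_rels.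
  split=> //; first by rewrite kwE // zE XY mxE.
  rewrite yE; split; first by apply: unit1; left.
  by rewrite -[1]opprK; apply: unit1; right.
have [y' yy' a'P] := unimodular_lift aP.
by case: nepi; apply: lift y' yy' a'P.
Qed.

Lemma obstruction_infinite : ~ group_epimorphism (group_of P) L ->
  obstruction (presentation_code P) (presentation_code Q).
Proof.
move=> nepi; have [M M_gt0 alt] := epimorphism_or_obstruction.
have [d [rep [d_gt0 rep0 rep_ex rep_inj]]] :=
  congruence_numbering (cR M) (covering_R M_gt0).
apply: (obstruction_complete (cR M) rep0 d_gt0 rep_ex rep_inj).
by move=> g /alt[].
Qed.

End InfiniteTarget.

End VirtuallyCyclicTargets.

Lemma obstruction_virtually_cyclic P Q : virtually_cyclic (group_of Q) ->
  ~ group_epimorphism (group_of P) (group_of Q) ->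
  obstruction (presentation_code P) (presentation_code Q).
Proof.
case/virtually_cyclic_structure => [[l lT]|]; first exact: obstruction_finite lT.
move=> [pi [c [kappa [l [[piM pi1] [k0 pic] cpi cl]]]]].
exact: obstruction_infinite piM pi1 k0 pic cpi cl.
Qed.

(** * The uniform epimorphism problem *)

Lemma solvable_of_obstruction (D : groupType -> Prop) :
  (forall P Q, D (group_of Q) -> ~ group_epimorphism (group_of P) (group_of Q) ->
     obstruction (presentation_code P) (presentation_code Q)) ->
  uniform_epimorphism_problem_solvable D.
Proof.
move=> Dobs; have [p pP] := search_program semidec_epimorphism_certificate semidec_obstruction.
exists p => P Q DQ /=; pose e i := if i is 0%N then presentation_code P else presentation_code Q.
have [|[]|Y N] := pP e.
- have [epi|nepi] := pselect (group_epimorphism (group_of P) (group_of Q)).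
    by left; apply/epimorphism_certificateP.
  by right; apply: Dobs.
- by move=> /epimorphism_certificateP epi /obstruction_sound.
by split=> [/epimorphism_certificateP|nepi]; [exact: Y | apply: N => /epimorphism_certificateP].
Qed.

Theorem theorem1p4 :
  uniform_epimorphism_problem_solvable fg_abelian_times_finite /\
  uniform_epimorphism_problem_solvable virtually_cyclic.
Proof.
split; apply: solvable_of_obstruction => P Q.
  exact: obstruction_lattice.
exact: obstruction_virtually_cyclic.
Qed.
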